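(* Let $M$ be a compact connected surface (isometrically immersed) in $\mathbb{E}^3$ whose mean curvature function $\alpha$ is nowhere zero. Then $M$ has conformal Laplace transformation if and only if the following two conditions hold: (1) $\nabla \alpha^2$ is a principal direction on the open subset $U$ of $M$ where $\nabla\alpha^2\neq 0$; and (2) the Gauss curvature $K$ of $M$ is given by $K=\alpha^2 - \dfrac{1}{16\alpha^6}|\nabla\alpha|^4$.
   Context: Manifolds and immersions are smooth and connected. $H=\frac12\operatorname{trace}h$ is the mean curvature vector and $\alpha=\|H\|$ the mean curvature function; $\nabla f$ denotes the gradient of a function $f$ on $M$. $\Delta=-\operatorname{trace}\nabla^2$ is the Laplace operator of $M$ and $x$ the immersion. The Laplace map is $L:M\to\mathbb{E}^3$, $L(p)=(\Delta x)(p)=-2H(p)$; the Laplace transformation $\mathcal L:M\to L(M)$ is $L$ regarded as a map onto its image. $\mathcal L$ is conformal if there is a strictly positive function $\rho$ on $M$ with $\langle dL(X),dL(Y)\rangle=\rho^2\langle X,Y\rangle$ for all tangent vectors $X,Y$ at a common point. A principal direction is an eigenvector of the shape operator. *)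

(* Defs.v *)
From HB Require Import structures.
From mathcomp Require Import all_boot all_order all_algebra.
From mathcomp Require Import all_classical all_reals all_analysis.

Set Implicit Arguments.
Unset Strict Implicit.
Unset Printing Implicit Defensive.

Import Order.TTheory GRing.Theory Num.Theory.
Import numFieldNormedType.Exports.

Local Open Scope classical_set_scope.
Local Open Scope ring_scope.

(* The library norm on row vectors is the sup norm; Euclidean length is
   [enorm]. *)
Definition dot (R : realType) (n : nat) (u v : 'rV[R]_n) : R :=
  \sum_(k < n) u 0 k * v 0 k.

Definition enorm (R : realType) (n : nat) (u : 'rV[R]_n) : R :=
  Num.sqrt (dot u u).

(* Addition in ['I_3] is modulo 3. *)
Definition cross (R : realType) (u v : 'rV[R]_3) : 'rV[R]_3 :=
  \row_(k < 3) (u 0 (k + 1) * v 0 (k + 2) - u 0 (k + 2) * v 0 (k + 1)).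

Definition partial (R : realType) (V : normedModType R) (i : 'I_2)
    (F : 'rV[R]_2 -> V) (q : 'rV[R]_2) : V :=
  'D_(delta_mx 0 i) F q.

Fixpoint class_C (R : realType) (V : normedModType R) (k : nat)
    (W : set 'rV[R]_2) (F : 'rV[R]_2 -> V) : Prop :=
  (forall q, W q -> {for q, continuous F}) /\
  if k is k'.+1 then
    forall i : 'I_2,
      (forall q, W q -> derivable F q (delta_mx 0 i)) /\
      class_C k' W (partial i F)
  else True.

(* Meant for open [W]; the values of [F] outside [W] are then irrelevant. *)
Definition smooth_on (R : realType) (V : normedModType R)
    (W : set 'rV[R]_2) (F : 'rV[R]_2 -> V) : Prop :=
  forall k, class_C k W F.

(* [chart_inv] is only meaningful on [chart_cod]. *)
Record chart (R : realType) (M : topologicalType) := Chart {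
  chart_dom : set M;
  chart_map : M -> 'rV[R]_2;
  chart_inv : 'rV[R]_2 -> M;
  chart_dom_open : open chart_dom;
  chart_cod_open : open (chart_map @` chart_dom);
  chart_map_cont : {within chart_dom, continuous chart_map};
  chart_inv_cont : {within chart_map @` chart_dom, continuous chart_inv};
  chart_mapK : forall p, chart_dom p -> chart_inv (chart_map p) = p
}.

Definition chart_cod (R : realType) (M : topologicalType) (c : chart R M) :
  set 'rV[R]_2 := chart_map c @` chart_dom c.

(* A smooth 2-manifold without boundary.  The preferred chart [chart_at p]
   identifies the tangent space at [p] with ['rV[R]_2]. *)
Record smooth_surface (R : realType) (M : topologicalType) := SmoothSurface {
  surface_hausdorff : hausdorff_space M;
  surface_countable : @second_countable M;
  atlas : set (chart R M);
  chart_at : M -> chart R M;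
  chart_at_atlas : forall p, atlas (chart_at p);
  chart_at_dom : forall p, chart_dom (chart_at p) p;
  atlas_compatible : forall c d, atlas c -> atlas d ->
    smooth_on (chart_map c @` (chart_dom c `&` chart_dom d))
      (chart_map d \o chart_inv c)
}.

Section LocalGeometry.

(* [X] is an immersion of an open subset of the plane, with the induced
   metric. *)
Variables (R : realType) (X : 'rV[R]_2 -> 'rV[R]_3).

Definition metric_mx (q : 'rV[R]_2) : 'M[R]_2 :=
  \matrix_(i, j) dot (partial i X q) (partial j X q).

Definition metric_inv (q : 'rV[R]_2) : 'M[R]_2 := invmx (metric_mx q).

(* Coefficient of the k-th coordinate field in the Levi-Civita derivative of
   the j-th coordinate field along the i-th one. *)
Definition christoffel (i j k : 'I_2) (q : 'rV[R]_2) : R :=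
  2^-1 * \sum_(l < 2) metric_inv q k l *
    (partial i (fun r => metric_mx r j l) q
     + partial j (fun r => metric_mx r i l) q
     - partial l (fun r => metric_mx r i j) q).

Definition local_hessian (V : normedModType R) (F : 'rV[R]_2 -> V)
    (i j : 'I_2) (q : 'rV[R]_2) : V :=
  partial i (partial j F) q - \sum_(k < 2) christoffel i j k q *: partial k F q.

Definition local_laplacian (V : normedModType R) (F : 'rV[R]_2 -> V)
    (q : 'rV[R]_2) : V :=
  - \sum_(i < 2) \sum_(j < 2) metric_inv q i j *: local_hessian F i j q.

(* Gauss formula: the second fundamental form is the difference of the ambient
   derivative and the (push-forward of the) Levi-Civita derivative. *)
Definition local_second_form (i j : 'I_2) (q : 'rV[R]_2) : 'rV[R]_3 :=
  partial i (partial j X) q - \sum_(k < 2) christoffel i j k q *: partial k X q.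

Definition local_mean_curvature_vector (q : 'rV[R]_2) : 'rV[R]_3 :=
  2^-1 *: \sum_(i < 2) \sum_(j < 2) metric_inv q i j *: local_second_form i j q.

Definition local_unit_normal (q : 'rV[R]_2) : 'rV[R]_3 :=
  let N := cross (partial 0 X q) (partial 1 X q) in (enorm N)^-1 *: N.

(* Acts on row vectors by [v |-> v *m local_shape_mx q]. *)
Definition local_shape_mx (q : 'rV[R]_2) : 'M[R]_2 :=
  (\matrix_(i, j) dot (local_second_form i j q) (local_unit_normal q))
    *m metric_inv q.

Definition local_gradient (F : 'rV[R]_2 -> R) (q : 'rV[R]_2) : 'rV[R]_2 :=
  (\row_(i < 2) partial i F q) *m metric_inv q.

End LocalGeometry.

Section SurfaceGeometry.

Variables (R : realType) (M : topologicalType) (S : smooth_surface R M).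

Definition coord (p : M) : 'rV[R]_2 := chart_map (chart_at S p) p.

Definition in_coord (V : Type) (p : M) (f : M -> V) : 'rV[R]_2 -> V :=
  f \o chart_inv (chart_at S p).

Definition smooth_map (V : normedModType R) (f : M -> V) : Prop :=
  forall c, atlas S c -> smooth_on (chart_cod c) (f \o chart_inv c).

Definition differential (V : normedModType R) (f : M -> V) (p : M)
    (v : 'rV[R]_2) : V :=
  'D_v (in_coord p f) (coord p).

Variable x : M -> 'rV[R]_3.

Definition immersion : Prop :=
  smooth_map x /\ forall p, injective (differential x p).

Definition metric (p : M) (v w : 'rV[R]_2) : R :=
  dot (differential x p v) (differential x p w).

Definition gradient (f : M -> R) (p : M) : 'rV[R]_2 :=
  local_gradient (in_coord p x) (in_coord p f) (coord p).

Definition metric_norm (p : M) (v : 'rV[R]_2) : R := Num.sqrt (metric p v v).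

Definition laplacian (V : normedModType R) (f : M -> V) (p : M) : V :=
  local_laplacian (in_coord p x) (in_coord p f) (coord p).

Definition mean_curvature_vector (p : M) : 'rV[R]_3 :=
  local_mean_curvature_vector (in_coord p x) (coord p).

Definition mean_curvature (p : M) : R := enorm (mean_curvature_vector p).

(* The unit normal, hence the shape operator, depends up to sign on the
   orientation of the preferred chart; [principal_direction] and
   [gauss_curvature] do not. *)
Definition shape_operator (p : M) (v : 'rV[R]_2) : 'rV[R]_2 :=
  v *m local_shape_mx (in_coord p x) (coord p).

Definition principal_direction (p : M) (v : 'rV[R]_2) : Prop :=
  v != 0 /\ exists kappa : R, shape_operator p v = kappa *: v.

Definition gauss_curvature (p : M) : R :=
  \det (local_shape_mx (in_coord p x) (coord p)).

Definition laplace_map : M -> 'rV[R]_3 := laplacian x.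

Definition conformal_laplace_transformation : Prop :=
  exists rho : M -> R, (forall p, 0 < rho p) /\
    forall p v w,
      dot (differential laplace_map p v) (differential laplace_map p w)
      = rho p ^+ 2 * metric p v w.

End SurfaceGeometry.

(* Main.v *)
(** Put [u = alpha^2 = <H,H>], [w = du], [W = |w|^2] and [beta = <II,H>], so
    that [tr beta = 2 u] and [dH(Y)] has tangential part [-beta Y] and normal
    part [w(Y) H / (2 u)].  Conformality reads
    [4 (beta g^-1 beta + w^T w / (4 u)) = rho^2 g], and Cayley-Hamilton for
    [beta g^-1] turns it into [beta = u g - (2 w^T w - W g) / (16 u^2)], which
    gives (1) and (2).

    Conversely, (1) and (2) only give
    [beta = u g + eps (2 w^T w - W g) / (16 u^2)] with a sign [eps] wherever
    [W <> 0], and [beta = u g] elsewhere.  The Codazzi equation then forces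
    [Phi := (4 u tr(Hess u) - 5 W) / (16 u^3)] to equal [eps] where [W <> 0],
    while [Phi = 0] on open sets where [W = 0].  Hence the continuous function
    [Phi] takes values in [{-1, 0, 1}] and is constant on the connected [M].
    As [Phi <= 0] at a maximum of [u] and [Phi >= 0] at a minimum, [Phi = 0],
    so [W] vanishes identically: [M] is umbilic and [rho = 2 u] works. *)

(* Why a sign is lost in the converse: (1) fixes only the axes of the trace-free part of beta and
   (2) only its determinant, that is, its size. Conformality is the case [eps = -1]. A priori [eps]
   may jump across the zero set of [W], about whose shape nothing is known. [Phi] is the remedy: it
   is smooth across that set, and it comes from contracting the Codazzi equation with a vector
   annihilated by [w], which gives [eps * Phi = 1] wherever [eps] is locally constant.

   The other obstacle is bookkeeping. Every point carries its own chart, and the unit normal is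
   fixed only up to sign. Hence [H] itself serves as the normal vector, and [u], beta, [W], tr(Hess
   u) do not depend on the orientation. Passing from one chart to another rests on a single
   observation: the failure of the Christoffel symbols to transform correctly is the coefficient
   vector of something both tangent and normal to the surface, hence zero. *)
Require Import Defs.
From HB Require Import structures.
From mathcomp Require Import all_boot all_order all_algebra.
From mathcomp Require Import all_classical all_reals all_analysis.
From mathcomp Require Import ring lra.

Import Order.TTheory GRing.Theory Num.Theory.
Import numFieldNormedType.Exports.

Local Open Scope classical_set_scope.
Local Open Scope ring_scope.

Set Implicit Arguments.
Unset Strict Implicit.
Unset Printing Implicit Defensive.

(** * Smooth functions on open subsets of the plane *)

Section SmoothClosure.
Context {R : realType}.
Implicit Types (W : set 'rV[R]_2) (q : 'rV[R]_2).

Lemma open_near_eq (T : Type) W (F G : 'rV[R]_2 -> T) q :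
  open W -> W q -> {in W, F =1 G} -> \forall r \near q, F r = G r.
Proof.
move=> oW Wq FG; apply: filterS (open_nbhs_nbhs (conj oW Wq)) => r Wr.
by apply: FG; rewrite inE.
Qed.

Lemma partial_eq_on (V : normedModType R) W (F G : 'rV[R]_2 -> V) i q :
  open W -> W q -> {in W, F =1 G} -> partial i F q = partial i G q.
Proof. by move=> oW Wq FG; apply: near_eq_derive; exact: open_near_eq FG. Qed.

Lemma near_eq_continuous (T U : topologicalType) (F G : T -> U) (a : T) :
  (\forall r \near a, F r = G r) -> {for a, continuous F} ->
  {for a, continuous G}.
Proof.
move=> FG cF; have FGa : F a = G a := nbhs_singleton FG.
apply: (@cvg_trans _ (F @ a)); first exact: near_eq_cvg.
by rewrite -FGa.
Qed.

(** Derivatives see only a neighbourhood, so agreement on an open set passes to every order. Later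
    proofs thus replace a function by a formula valid only on the image of a chart. *)
Lemma class_C_eq (V : normedModType R) k W (F G : 'rV[R]_2 -> V) :
  open W -> {in W, F =1 G} -> class_C k W F -> class_C k W G.
Proof.
move=> oW; elim: k F G => [|k IHk] F G FG [cF dF]; split.
- by move=> q Wq; exact: near_eq_continuous (open_near_eq oW Wq FG) (cF q Wq).
- by [].
- by move=> q Wq; exact: near_eq_continuous (open_near_eq oW Wq FG) (cF q Wq).
- move=> i; have [dFi CFi] := dF i; split.
    by move=> q Wq; exact: near_eq_derivable (open_near_eq oW Wq FG) (dFi q Wq).
  apply: IHk CFi => q /set_mem Wq; exact: partial_eq_on FG.
Qed.

Lemma class_CW (V : normedModType R) k W (F : 'rV[R]_2 -> V) :
  class_C k.+1 W F -> class_C k W F.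
Proof.
elim: k F => [|k IHk] F [cF dF]; split => // i.
by have [dFi CFi] := dF i; split => //; exact: IHk.
Qed.

Lemma class_C_sub (V : normedModType R) k W W' (F : 'rV[R]_2 -> V) :
  W' `<=` W -> class_C k W F -> class_C k W' F.
Proof.
move=> sW; elim: k F => [|k IHk] F [cF dF]; split => //.
- by move=> q /sW; exact: cF.
- by move=> q /sW; exact: cF.
- by move=> i; have [dFi CFi] := dF i; split; [move=> q /sW; exact: dFi|exact: IHk].
Qed.

Lemma class_C_continuous (V : normedModType R) k W (F : 'rV[R]_2 -> V) q :
  class_C k W F -> W q -> {for q, continuous F}.
Proof. by case: k => [|k] [cF _] Wq; exact: cF. Qed.

Lemma class_C_partial (V : normedModType R) k W (F : 'rV[R]_2 -> V) i :
  class_C k.+1 W F -> class_C k W (partial i F).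
Proof. by move=> [_ dF]; exact: (dF i).2. Qed.

Lemma class_C_derivable (V : normedModType R) k W (F : 'rV[R]_2 -> V) i q :
  class_C k.+1 W F -> W q -> derivable F q (delta_mx 0 i).
Proof. by move=> [_ dF] Wq; exact: (dF i).1. Qed.

Lemma smooth_eq (V : normedModType R) W (F G : 'rV[R]_2 -> V) :
  open W -> {in W, F =1 G} -> smooth_on W F -> smooth_on W G.
Proof. by move=> oW FG sF k; exact: class_C_eq FG (sF k). Qed.

Lemma smooth_sub (V : normedModType R) W W' (F : 'rV[R]_2 -> V) :
  W' `<=` W -> smooth_on W F -> smooth_on W' F.
Proof. by move=> sW sF k; exact: class_C_sub sW (sF k). Qed.

Lemma smooth_partial (V : normedModType R) W (F : 'rV[R]_2 -> V) i :
  smooth_on W F -> smooth_on W (partial i F).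
Proof. by move=> sF k; exact: class_C_partial (sF k.+1). Qed.

Lemma smooth_derivable (V : normedModType R) W (F : 'rV[R]_2 -> V) i q :
  smooth_on W F -> W q -> derivable F q (delta_mx 0 i).
Proof. by move=> sF; exact: class_C_derivable (sF 1%N). Qed.

Lemma smooth_continuous (V : normedModType R) W (F : 'rV[R]_2 -> V) q :
  smooth_on W F -> W q -> {for q, continuous F}.
Proof. by move=> sF; exact: class_C_continuous (sF 0%N). Qed.

Lemma class_C_cst (V : normedModType R) k W (c : V) :
  class_C k W (fun _ => c).
Proof.
have cC (c' : V) : forall q, W q -> {for q, continuous (fun _ => c')}.
  by move=> q _; exact: cst_continuous.
elim: k c => [|k IHk] c; first by split; [exact: cC|].
split; first exact: cC.
move=> i; split; first by move=> q _; exact: derivable_cst.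
rewrite (_ : partial i _ = fun _ => 0) //.
by apply/funext => q; rewrite /partial derive_cst.
Qed.

Lemma class_CD (V : normedModType R) k W (F G : 'rV[R]_2 -> V) :
  open W -> class_C k W F -> class_C k W G ->
  class_C k W (fun q => F q + G q).
Proof.
move=> oW; elim: k F G => [|k IHk] F G [cF dF] [cG dG]; split => //.
- by move=> q Wq; apply: (@continuousD _ _ _ F G); [exact: cF|exact: cG].
- by move=> q Wq; apply: (@continuousD _ _ _ F G); [exact: cF|exact: cG].
move=> i; have [dFi CFi] := dF i; have [dGi CGi] := dG i; split.
  by move=> q Wq; apply: (@derivableD _ _ _ F G); [exact: dFi|exact: dGi].
apply: class_C_eq (IHk _ _ CFi CGi) => // q /set_mem Wq.
by rewrite /partial -deriveD//; [exact: dFi|exact: dGi].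
Qed.

Lemma class_CM k W (f g : 'rV[R]_2 -> R) :
  open W -> class_C k W f -> class_C k W g ->
  class_C k W (fun q => f q * g q).
Proof.
move=> oW; elim: k f g => [|k IHk] f g Cf Cg;
  have [cf df] := Cf; have [cg dg] := Cg; split => //.
- by move=> q Wq; apply: (@continuousM _ _ f g); [exact: cf|exact: cg].
- by move=> q Wq; apply: (@continuousM _ _ f g); [exact: cf|exact: cg].
move=> i; have [dfi Cfi] := df i; have [dgi Cgi] := dg i; split.
  by move=> q Wq; apply: (@derivableM _ _ f g); [exact: dfi|exact: dgi].
apply: class_C_eq (class_CD oW (IHk _ _ (class_CW Cf) Cgi)
                               (IHk _ _ (class_CW Cg) Cfi)) => // q /set_mem Wq.
by rewrite /partial -[_ * _]/(_ *: _) -[g q * _]/(_ *: _) -deriveM//; [exact: dfi|exact: dgi].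
Qed.

Lemma class_CV k W (f : 'rV[R]_2 -> R) :
  open W -> (forall q, W q -> f q != 0) -> class_C k W f ->
  class_C k W (fun q => (f q)^-1).
Proof.
move=> oW f0; elim: k => [|k IHk] Cf; have [cf df] := Cf; split => //.
- by move=> q Wq; apply: (@continuousV _ _ f); [exact: f0|exact: cf].
- by move=> q Wq; apply: (@continuousV _ _ f); [exact: f0|exact: cf].
move=> i; have [dfi Cfi] := df i; split.
  by move=> q Wq; apply: (@derivableV _ _ f); [exact: f0|exact: dfi].
(* The derivative of [1 / f] is [- (1 / f) (1 / f) f'], in which [1 / f] is needed only to the order
   [k] of the induction hypothesis. *)
have CV := IHk (class_CW Cf).
have C1 := class_C_cst k W (-1 : R).
have := class_CM oW C1 (class_CM oW (class_CM oW CV CV) Cfi).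
apply: class_C_eq => // q /set_mem Wq.
rewrite /partial deriveV//; [|exact: f0|exact: dfi].
by rewrite -[_ *: _]/(_ * _) -exprVn expr2 mulN1r mulNr.
Qed.

Lemma smooth_cst (V : normedModType R) W (c : V) : smooth_on W (fun _ => c).
Proof. by move=> k; exact: class_C_cst. Qed.

Lemma smoothD (V : normedModType R) W (F G : 'rV[R]_2 -> V) :
  open W -> smooth_on W F -> smooth_on W G -> smooth_on W (fun q => F q + G q).
Proof. by move=> oW sF sG k; exact: class_CD. Qed.

Lemma smoothM W (f g : 'rV[R]_2 -> R) :
  open W -> smooth_on W f -> smooth_on W g -> smooth_on W (fun q => f q * g q).
Proof. by move=> oW sF sG k; exact: class_CM. Qed.

Lemma smoothV W (f : 'rV[R]_2 -> R) :
  open W -> (forall q, W q -> f q != 0) -> smooth_on W f ->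
  smooth_on W (fun q => (f q)^-1).
Proof. by move=> oW f0 sF k; exact: class_CV. Qed.

Lemma smoothN W (f : 'rV[R]_2 -> R) :
  open W -> smooth_on W f -> smooth_on W (fun q => - f q).
Proof.
move=> oW sf; have := smoothM oW (smooth_cst W (-1 : R)) sf.
apply: smooth_eq => // q _.
by rewrite mulN1r.
Qed.

Lemma smoothB W (f g : 'rV[R]_2 -> R) :
  open W -> smooth_on W f -> smooth_on W g -> smooth_on W (fun q => f q - g q).
Proof. by move=> oW sf sg; apply: smoothD => //; exact: smoothN. Qed.

Lemma smoothX W (f : 'rV[R]_2 -> R) n :
  open W -> smooth_on W f -> smooth_on W (fun q => f q ^+ n).
Proof.
move=> oW sf; elim: n => [|n IHn]; first exact: (smooth_cst W (_ : R)).
by under eq_fun do rewrite exprS; exact: smoothM.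
Qed.

Lemma smooth_sum W (I : Type) (s : seq I) (f : I -> 'rV[R]_2 -> R) :
  open W -> (forall i, smooth_on W (f i)) ->
  smooth_on W (fun q => \sum_(i <- s) f i q).
Proof.
move=> oW sf; elim: s => [|a s IHs].
  by under eq_fun do rewrite big_nil; exact: (smooth_cst W (_ : R)).
by under eq_fun do rewrite big_cons; exact: smoothD.
Qed.

Lemma partial_coord n (F : 'rV[R]_2 -> 'rV[R]_n) i q k :
  derivable F q (delta_mx 0 i) ->
  partial i F q 0 k = partial i (fun r => F r 0 k) q.
Proof. by move=> dF; rewrite /partial derive_mx// mxE. Qed.

Lemma continuous_coord (T : topologicalType) n (F : T -> 'rV[R]_n) (a : T) :
  {for a, continuous F} <-> forall k, {for a, continuous (fun r => F r 0 k)}.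
Proof.
split=> [cF k|cF].
  apply: (@continuous_comp _ _ _ F (fun u : 'rV[R]_n => u 0 k)) => //.
  exact: coord_continuous.
apply/cvgrPdist_le => /= e e0; near=> r.
rewrite [leLHS]/Num.Def.normr/= mx_normrE (bigmax_le _ (ltW e0))//= => i _.
rewrite !mxE (ord1 i.1); move: (i.2) => {i}; near: r.
apply: filter_forall => /= j; by have /cvgrPdist_le := cF j; exact.
Unshelve. all: by end_near. Qed.

(** Brings row-valued functions back to the scalar sum, product and quotient rules. *)
Lemma class_C_coord n k W (F : 'rV[R]_2 -> 'rV[R]_n) :
  open W -> class_C k W F <-> forall j, class_C k W (fun r => F r 0 j).
Proof.
move=> oW; elim: k F => [|k IHk] F; split.
- by move=> [cF _] j; split => // q Wq; move/(_ q Wq)/continuous_coord: cF; exact.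
- by move=> CF; split => // q Wq; apply/continuous_coord => j; apply: (CF j).1.
- move=> [cF dF] j; split.
    by move=> q Wq; move/(_ q Wq)/continuous_coord: cF; exact.
  move=> i; have [dFi CFi] := dF i; split.
    by move=> q Wq; move: (dFi q Wq) => /derivable_mxP /(_ 0 j).
  move/IHk : CFi => /(_ j); apply: class_C_eq => // q /set_mem Wq.
  by rewrite partial_coord//; exact: dFi.
- move=> CF; split.
    by move=> q Wq; apply/continuous_coord => j; apply: (CF j).1.
  have dF i q : W q -> derivable F q (delta_mx 0 i).
    move=> Wq; apply/derivable_mxP => a b; rewrite (ord1 a).
    by have [_ /(_ i)[+ _]] := CF b; exact.
  move=> i; split; first by move=> q Wq; exact: dF.
  apply/IHk => j; have [_ /(_ i)[_]] := CF j; apply: class_C_eq => // q /set_mem Wq.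
  by rewrite partial_coord//; exact: dF.
Qed.

Lemma smooth_coord n W (F : 'rV[R]_2 -> 'rV[R]_n) :
  open W -> smooth_on W F <-> forall j, smooth_on W (fun r => F r 0 j).
Proof.
move=> oW; split=> [sF j k|sF k]; first by have /class_C_coord := sF k; exact.
by apply/class_C_coord => // j; exact: sF.
Qed.

Lemma smoothZ n W (f : 'rV[R]_2 -> R) (F : 'rV[R]_2 -> 'rV[R]_n) :
  open W -> smooth_on W f -> smooth_on W F ->
  smooth_on W (fun q => f q *: F q).
Proof.
move=> oW sf /smooth_coord sF; apply/smooth_coord => // j.
by under eq_fun do rewrite mxE; apply: smoothM => //; exact: sF.
Qed.

Lemma smooth_sum_rV n W (I : Type) (s : seq I) (f : I -> 'rV[R]_2 -> 'rV[R]_n) :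
  open W -> (forall i, smooth_on W (f i)) ->
  smooth_on W (fun q => \sum_(i <- s) f i q).
Proof.
move=> oW sf; elim: s => [|a s IHs].
  by under eq_fun do rewrite big_nil; exact: (smooth_cst W (0 : 'rV[R]_n)).
by under eq_fun do rewrite big_cons; exact: smoothD.
Qed.

Lemma smooth_dot n W (F G : 'rV[R]_2 -> 'rV[R]_n) :
  open W -> smooth_on W F -> smooth_on W G ->
  smooth_on W (fun q => dot (F q) (G q)).
Proof.
move=> oW /smooth_coord sF /smooth_coord sG; apply: smooth_sum => // k.
by apply: smoothM => //; [exact: sF|exact: sG].
Qed.

End SmoothClosure.

(** * Differentiability, symmetry of second derivatives and local maxima *)

Section Lines.
Context {R : realType}.

Lemma is_derive_line (V : normedModType R) (f : V -> R) (a v : V) (t : R) :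
  derivable f (t *: v + a) v ->
  is_derive (t : R) 1 (fun s : R => f (s *: v + a)) ('D_v f (t *: v + a)).
Proof.
move=> df.
have E : (fun h : R => h^-1 *: (f ((h *: 1 + t) *: v + a) - f (t *: v + a))) =
         (fun h => h^-1 *: (f (h *: v + (t *: v + a)) - f (t *: v + a))).
  by apply/funext => h; rewrite [h *: 1]mulr1 scalerDl addrA.
by apply: DeriveDef; rewrite /derivable/derive /= E.
Qed.

(** It asks only for derivatives along [v], so that it can serve in the proof that continuous
    partial derivatives imply differentiability. *)
Lemma MVT_line_pos (V : normedModType R) (f : V -> R) (a v : V) (t : R) :
  0 < t ->
  (forall s : R, 0 <= s <= t -> derivable f (s *: v + a) v) ->
  exists s : R, [/\ 0 < s, s < t & f (t *: v + a) - f a = t * 'D_v f (s *: v + a)].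
Proof.
move=> t0 df; pose h (s : R) := f (s *: v + a).
have dh (s : R) : 0 <= s <= t -> is_derive s 1 h ('D_v f (s *: v + a)).
  by move=> /df/is_derive_line.
have ch (s : R) : 0 <= s <= t -> {for s, continuous h}.
  move=> st; apply: differentiable_continuous.
  by have [/derivable1_diffP] := dh s st.
have h0 : h 0 = f a by rewrite /h scale0r add0r.
have [||c cI] := @MVT R h (fun s => 'D_v f (s *: v + a)) 0 t t0.
+ by move=> s /subset_itv_oo_cc; rewrite in_itv /= => /dh.
+ by apply: continuous_in_subspaceT => s /set_mem/=; rewrite in_itv => /ch.
rewrite h0 subr0 => E; move: cI; rewrite in_itv /= => /andP[c0 ct].
by exists c; split => //; rewrite mulrC -E.
Qed.

Lemma MVT_line (V : normedModType R) (f : V -> R) (a v : V) (t : R) :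
  (forall s : R, `|s| <= `|t| -> derivable f (s *: v + a) v) ->
  exists2 s : R, `|s| <= `|t| & f (t *: v + a) - f a = t * 'D_v f (s *: v + a).
Proof.
have [t0|t0|->] := ltgtP t 0; last first.
- by exists 0; rewrite ?normr0// scale0r add0r subrr mul0r.
- rewrite gtr0_norm// => df; have [|s [s0 st E]] := @MVT_line_pos V f a v t t0.
    by move=> s /andP[s0 st]; apply: df; rewrite ger0_norm.
  by exists s; rewrite // gtr0_norm// ltW.
rewrite ltr0_norm// => df; have Nt0 : 0 < - t by rewrite oppr_gt0.
have shift (s : R) : s *: v + (t *: v + a) = (s + t) *: v + a.
  by rewrite addrA scalerDl.
(* For negative [t] the segment is traversed from its other end. *)
have [|s [s0 st]] := @MVT_line_pos V f (t *: v + a) v (- t) Nt0.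
  move=> s /andP[s0 st]; rewrite shift; apply: df.
  by rewrite ler_norml opprK lerDr s0/= (le_trans _ (ltW Nt0))// -lerBrDr sub0r.
rewrite !shift addNr scale0r add0r => E; exists (s + t).
  by rewrite ler_norml opprK lerDr (ltW s0)/= (le_trans _ (ltW Nt0))// -lerBrDr sub0r ltW.
by rewrite -[LHS]opprB E mulNr opprK.
Qed.

Lemma near_line (V : normedModType R) (P : V -> Prop) (a v : V) :
  (\forall q \near a, P q) ->
  exists2 t : R, 0 < t & forall s : R, `|s| <= t -> P (s *: v + a).
Proof.
move=> /nbhs_ballP[r /= r0 Pr].
(* The added 1 keeps the divisor positive when [v = 0]. *)
have v1 : 0 < `|v| + 1 by rewrite ltr_wpDl.
exists (r / (`|v| + 1) / 2); first by rewrite !divr_gt0.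
move=> s st; apply: Pr; rewrite -ball_normE /ball_/= opprD addrCA subrr addr0 normrN normrZ.
have : `|s| * `|v| <= r / (`|v| + 1) / 2 * (`|v| + 1).
  by rewrite ler_pM// lerDl.
move=> /le_lt_trans; apply.
by rewrite mulrAC divfK ?gt_eqF// ltr_pdivrMr// mulr_natr mulr2n ltrDl.
Qed.

End Lines.

Section Differentiability.
Context {R : realType}.

(** The definition of [differentiable] speaks of a chosen differential and of [lim (nbhs a)], which
    is [a]; this is the bridge from the usual epsilon estimate. *)
Lemma differentiable_linear_approx (V W : normedModType R) (f : V -> W)
    (df : {linear V -> W}) (a : V) :
  continuous df ->
  (forall e : R, 0 < e -> \forall h \near (0 : V),
     `|f (h + a) - f a - df h| <= e * `|h|) ->
  differentiable f a.
Proof.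
move=> dfc approx; apply/diffP => /=.
apply: (@getPex _ (fun (df : {linear V -> W}) => continuous df /\
  forall y, f y = f (lim (nbhs a)) + df (y - lim (nbhs a))
                  +o_(y \near a) (y - lim (nbhs a)))).
exists df; split => //.
have : f = cst (f (lim (nbhs a))) + df \o center (lim (nbhs a))
           +o_ a (center (lim (nbhs a))).
  apply/eqaddoP => e e0; rewrite lim_id//.
  rewrite [\forall x \near _, _ <= _](near_shift 0) subr0 /=.
  apply: filterS (approx _ e0) => h /= happ.
  rewrite -[X in `|X| <= _]/(f (h + a) - (f a + df (h + a - a))).
  by rewrite addrK opprD addrA.
by move=> fE y; rewrite [in LHS]fE.
Qed.

Definition lin2 (A B : R) (v : 'rV[R]_2) : R := v 0 0 * A + v 0 1 * B.

Lemma lin2_is_linear A B : linear (lin2 A B).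
Proof. by move=> k u v; rewrite /lin2 !mxE -[k *: _]/(k * _); ring. Qed.

HB.instance Definition _ A B :=
  GRing.isLinear.Build R 'rV[R]_2 R _ (lin2 A B) (lin2_is_linear A B).

Lemma lin2_continuous A B : continuous (lin2 A B).
Proof.
move=> v; apply: (@continuousD _ _ _ (fun v : 'rV[R]_2 => v 0 0 * A) (fun v : 'rV[R]_2 => v 0 1 * B)).
  apply: (@continuousM _ _ (fun v : 'rV[R]_2 => v 0 0) (cst A)); last exact: cst_continuous.
  exact: coord_continuous.
apply: (@continuousM _ _ (fun v : 'rV[R]_2 => v 0 1) (cst B)); last exact: cst_continuous.
exact: coord_continuous.
Qed.

Lemma row2E (v : 'rV[R]_2) :
  v = v 0 0 *: delta_mx 0 0 + v 0 1 *: delta_mx 0 1.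
Proof.
by rewrite [LHS]row_sum_delta !big_ord_recl big_ord0 addr0; congr (_ *: _ + v 0 _ *: delta_mx _ _); exact/val_inj.
Qed.

Lemma le_norm_row2 (v : 'rV[R]_2) i : `|v 0 i| <= `|v|.
Proof.
rewrite [leRHS]/Num.Def.normr/= mx_normrE.
exact: (le_bigmax _ (fun k : 'I_1 * 'I_2 => `|v k.1 k.2|) (0, i)).
Qed.

Lemma ball_norm_row2 (e a b : R) : `|a| < e -> `|b| < e ->
  `|a *: delta_mx 0 0 + b *: delta_mx 0 1 : 'rV[R]_2| < e.
Proof.
move=> ae be; rewrite [ltLHS]/Num.Def.normr/= mx_normrE.
apply: bigmax_lt => /=; first exact: le_lt_trans ae.
move=> [i j] _ /=; rewrite !mxE (ord1 i) /=.
have -> : j = if j == 0 then 0 else 1 by case: j => -[|[|//]] ? ; exact/val_inj.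
by case: (j == 0); rewrite /= ?mulr1 ?mulr0 ?addr0 ?add0r.
Qed.

(** [class_C] knows only the coordinate directions. Going from [a] to [h + a] along two coordinate
    segments, with the mean value theorem on each, turns continuity of the partial derivatives into
    the linear estimate that the chain rule needs. *)
Lemma C1_differentiable W (f : 'rV[R]_2 -> R) (a : 'rV[R]_2) :
  open W -> W a -> class_C 1 W f -> differentiable f a.
Proof.
move=> oW Wa [cf df].
have d0 := (df 0).1; have [c0 _] := (df 0).2.
have d1 := (df 1).1; have [c1 _] := (df 1).2.
have /nbhs_ballP[r0 /= r0_gt0 Wr0] := open_nbhs_nbhs (conj oW Wa).
apply: (@differentiable_linear_approx _ _ _ (lin2 (partial 0 f a) (partial 1 f a))).
  exact: lin2_continuous.
move=> e e0.
have e20 : 0 < e / 2 by rewrite divr_gt0.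
have /cvgrPdist_le/(_ _ e20)/nbhs_ballP[r1 /= r1_gt0 near1] := c0 _ Wa.
have /cvgrPdist_le/(_ _ e20)/nbhs_ballP[r2 /= r2_gt0 near2] := c1 _ Wa.
pose r := Num.min r0 (Num.min r1 r2).
have r_gt0 : 0 < r by rewrite !lt_min r0_gt0 r1_gt0.
apply/nbhs_ballP; exists r => //= h.
rewrite -ball_normE /ball_/= sub0r normrN => hr.
have hin (s t : R) : `|s| <= `|h 0 0| -> `|t| <= `|h 0 1| ->
    `|s *: delta_mx 0 0 + t *: delta_mx 0 1 : 'rV[R]_2| < r.
  move=> sh th; apply: ball_norm_row2.
    by apply: le_lt_trans hr; apply: le_trans sh _; exact: le_norm_row2.
  by apply: le_lt_trans hr; apply: le_trans th _; exact: le_norm_row2.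
have rr k (s t : R) : r <= k -> `|s| <= `|h 0 0| -> `|t| <= `|h 0 1| ->
    ball a k (s *: delta_mx 0 0 + (t *: delta_mx 0 1 + a)).
  move=> rk sh th; rewrite -ball_normE /ball_/=.
  by rewrite addrA opprD addrCA subrr addr0 normrN (lt_le_trans (hin _ _ sh th)).
have rr0 : r <= r0 by rewrite /r ge_min lexx.
have rr1 : r <= r1 by rewrite /r !ge_min lexx orbT.
have rr2 : r <= r2 by rewrite /r !ge_min lexx !orbT.
have n00 : `|0 : R| <= `|h 0 0| by rewrite normr0.
have [|s sh E0] := @MVT_line R _ f (h 0 1 *: delta_mx 0 1 + a) (delta_mx 0 0) (h 0 0).
  by move=> s sh; apply/d0/Wr0/rr.
have [|t th E1] := @MVT_line R _ f a (delta_mx 0 1) (h 0 1).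
  by move=> t th; apply/d1/Wr0; have := rr _ 0 t rr0 n00 th; rewrite scale0r add0r.
have -> : f (h + a) - f a - lin2 (partial 0 f a) (partial 1 f a) h =
  - (h 0 0 * (partial 0 f a - partial 0 f (s *: delta_mx 0 0 + (h 0 1 *: delta_mx 0 1 + a))))
  - (h 0 1 * (partial 1 f a - partial 1 f (t *: delta_mx 0 1 + a))).
  have -> : h + a = h 0 0 *: delta_mx 0 0 + (h 0 1 *: delta_mx 0 1 + a).
    by rewrite {1}(row2E h) addrA.
  by rewrite !mulrBr /partial -E0 -E1 /lin2; ring.
rewrite (le_trans (ler_normB _ _))// normrN !normrM [e]splitr mulrDl lerD//.
  rewrite mulrC ler_pM//; last exact: le_norm_row2.
  by apply: near1; apply: rr.
rewrite mulrC ler_pM//; last exact: le_norm_row2.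
by apply: near2; have := rr _ 0 t rr2 n00 th; rewrite scale0r add0r.
Qed.

Lemma C1_differentiable_rV n W (F : 'rV[R]_2 -> 'rV[R]_n) (a : 'rV[R]_2) :
  open W -> W a -> class_C 1 W F -> differentiable F a.
Proof.
move=> oW Wa /class_C_coord CF.
have -> : F = \sum_(k < n) (fun q => F q 0 k *: (delta_mx 0 k : 'rV[R]_n)).
  by apply/funext => q; rewrite fct_sumE [LHS]row_sum_delta.
apply: differentiable_sum => k; apply: differentiableZl.
exact: C1_differentiable oW Wa (CF oW k).
Qed.

Lemma derive_row2 (V : normedModType R) (F : 'rV[R]_2 -> V) (q v : 'rV[R]_2) :
  differentiable F q ->
  'D_v F q = v 0 0 *: partial 0 F q + v 0 1 *: partial 1 F q.
Proof.
move=> dF; rewrite /partial !deriveE// {1}(row2E v).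
by rewrite linearD !linearZ.
Qed.

Lemma partial_comp (V : normedModType R) (F : 'rV[R]_2 -> V)
    (phi : 'rV[R]_2 -> 'rV[R]_2) q i :
  differentiable phi q -> differentiable F (phi q) ->
  partial i (F \o phi) q = \sum_(a < 2) partial i phi q 0 a *: partial a F (phi q).
Proof.
move=> dphi dF; rewrite {1}/partial deriveE; last exact: differentiable_comp.
rewrite (diff_comp dphi dF) -[LHS]/('d F (phi q) ('d phi q (delta_mx 0 i))).
have <- : 'D_(delta_mx 0 i) phi q = 'd phi q (delta_mx 0 i) by exact: deriveE.
rewrite -[LHS](deriveE _ dF) derive_row2//.
rewrite !big_ord_recl big_ord0 addr0 /=; congr (_ + _ *: partial _ _ _); last exact/val_inj.
by congr (_ 0 _); exact/val_inj.
Qed.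

Lemma is_derive_translate (V W : normedModType R) (f : V -> W) (b q v : V) :
  derivable f (b + q) v ->
  is_derive q v (fun x => f (b + x)) ('D_v f (b + q)).
Proof.
move=> df.
have E : (fun h : R => h^-1 *: (f (b + (h *: v + q)) - f (b + q))) =
         (fun h => h^-1 *: (f (h *: v + (b + q)) - f (b + q))).
  by apply/funext => h; rewrite addrCA.
by apply: DeriveDef; rewrite /derivable/derive /= E.
Qed.

Section Schwarz.
Variables (W : set 'rV[R]_2) (f : 'rV[R]_2 -> R).
Hypotheses (oW : open W) (Cf : class_C 2 W f).

(** The mean value theorem is used twice: for the increment of [f] along [ej], moved along [ei], and
    then for [partial i f] along [ej]. The left side is symmetric in [i] and [j], which is the
    source of Schwarz's theorem. *)
Lemma second_difference (i j : 'I_2) (a : 'rV[R]_2) (t : R) : 0 < t ->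
  (forall s s' : R, `|s| <= t -> `|s'| <= t ->
     W (s *: delta_mx 0 i + (s' *: delta_mx 0 j + a))) ->
  exists s s' : R, [/\ `|s| <= t, `|s'| <= t &
    f (t *: delta_mx 0 i + (t *: delta_mx 0 j + a)) - f (t *: delta_mx 0 j + a)
    - (f (t *: delta_mx 0 i + a) - f a) =
    t ^+ 2 * partial j (partial i f) (s *: delta_mx 0 i + (s' *: delta_mx 0 j + a))].
Proof.
set ei : 'rV[R]_2 := delta_mx 0 i; set ej : 'rV[R]_2 := delta_mx 0 j.
move=> t0 inW; have tE : `|t| = t by rewrite gtr0_norm.
have di q : W q -> derivable f q ei by exact: class_C_derivable Cf.
have dji q : W q -> derivable (partial i f) q ej.
  exact: class_C_derivable (class_C_partial i Cf).
have n0 : `|0 : R| <= t by rewrite normr0 ltW.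
pose g (q : 'rV[R]_2) := f (t *: ej + q) - f q.
have dg (s : R) : `|s| <= t -> is_derive (s *: ei + a) ei g
   (partial i f (s *: ei + (t *: ej + a)) - partial i f (s *: ei + a)).
  move=> st.
  have Wst : W (s *: ei + (t *: ej + a)) by apply: inW; rewrite ?tE.
  have Ws : W (s *: ei + a) by have := inW s 0 st n0; rewrite scale0r add0r.
  apply: is_deriveB; last exact/derivableP/di.
  rewrite addrCA; apply: is_derive_translate; rewrite addrCA; exact: di.
have [s st E1] : exists2 s : R, `|s| <= `|t| &
    g (t *: ei + a) - g a = t * 'D_ei g (s *: ei + a).
  by apply: MVT_line => s; rewrite tE => /dg[].
rewrite tE in st; have [_ dgE] := dg s st; rewrite dgE in E1; move: E1.
have [s' st' E2] : exists2 s' : R, `|s'| <= `|t| &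
    partial i f (t *: ej + (s *: ei + a)) - partial i f (s *: ei + a)
    = t * partial j (partial i f) (s' *: ej + (s *: ei + a)).
  apply: MVT_line => s'; rewrite tE => st'; apply: dji.
  by rewrite addrCA; exact: inW.
rewrite tE in st'; rewrite [s *: ei + (t *: ej + a)]addrCA E2 /g => E.
have swap (x y : R) : x *: ei + (y *: ej + a) = y *: ej + (x *: ei + a).
  exact: addrCA.
exists s, s'; split; [exact: st|exact: st'|].
rewrite (swap t t).
rewrite (swap s s').
rewrite expr2 -mulrA.
have alg (A B C D P : R) : A - C - (B - D) = P -> A - B - (C - D) = P.
  by move=> <-; ring.
exact: alg E.
Qed.

Lemma partialC (i j : 'I_2) a : W a ->
  partial i (partial j f) a = partial j (partial i f) a.
Proof.
move=> Wa; apply/eqP; rewrite -subr_eq0 -normr_le0; apply/ler_addgt0Pl => e e0; rewrite addr0.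
have cij : {for a, continuous (partial i (partial j f))}.
  exact: class_C_continuous (class_C_partial i (class_C_partial j Cf)) Wa.
have cji : {for a, continuous (partial j (partial i f))}.
  exact: class_C_continuous (class_C_partial j (class_C_partial i Cf)) Wa.
have e20 : 0 < e / 2 by rewrite divr_gt0.
have /nbhs_ballP[r0 /= r0_gt0 Wr0] := open_nbhs_nbhs (conj oW Wa).
have /cvgrPdist_le/(_ _ e20)/nbhs_ballP[r1 /= r1_gt0 near1] := cij.
have /cvgrPdist_le/(_ _ e20)/nbhs_ballP[r2 /= r2_gt0 near2] := cji.
pose r := Num.min r0 (Num.min r1 r2).
have r_gt0 : 0 < r by rewrite !lt_min r0_gt0 r1_gt0.
have rr0 : r <= r0 by rewrite /r ge_min lexx.
have rr1 : r <= r1 by rewrite /r !ge_min lexx orbT.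
have rr2 : r <= r2 by rewrite /r !ge_min lexx !orbT.
(* Two coordinate steps of length at most [t] then stay inside the ball of radius [r]. *)
pose t := r / 3; have t0 : 0 < t by rewrite divr_gt0.
have inb k l m (s s' : R) : r <= m -> `|s| <= t -> `|s'| <= t ->
    ball a m (s *: delta_mx 0 k + (s' *: delta_mx 0 l + a)).
  move=> rm sh th; rewrite -ball_normE /ball_/=.
  rewrite addrA opprD addrCA subrr addr0 normrN (lt_le_trans _ rm)//.
  rewrite (le_lt_trans (ler_normD _ _))// !normrZ.
  have n1 k' : `|delta_mx 0 k' : 'rV[R]_2| <= 1.
    rewrite [leLHS]/Num.Def.normr/= mx_normrE; apply: bigmax_le => //= x _.
    by rewrite !mxE; case: (_ && _); rewrite ?normr1 ?normr0.
  have m1 (u : R) k' : `|u| <= t -> `|u| * `|delta_mx 0 k' : 'rV[R]_2| <= t.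
    by move=> ut; rewrite -[t]mulr1 ler_pM.
  apply: le_lt_trans (lerD (m1 _ k sh) (m1 _ l th)) _.
  by rewrite /t; lra.
have [|s [s' [st st' E]]] := @second_difference i j a t t0.
  by move=> s s' st st'; apply/Wr0/inb.
have [|u [u' [ut ut' E']]] := @second_difference j i a t t0.
  by move=> u u' ut ut'; apply/Wr0/inb.
(* Both sides equal the same second difference. *)
have : t ^+ 2 * partial j (partial i f) (s *: delta_mx 0 i + (s' *: delta_mx 0 j + a))
   = t ^+ 2 * partial i (partial j f) (u *: delta_mx 0 j + (u' *: delta_mx 0 i + a)).
  have swap : t *: 'e_j + (t *: 'e_i + a) = t *: 'e_i + (t *: 'e_j + a).
    exact: addrCA.
  rewrite swap in E'.
  have alg (A B C D P Q : R) : A - B - (C - D) = P -> A - C - (B - D) = Q -> P = Q.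
    by move=> <- <-; ring.
  exact: alg E E'.
move/mulfI => /(_ (lt0r_neq0 (exprn_gt0 _ t0))) EE.
have b1 := near1 _ (inb j i _ _ _ rr1 ut ut').
have b2 := near2 _ (inb i j _ _ _ rr2 st st').
rewrite -EE in b1; rewrite [e]splitr.
rewrite -(subrKA (partial j (partial i f) (s *: 'e_i + (s' *: 'e_j + a)))).
apply: le_trans (ler_normD _ _) _; apply: lerD; first exact: b1.
by rewrite distrC; exact: b2.
Qed.

End Schwarz.

Lemma smooth_partialC (W : set 'rV[R]_2) (f : 'rV[R]_2 -> R) i j a :
  open W -> smooth_on W f -> W a ->
  partial i (partial j f) a = partial j (partial i f) a.
Proof. by move=> oW sf Wa; exact: partialC oW (sf 2%N) _ _ _ Wa. Qed.

Lemma smooth_partialC_rV n (W : set 'rV[R]_2) (F : 'rV[R]_2 -> 'rV[R]_n) i j a :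
  open W -> smooth_on W F -> W a ->
  partial i (partial j F) a = partial j (partial i F) a.
Proof.
move=> oW sF Wa; have sc := (smooth_coord F oW).1 sF.
have pE i' j' k : (partial i' (partial j' F) a) 0 k =
    partial i' (partial j' (fun q => F q 0 k)) a.
  rewrite partial_coord; last by apply: smooth_derivable Wa; exact: smooth_partial.
  apply: (partial_eq_on _ oW Wa) => q /set_mem Wq.
  by rewrite partial_coord//; exact: smooth_derivable sF Wq.
apply/rowP => k.
apply: (etrans (pE i j k)); apply: (etrans _ (esym (pE j i k))).
exact: (@smooth_partialC W (fun q => F q 0 k) i j a oW (sc k) Wa).
Qed.

Lemma smooth_differentiable W (f : 'rV[R]_2 -> R) a :
  open W -> W a -> smooth_on W f -> differentiable f a.
Proof. by move=> oW Wa sf; exact: C1_differentiable oW Wa (sf 1%N). Qed.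

Lemma smooth_differentiable_rV n W (F : 'rV[R]_2 -> 'rV[R]_n) a :
  open W -> W a -> smooth_on W F -> differentiable F a.
Proof. by move=> oW Wa sF; exact: C1_differentiable_rV oW Wa (sF 1%N). Qed.

Section LocalMaximum.
Variables (W : set 'rV[R]_2) (f : 'rV[R]_2 -> R) (a : 'rV[R]_2).
Hypotheses (oW : open W) (Wa : W a) (sf : smooth_on W f).
Hypothesis fmax : forall r, W r -> f r <= f a.

Let g (v q : 'rV[R]_2) : R := v 0 0 * partial 0 f q + v 0 1 * partial 1 f q.

Let gE v q : W q -> 'D_v f q = g v q.
Proof. by move=> Wq; rewrite derive_row2//; exact: smooth_differentiable Wq sf. Qed.

Let sg v : smooth_on W (g v).
Proof.
by apply: smoothD => //; apply: smoothM => //;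
  [exact: (smooth_cst W (v 0 0 : R))|exact: smooth_partial|
   exact: (smooth_cst W (v 0 1 : R))|exact: smooth_partial].
Qed.

Let derivable_dir (h : 'rV[R]_2 -> R) v q :
  smooth_on W h -> W q -> derivable h q v.
Proof. by move=> sh Wq; apply: diff_derivable; exact: smooth_differentiable sh. Qed.

Let W_line v : exists2 t : R, 0 < t & forall s : R, `|s| <= t -> W (s *: v + a).
Proof. by apply: near_line; exact: open_nbhs_nbhs. Qed.

Let max_derive_le0 v : g v a <= 0.
Proof.
rewrite leNgt; apply/negP => ga.
have [t0 t0_gt0 Wt] := W_line v.
have [t1 t1_gt0 gt] : exists2 t : R, 0 < t & forall s : R, `|s| <= t -> 0 < g v (s *: v + a).
  apply: (near_line (P := fun q => 0 < g v q)).
  have cg := smooth_continuous (sg v) Wa.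
  exact: (cvgr_gt _ cg _ ga).
pose t := Num.min t0 t1; have tt0 : 0 < t by rewrite lt_min t0_gt0.
have W_t (s : R) : 0 <= s <= t -> W (s *: v + a).
  move=> /andP[s0 st]; apply: Wt; rewrite ger0_norm// (le_trans st)//.
  by rewrite /t ge_min lexx.
have [|s [s0 st E]] := @MVT_line_pos R _ f a v t tt0.
  by move=> s st; apply: derivable_dir sf _; exact: W_t.
have : f (t *: v + a) - f a <= 0.
  by rewrite subr_le0; apply: fmax; apply: W_t; rewrite lexx ltW.
rewrite E gE; last by apply: W_t; rewrite !ltW.
apply/negP; rewrite -ltNge mulr_gt0//; apply: gt.
by rewrite ger0_norm ?ltW// (lt_le_trans st)// /t ge_min lexx orbT.
Qed.

Let max_derive0 v : g v a = 0.
Proof.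
apply/eqP; rewrite eq_le max_derive_le0/=.
have := max_derive_le0 (- v); rewrite /g !mxE !mulNr -opprD oppr_le0; exact.
Qed.

Lemma local_max_partial i : partial i f a = 0.
Proof.
by rewrite /partial (gE (delta_mx 0 i) Wa); exact: max_derive0.
Qed.

(** Were the second derivative positive, [g v], zero at [a], would be positive just beyond [a] along
    [v], and by the mean value theorem [f] would exceed its maximum. *)
Let max_second_le0 v : g v a = 0 -> 'D_v (g v) a <= 0.
Proof.
move=> ga0; rewrite leNgt; apply/negP => Dga.
have gvE q : W q -> 'D_v (g v) q =
    v 0 0 * partial 0 (g v) q + v 0 1 * partial 1 (g v) q.
  move=> Wq; rewrite derive_row2//; exact: smooth_differentiable Wq (sg v).
have [t0 t0_gt0 Wt] := W_line v.
have [t1 t1_gt0 gt] : exists2 t : R, 0 < t & forall s : R, `|s| <= t ->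
    0 < v 0 0 * partial 0 (g v) (s *: v + a) + v 0 1 * partial 1 (g v) (s *: v + a).
  apply: (near_line (P := fun q => 0 < v 0 0 * partial 0 (g v) q + v 0 1 * partial 1 (g v) q)).
  have sh : smooth_on W (fun q => v 0 0 * partial 0 (g v) q + v 0 1 * partial 1 (g v) q).
    by apply: smoothD => //; apply: smoothM => //;
    [exact: (smooth_cst W (v 0 0 : R))|exact: smooth_partial|
     exact: (smooth_cst W (v 0 1 : R))|exact: smooth_partial].
  have cg := smooth_continuous sh Wa.
  by apply: (cvgr_gt _ cg); rewrite -gvE.
pose t := Num.min t0 t1; have tt0 : 0 < t by rewrite lt_min t0_gt0.
have W_t (s : R) : 0 <= s <= t -> W (s *: v + a).
  move=> /andP[s0 st]; apply: Wt; rewrite ger0_norm// (le_trans st)//.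
  by rewrite /t ge_min lexx.
have [|s [s0 st E]] := @MVT_line_pos R _ f a v t tt0.
  by move=> s st; apply: derivable_dir sf _; exact: W_t.
have [|u [u0 us E']] := @MVT_line_pos R _ (g v) a v s s0.
  move=> u /andP[u0 us]; apply: derivable_dir (sg v) _; apply: W_t.
  by rewrite u0 (le_trans us)// ltW.
have : f (t *: v + a) - f a <= 0.
  by rewrite subr_le0; apply: fmax; apply: W_t; rewrite lexx ltW.
have Ws : W (s *: v + a) by apply: W_t; rewrite !ltW.
rewrite E gE//; apply/negP; rewrite -ltNge mulr_gt0//.
rewrite ga0 subr0 in E'; rewrite E'; apply: mulr_gt0; first exact: s0.
rewrite gvE.
  by apply: gt; rewrite ger0_norm ?ltW// (lt_trans us)// (lt_le_trans st)// /t ge_min lexx orbT.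
by apply: W_t; rewrite ltW//= ltW// (lt_trans us).
Qed.

Lemma local_max_hessian (c0 c1 : R) :
  c0 ^+ 2 * partial 0 (partial 0 f) a + 2 * c0 * c1 * partial 0 (partial 1 f) a
  + c1 ^+ 2 * partial 1 (partial 1 f) a <= 0.
Proof.
pose v : 'rV[R]_2 := \row_k (if k == 0 then c0 else c1).
have v0 : v 0 0 = c0 by rewrite mxE.
have v1 : v 0 1 = c1 by rewrite mxE.
have := max_second_le0 (max_derive0 v).
rewrite derive_row2; last exact: smooth_differentiable Wa (sg v).
have pgE i : partial i (g v) a =
    c0 * partial i (partial 0 f) a + c1 * partial i (partial 1 f) a.
  have d k : derivable (partial k f) a (delta_mx 0 i).
    by apply: smooth_derivable Wa; exact: smooth_partial.
  have dc (c : R) k : derivable (fun q => c * partial k f q) a (delta_mx 0 i).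
    by apply: derivableM; [exact: derivable_cst|exact: d].
  rewrite {1}/partial /g v0 v1 deriveD; [|exact: dc|exact: dc].
  by rewrite !deriveMl.
rewrite !pgE v0 v1 (smooth_partialC 1 0 oW sf Wa).
have alg (A B C : R) : c0 * (c0 * A + c1 * B) + c1 * (c0 * B + c1 * C) <= 0 ->
    c0 ^+ 2 * A + 2 * c0 * c1 * B + c1 ^+ 2 * C <= 0.
  by apply: le_trans; rewrite le_eqVlt; apply/orP; left; apply/eqP; ring.
exact: alg.
Qed.

End LocalMaximum.

End Differentiability.

(** * Local geometry of an immersed surface *)

Opaque derive.

Lemma sum2E (V : nmodType) (f : 'I_2 -> V) : \sum_(i < 2) f i = f 0 + f 1.
Proof. by rewrite !big_ord_recl big_ord0 addr0; congr (_ + f _); exact/val_inj. Qed.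

Lemma forall2E (P : 'I_2 -> Prop) : P 0 -> P 1 -> forall i, P i.
Proof.
move=> P0 P1 [[|[|//]] ilt].
  by rewrite (_ : Ordinal ilt = 0)//; exact/val_inj.
by rewrite (_ : Ordinal ilt = 1)//; exact/val_inj.
Qed.

Lemma matrix2P (T : Type) (A B : 'M[T]_2) :
  A 0 0 = B 0 0 -> A 0 1 = B 0 1 -> A 1 0 = B 1 0 -> A 1 1 = B 1 1 -> A = B.
Proof.
by move=> ????; apply/matrixP; apply: forall2E; apply: forall2E.
Qed.

Lemma row2P (T : Type) (u v : 'rV[T]_2) : u 0 0 = v 0 0 -> u 0 1 = v 0 1 -> u = v.
Proof. by move=> ??; apply/rowP; apply: forall2E. Qed.

Lemma det2E (R : comRingType) (A : 'M[R]_2) : \det A = A 0 0 * A 1 1 - A 0 1 * A 1 0.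
Proof.
rewrite (expand_det_row _ 0) sum2E /cofactor !det_mx11 !mxE /= !expr0 expr1.
rewrite (_ : lift 0 0 = 1 :> 'I_2); last exact/val_inj.
rewrite (_ : lift 1 0 = 0 :> 'I_2); last exact/val_inj.
ring.
Qed.

Lemma invmx2E (F : fieldType) (A : 'M[F]_2) : A \in unitmx ->
  [/\ invmx A 0 0 = (\det A)^-1 * A 1 1, invmx A 0 1 = - (\det A)^-1 * A 0 1,
      invmx A 1 0 = - (\det A)^-1 * A 1 0 & invmx A 1 1 = (\det A)^-1 * A 0 0].
Proof.
move=> uA; pose B : 'M[F]_2 := \matrix_(i, j) (if i == 0
  then if j == 0 then (\det A)^-1 * A 1 1 else - (\det A)^-1 * A 0 1
  else if j == 0 then - (\det A)^-1 * A 1 0 else (\det A)^-1 * A 0 0).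
suff -> : invmx A = B by split; rewrite mxE.
apply: (can_inj (mulmxK uA)); rewrite mulVmx//; apply/esym.
have d0 : \det A != 0 by rewrite -unitfE -unitmxE.
have dE := det2E A; rewrite dE in d0.
apply: matrix2P; rewrite mxE sum2E !mxE /= dE; field; exact: d0.
Qed.

Section Dot.
Context {R : realType} {n : nat}.
Implicit Types u v w : 'rV[R]_n.

Lemma dotC u v : dot u v = dot v u.
Proof. by apply: eq_bigr => k _; rewrite mulrC. Qed.

Lemma dotDl u v w : dot (u + v) w = dot u w + dot v w.
Proof. by rewrite /dot -big_split; apply: eq_bigr => k _; rewrite mxE mulrDl. Qed.

Lemma dotZl a u w : dot (a *: u) w = a * dot u w.
Proof. by rewrite /dot mulr_sumr; apply: eq_bigr => k _; rewrite mxE mulrA. Qed.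

Lemma dotNl u w : dot (- u) w = - dot u w.
Proof. by rewrite -scaleN1r dotZl mulN1r. Qed.

Lemma dotBl u v w : dot (u - v) w = dot u w - dot v w.
Proof. by rewrite dotDl dotNl. Qed.

Lemma dot0l w : dot 0 w = 0.
Proof. by rewrite -(scale0r 0) dotZl mul0r. Qed.

Lemma dotDr u v w : dot w (u + v) = dot w u + dot w v.
Proof. by rewrite dotC dotDl !(dotC w). Qed.

Lemma dotZr a u w : dot w (a *: u) = a * dot w u.
Proof. by rewrite dotC dotZl (dotC w). Qed.

Lemma dot_ge0 u : 0 <= dot u u.
Proof. by apply: sumr_ge0 => k _; rewrite -expr2 sqr_ge0. Qed.

Lemma dot_eq0 u : dot u u = 0 -> u = 0.
Proof.
move=> /eqP; rewrite psumr_eq0; last by move=> k _; rewrite -expr2 sqr_ge0.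
move=> /allP u0; apply/rowP => k; rewrite mxE.
by have := u0 k (mem_index_enum k); rewrite /= -expr2 sqrf_eq0 => /eqP.
Qed.

Lemma partial_dot (F G : 'rV[R]_2 -> 'rV[R]_n) i q :
  derivable F q (delta_mx 0 i) -> derivable G q (delta_mx 0 i) ->
  partial i (fun r => dot (F r) (G r)) q =
  dot (partial i F q) (G q) + dot (F q) (partial i G q).
Proof.
move=> dF dG.
have dFk k : derivable (fun r => F r 0 k) q (delta_mx 0 i) by have /derivable_mxP := dF; exact.
have dGk k : derivable (fun r => G r 0 k) q (delta_mx 0 i) by have /derivable_mxP := dG; exact.
have -> : (fun r => dot (F r) (G r)) =
    \sum_(k < n) ((fun r => F r 0 k) * (fun r => G r 0 k)).
  by apply/funext => r; rewrite fct_sumE.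
rewrite /partial derive_sum; last by move=> k; exact: derivableM.
rewrite /dot -big_split; apply: eq_bigr => k _ /=.
rewrite deriveM// -[partial i F q 0 k]/('D_(delta_mx 0 i) F q 0 k).
rewrite -!/(partial _ _ _) !partial_coord// addrC.
congr (_ + _); exact: mulrC.
Qed.

End Dot.

Section ScalarRules.
Context {R : realType}.
Implicit Types (f g : 'rV[R]_2 -> R) (q : 'rV[R]_2).

Lemma partialD f g i q :
  derivable f q (delta_mx 0 i) -> derivable g q (delta_mx 0 i) ->
  partial i (fun r => f r + g r) q = partial i f q + partial i g q.
Proof. by move=> df dg; rewrite /partial -deriveD. Qed.

Lemma partial_cst (V : normedModType R) (c : V) i q :
  partial i (fun _ => c) q = 0.
Proof. exact: derive_cst. Qed.

Lemma partialM f g i q :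
  derivable f q (delta_mx 0 i) -> derivable g q (delta_mx 0 i) ->
  partial i (fun r => f r * g r) q = f q * partial i g q + partial i f q * g q.
Proof.
move=> df dg; rewrite /partial (deriveM df dg) -[_ *: _]/(_ * _).
by rewrite -[X in _ + X]/(_ * _) [X in _ + X]mulrC.
Qed.

End ScalarRules.

Opaque dot partial.

Section LocalGeometryFacts.
Context {R : realType}.
Variables (W : set 'rV[R]_2) (X : 'rV[R]_2 -> 'rV[R]_3).
Hypotheses (oW : open W) (sX : smooth_on W X).
Hypothesis gW : forall q, W q -> metric_mx X q \in unitmx.

Lemma metric_mxE q i j : metric_mx X q i j = dot (partial i X q) (partial j X q).
Proof. by rewrite mxE. Qed.

Lemma metric_mx_sym q : (metric_mx X q)^T = metric_mx X q.
Proof. by apply/matrixP => i j; rewrite mxE !metric_mxE dotC. Qed.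

Lemma metric_inv_sym q : (metric_inv X q)^T = metric_inv X q.
Proof. by rewrite /metric_inv trmx_inv metric_mx_sym. Qed.

Lemma smooth_metric i j : smooth_on W (fun q => metric_mx X q i j).
Proof.
under eq_fun do rewrite metric_mxE.
by apply: smooth_dot => //; exact: smooth_partial.
Qed.

Let sXi i : smooth_on W (partial i X) := smooth_partial i sX.

(** Expanding the derivatives of the metric leaves [A + B + (A + C) - (B + C)], because second
    partials commute. The Christoffel symbols are thus the tangential coordinates of the second
    partials of [X]. *)
Lemma christoffelE i j k q : W q -> christoffel X i j k q =
  \sum_(l < 2) metric_inv X q k l * dot (partial i (partial j X) q) (partial l X q).
Proof.
move=> Wq; rewrite /christoffel mulr_sumr; apply: eq_bigr => l _.
have pg a b c : partial a (fun r => metric_mx X r b c) q =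
    dot (partial a (partial b X) q) (partial c X q)
    + dot (partial b X q) (partial a (partial c X) q).
  under eq_fun do rewrite metric_mxE.
  by apply: partial_dot; exact: smooth_derivable (sXi _) Wq.
rewrite !pg (smooth_partialC_rV j i oW sX Wq) (smooth_partialC_rV l i oW sX Wq).
rewrite (smooth_partialC_rV l j oW sX Wq) (dotC (partial j X q)) (dotC (partial i X q) _).
have alg (k0 A B C : R) : 2^-1 * (k0 * (A + B + (A + C) - (B + C))) = k0 * A.
  by field.
exact: alg.
Qed.

(** By [christoffelE] the subtracted sum is the tangential projection of the second partial: its
    coefficients are [v] times the inverse metric. *)
Lemma second_form_normal i j l q : W q ->
  dot (local_second_form X i j q) (partial l X q) = 0.
Proof.
move=> Wq; rewrite /local_second_form sum2E dotBl dotDl !dotZl.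
rewrite -(metric_mxE q 0 l) -(metric_mxE q 1 l).
set v := \row_m dot (partial i (partial j X) q) (partial m X q).
have cE k : christoffel X i j k q = (v *m metric_inv X q) 0 k.
  rewrite christoffelE// mxE; apply: eq_bigr => m _; rewrite mxE mulrC.
  by congr (_ * _); rewrite -[in RHS]metric_inv_sym mxE.
have -> : dot (partial i (partial j X) q) (partial l X q) = v 0 l by rewrite mxE.
rewrite !cE -[in X in X - _](mulmx1 v) -(mulVmx (gW Wq)) mulmxA.
by rewrite [X in X - _]mxE sum2E subrr.
Qed.

End LocalGeometryFacts.

Section SmoothLocal.
Context {R : realType}.
Variables (W : set 'rV[R]_2) (X : 'rV[R]_2 -> 'rV[R]_3).
Hypotheses (oW : open W) (sX : smooth_on W X).
Hypothesis gW : forall q, W q -> metric_mx X q \in unitmx.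

Let sXi i : smooth_on W (partial i X) := smooth_partial i sX.

Lemma metric_invE q : W q ->
  [/\ metric_inv X q 0 0 = (\det (metric_mx X q))^-1 * metric_mx X q 1 1,
      metric_inv X q 0 1 = - (\det (metric_mx X q))^-1 * metric_mx X q 0 1,
      metric_inv X q 1 0 = - (\det (metric_mx X q))^-1 * metric_mx X q 0 1 &
      metric_inv X q 1 1 = (\det (metric_mx X q))^-1 * metric_mx X q 0 0].
Proof.
move=> Wq; have [e00 e01 e10 e11] := invmx2E (gW Wq); split=> //.
by rewrite /metric_inv e10 (metric_mxE X q 1 0) (metric_mxE X q 0 1) dotC.
Qed.

Lemma smooth_det_metric : smooth_on W (fun q => \det (metric_mx X q)).
Proof.
under eq_fun do rewrite det2E.
by apply: smoothB => //; apply: smoothM => //; exact: smooth_metric.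
Qed.

Lemma smooth_metric_inv i j : smooth_on W (fun q => metric_inv X q i j).
Proof.
have sD : smooth_on W (fun q => (\det (metric_mx X q))^-1).
  apply: smoothV => //; last exact: smooth_det_metric.
  by move=> q /gW; rewrite unitmxE unitfE.
have sg a b : smooth_on W (fun q => (\det (metric_mx X q))^-1 * metric_mx X q a b).
  by apply: smoothM => //; exact: smooth_metric.
have sNg a b : smooth_on W (fun q => - (\det (metric_mx X q))^-1 * metric_mx X q a b).
  by apply: smoothM => //; [exact: smoothN|exact: smooth_metric].
move: i j; apply: forall2E; apply: forall2E.
- by apply: smooth_eq (sg 1 1) => // q /set_mem /metric_invE[].
- by apply: smooth_eq (sNg 0 1) => // q /set_mem /metric_invE[].
- by apply: smooth_eq (sNg 0 1) => // q /set_mem /metric_invE[].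
- by apply: smooth_eq (sg 0 0) => // q /set_mem /metric_invE[].
Qed.

Lemma smooth_christoffel i j k : smooth_on W (christoffel X i j k).
Proof.
have s : smooth_on W (fun q => \sum_(l < 2) metric_inv X q k l *
    dot (partial i (partial j X) q) (partial l X q)).
  apply: smooth_sum => // l; apply: smoothM => //; first exact: smooth_metric_inv.
  by apply: smooth_dot => //; exact: smooth_partial.
by apply: smooth_eq s => // q /set_mem Wq; rewrite (christoffelE oW sX _ _ _ Wq).
Qed.

Lemma smooth_second_form i j : smooth_on W (local_second_form X i j).
Proof.
apply: smoothD => //; first exact: smooth_partial.
have s : smooth_on W (fun q => (-1 : R) *: \sum_(k < 2) christoffel X i j k q *: partial k X q).
  apply: smoothZ => //; first exact: (smooth_cst W (-1 : R)).
  by apply: smooth_sum_rV => // k; apply: smoothZ => //; exact: smooth_christoffel.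
by apply: smooth_eq s => // q _; rewrite scaleN1r.
Qed.

Lemma smooth_mean_curvature_vector : smooth_on W (local_mean_curvature_vector X).
Proof.
apply: smoothZ => //; first exact: (smooth_cst W (2^-1 : R)).
apply: smooth_sum_rV => // i; apply: smooth_sum_rV => // j; apply: smoothZ => //.
  exact: smooth_metric_inv.
exact: smooth_second_form.
Qed.

Lemma smooth_hessian (f : 'rV[R]_2 -> R) i j : smooth_on W f ->
  smooth_on W (local_hessian X f i j).
Proof.
move=> sf; apply: smoothB => //; first by do 2!apply: smooth_partial.
apply: smooth_sum => // k; apply: smoothM => //; first exact: smooth_christoffel.
exact: smooth_partial.
Qed.

End SmoothLocal.

(** * Change of coordinates *)

Lemma invmx_congruence (R : fieldType) n (J g : 'M[R]_n) :
  J \in unitmx -> g \in unitmx ->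
  J^T *m invmx (J *m g *m J^T) *m J = invmx g.
Proof.
move=> uJ ug; set k := invmx (J *m g *m J^T).
have uJT : J^T \in unitmx by rewrite unitmx_tr.
have ugJ : J *m g *m J^T \in unitmx by rewrite !unitmx_mul uJ ug.
have kJ : k *m (J *m g *m J^T) = 1%:M by rewrite mulVmx.
have e : J^T *m k *m J *m g = 1%:M.
  apply: (can_inj (mulmxK uJT)); rewrite mul1mx -!mulmxA.
  by rewrite [k *m _](_ : _ = 1%:M) ?mulmx1// mulmxA.
by rewrite -[LHS]mulmx1 -(mulmxV ug) mulmxA e mul1mx.
Qed.

(** The inverse metric transforms by the inverse congruence, so the Jacobians cancel in a metric
    trace. A general module [V] covers both scalar Hessians and the vector-valued second fundamental
    form. *)
Lemma contract_congruence (R : fieldType) (V : lmodType R) (J g g' : 'M[R]_2)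
    (h h' : 'I_2 -> 'I_2 -> V) :
  J \in unitmx -> g \in unitmx -> g' = J *m g *m J^T ->
  (forall i j, h' i j = \sum_(a < 2) \sum_(b < 2) (J i a * J j b) *: h a b) ->
  \sum_(i < 2) \sum_(j < 2) invmx g' i j *: h' i j =
  \sum_(a < 2) \sum_(b < 2) invmx g a b *: h a b.
Proof.
move=> uJ ug -> hE; set k := invmx (J *m g *m J^T).
have kE : invmx g = J^T *m k *m J := esym (invmx_congruence uJ ug).
have entry a b : invmx g a b = \sum_(i < 2) \sum_(j < 2) k i j * (J i a * J j b).
  rewrite kE -mulmxA mxE; apply: eq_bigr => i _; rewrite !mxE mulr_sumr.
  by apply: eq_bigr => j _; ring.
under eq_bigr => i _ do under eq_bigr => j _ do rewrite hE scaler_sumr.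
under eq_bigr => i _ do under eq_bigr => j _ do under eq_bigr => a _ do rewrite scaler_sumr.
under eq_bigr => i _ do rewrite exchange_big.
rewrite exchange_big; apply: eq_bigr => a _ /=.
under eq_bigr => i _ do rewrite exchange_big.
rewrite exchange_big; apply: eq_bigr => b _ /=.
rewrite entry scaler_suml; apply: eq_bigr => i _; rewrite scaler_suml.
by apply: eq_bigr => j _; rewrite scalerA.
Qed.

(** The second derivatives of [f] cancel, and the factor of its first derivatives does not involve
    [f]: what is learnt about this factor from one function holds for all. *)
Lemma hessian_defect_alg (R : comRingType) (GX : 'I_2 -> 'I_2 -> 'I_2 -> R)
    (GY : 'I_2 -> R) (f2 : 'I_2 -> 'I_2 -> R) (J : 'M[R]_2)
    (dJ f1 g1 : 'I_2 -> R) (g2 : R) i j :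
  g2 = \sum_(a < 2) (dJ a * f1 a + J j a * \sum_(b < 2) J i b * f2 b a) ->
  (forall k, g1 k = \sum_(a < 2) J k a * f1 a) ->
  f2 1 0 = f2 0 1 ->
  g2 - \sum_(k < 2) GY k * g1 k -
    \sum_(a < 2) \sum_(b < 2) J i a * J j b *
      (f2 a b - \sum_(k < 2) GX a b k * f1 k) =
  \sum_(c < 2) (dJ c + \sum_(a < 2) \sum_(b < 2) J i a * J j b * GX a b c
    - \sum_(k < 2) GY k * J k c) * f1 c.
Proof. by move=> -> g1E f2E; rewrite !sum2E !g1E !sum2E f2E; ring. Qed.

Lemma gram_congruence (R : realType) n m p (J : 'M[R]_(m, 2)) (K : 'M[R]_(p, 2))
    (g : 'M[R]_2) (e : 'I_2 -> 'rV[R]_n) i j :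
  (forall a b, g a b = dot (e a) (e b)) ->
  dot (\sum_(a < 2) J i a *: e a) (\sum_(b < 2) K j b *: e b) =
  (J *m g *m K^T) i j.
Proof.
move=> gE; rewrite mxE !sum2E !dotDl !dotDr !dotZl !dotZr.
rewrite ![(_ *m _) _ _]mxE ![K^T _ _]mxE !sum2E !gE.
by set a := dot (e 0) (e 0); set b := dot (e 0) (e 1); set c := dot (e 1) (e 0);
  set d := dot (e 1) (e 1); clearbody a b c d; ring.
Qed.

Lemma dot_combination0 (R : realType) n (A : 'rV[R]_n) (B : 'I_2 -> 'I_2 -> 'rV[R]_n)
    (v : 'I_2 -> 'rV[R]_n) (k : 'I_2 -> 'I_2 -> R) (l : 'I_2 -> R) :
  dot A (\sum_(m < 2) l m *: v m) = 0 ->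
  (forall a b m, dot (B a b) (v m) = 0) ->
  dot (A - \sum_(a < 2) \sum_(b < 2) k a b *: B a b) (\sum_(m < 2) l m *: v m) = 0.
Proof.
move=> A0 B0; rewrite dotBl A0 !sum2E !dotDl !dotDr !dotZl !dotZr !B0.
by rewrite !mulr0 !addr0 subr0.
Qed.

Section Reparametrization.
Context {R : realType}.
Variables (V W : set 'rV[R]_2) (X Y : 'rV[R]_2 -> 'rV[R]_3).
Variable phi : 'rV[R]_2 -> 'rV[R]_2.
Hypotheses (oV : open V) (oW : open W) (sX : smooth_on W X).
Hypotheses (sphi : smooth_on V phi) (phiW : forall q, V q -> W (phi q)).
Hypothesis YE : {in V, Y =1 X \o phi}.
Hypothesis sY : smooth_on V Y.

(** Row [i] is the derivative of [psi] in direction [i], the transpose of the usual Jacobian, so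
    that bilinear forms transform as [J g J^T]. *)
Definition jac (psi : 'rV[R]_2 -> 'rV[R]_2) q : 'M[R]_2 :=
  \matrix_(i, a) partial i psi q 0 a.

Let J := jac phi.

Let sphia a : smooth_on V (fun q => phi q 0 a).
Proof. by have /smooth_coord := sphi; exact. Qed.

Let JE q i a : V q -> J q i a = partial i (fun r => phi r 0 a) q.
Proof. by move=> Vq; rewrite mxE partial_coord//; exact: smooth_derivable Vq. Qed.

Opaque jac.

Let sJ i a : smooth_on V (fun q => J q i a).
Proof.
have s : smooth_on V (partial i (fun r => phi r 0 a)) by exact: smooth_partial.
by apply: smooth_eq s => // q /set_mem /JE ->.
Qed.

Let dphi q : V q -> differentiable phi q.
Proof. by move=> Vq; exact: smooth_differentiable_rV Vq sphi. Qed.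

Lemma partial_reparam (f g : 'rV[R]_2 -> R) q i : smooth_on W f ->
  {in V, g =1 f \o phi} -> V q ->
  partial i g q = \sum_(a < 2) J q i a * partial a f (phi q).
Proof.
move=> sf gE Vq; rewrite (partial_eq_on _ oV Vq gE).
rewrite partial_comp; [|exact: dphi|exact: smooth_differentiable oW (phiW Vq) sf].
by apply: eq_bigr => a _; rewrite mxE.
Qed.

Lemma partial_reparam_rV n (F G : 'rV[R]_2 -> 'rV[R]_n) q i : smooth_on W F ->
  {in V, G =1 F \o phi} -> V q ->
  partial i G q = \sum_(a < 2) J q i a *: partial a F (phi q).
Proof.
move=> sF GE Vq; rewrite (partial_eq_on _ oV Vq GE).
rewrite partial_comp; [|exact: dphi|exact: smooth_differentiable_rV oW (phiW Vq) sF].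
by apply: eq_bigr => a _; rewrite mxE.
Qed.

Lemma partial2_reparam (f g : 'rV[R]_2 -> R) q i j : smooth_on W f ->
  {in V, g =1 f \o phi} -> V q ->
  partial i (partial j g) q =
  \sum_(a < 2) (partial i (fun r => J r j a) q * partial a f (phi q) +
    J q j a * \sum_(b < 2) J q i b * partial b (partial a f) (phi q)).
Proof.
move=> sf gE Vq.
pose h r := \sum_(a < 2) J r j a * partial a f (phi r).
have hE : {in V, partial j g =1 h}.
  by move=> r /set_mem Vr; exact: partial_reparam.
rewrite (partial_eq_on _ oV Vq hE) /h.
under eq_fun do rewrite sum2E.
have dfa a : derivable (fun r => partial a f (phi r)) q (delta_mx 0 i).
  apply: diff_derivable; apply: (differentiable_comp (dphi Vq)).
  by apply: smooth_differentiable oW (phiW Vq) _; exact: smooth_partial.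
have dJ a : derivable (fun r => J r j a) q (delta_mx 0 i).
  exact: smooth_derivable (sJ j a) Vq.
have pfa a : partial i (fun r => partial a f (phi r)) q =
    \sum_(b < 2) J q i b * partial b (partial a f) (phi q).
  by apply: partial_reparam => //; exact: smooth_partial.
have pE a : partial i (fun r => J r j a * partial a f (phi r)) q =
    partial i (fun r => J r j a) q * partial a f (phi q)
    + J q j a * (\sum_(b < 2) J q i b * partial b (partial a f) (phi q)).
  apply: etrans (partialM (dJ a) (dfa a)) _; rewrite addrC.
  congr (_ + _); exact: (congr1 ( *%R (J q j a)) (pfa a)).
have dM a : derivable (fun r => J r j a * partial a f (phi r)) q (delta_mx 0 i).
  exact: derivableM (dJ a) (dfa a).
apply: (etrans (partialD (dM 0) (dM 1))); apply: (etrans _ (esym (sum2E _))).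
exact: (congr2 +%R (pE 0) (pE 1)).
Qed.

Lemma metric_reparam q : V q ->
  metric_mx Y q = J q *m metric_mx X (phi q) *m (J q)^T.
Proof.
move=> Vq; apply/matrixP => i j; rewrite metric_mxE.
rewrite (partial_reparam_rV i sX YE Vq) (partial_reparam_rV j sX YE Vq).
exact: gram_congruence (metric_mxE X (phi q)).
Qed.

(** The factors of an invertible product of square matrices are invertible. One point where the
    metric of [Y] is nondegenerate thus yields both the Jacobian and the metric of [X]. *)
Lemma reparam_unit q : V q -> metric_mx Y q \in unitmx ->
  J q \in unitmx /\ metric_mx X (phi q) \in unitmx.
Proof.
by move=> Vq; rewrite metric_reparam// !unitmx_mul => /andP[/andP[uJ ug] _].
Qed.

Hypothesis gX : forall r, W r -> metric_mx X r \in unitmx.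
Hypothesis gY : forall q, V q -> metric_mx Y q \in unitmx.

Let uJ q : V q -> J q \in unitmx.
Proof. by move=> Vq; have [] := reparam_unit Vq (gY Vq). Qed.

(** The error in the transformation law of the Christoffel symbols. *)
Let defect q i j c : R := partial i (fun r => J r j c) q
  + \sum_(a < 2) \sum_(b < 2) J q i a * J q j b * christoffel X a b c (phi q)
  - \sum_(k < 2) christoffel Y i j k q * J q k c.

Lemma hessian_defect (f g : 'rV[R]_2 -> R) q i j : smooth_on W f ->
  {in V, g =1 f \o phi} -> V q ->
  local_hessian Y g i j q -
    \sum_(a < 2) \sum_(b < 2) J q i a * J q j b * local_hessian X f a b (phi q)
  = \sum_(c < 2) defect q i j c * partial c f (phi q).
Proof.
move=> sf gE Vq.
have H := @hessian_defect_alg R (fun a b c => christoffel X a b c (phi q))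
  (fun k => christoffel Y i j k q) (fun a b => partial a (partial b f) (phi q))
  (J q) (fun c => partial i (fun r => J r j c) q) (fun a => partial a f (phi q))
  (fun k => partial k g q) (partial i (partial j g) q) i j
  (partial2_reparam i j sf gE Vq) (fun k => partial_reparam k sf gE Vq)
  (smooth_partialC 1 0 oW sf (phiW Vq)).
exact: H.
Qed.

Let second_form_coord (Z : 'rV[R]_2 -> 'rV[R]_3) (U : set 'rV[R]_2) i j q k :
  open U -> smooth_on U Z -> U q ->
  (local_second_form Z i j q) 0 k = local_hessian Z (fun r => Z r 0 k) i j q.
Proof.
move=> oU sZ Uq; rewrite /local_second_form /local_hessian mxE.
have dZ l r : U r -> derivable Z r (delta_mx 0 l) by exact: smooth_derivable sZ.
congr (_ + _).
  rewrite partial_coord; last by apply: smooth_derivable Uq; exact: smooth_partial.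
  apply: (partial_eq_on _ oU Uq) => r /set_mem Ur.
  by rewrite partial_coord//; exact: dZ.
rewrite mxE summxE; congr (- _); apply: eq_bigr => l _.
by rewrite mxE partial_coord//; exact: dZ.
Qed.

(** Each coordinate of [X] is a scalar function, whose Hessian is the same coordinate of the second
    fundamental form; [hessian_defect] applies to it. *)
Lemma second_form_defect q i j : V q ->
  local_second_form Y i j q -
    \sum_(a < 2) \sum_(b < 2) (J q i a * J q j b) *: local_second_form X a b (phi q)
  = \sum_(c < 2) defect q i j c *: partial c X (phi q).
Proof.
move=> Vq; apply/rowP => k; have /smooth_coord sXk := sX.
have YkE : {in V, (fun r => Y r 0 k) =1 (fun r => X r 0 k) \o phi}.
  by move=> r /YE ->.
have H := hessian_defect i j (sXk oW k) YkE Vq.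
have subE (A B : 'rV[R]_3) : (A - B) 0 k = A 0 k - B 0 k by rewrite !mxE.
rewrite subE (second_form_coord _ _ _ oV sY Vq) summxE [in RHS]summxE.
transitivity (\sum_(c < 2) defect q i j c * partial c (fun r => X r 0 k) (phi q)).
  rewrite -H; congr (_ - _); apply: eq_bigr => a _; rewrite summxE.
  by apply: eq_bigr => b _; rewrite mxE (second_form_coord _ _ _ oW sX (phiW Vq)).
apply: eq_bigr => c _; rewrite mxE; congr (_ * _).
by rewrite partial_coord//; exact: smooth_derivable sX (phiW Vq).
Qed.

(** The vector with these coefficients is tangent to the surface. By [second_form_defect] it is also
    a combination of normal vectors, so it is zero, and the coordinate fields are independent. No
    direct computation with Christoffel symbols is involved. *)
Lemma defect0 q i j c : V q -> defect q i j c = 0.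
Proof.
move=> Vq; pose e : 'rV[R]_2 := \row_c defect q i j c.
have YdE m : partial m Y q = \sum_(a < 2) J q m a *: partial a X (phi q).
  exact: partial_reparam_rV sX YE Vq.
have nX a b l : dot (local_second_form X a b (phi q)) (partial l X (phi q)) = 0.
  exact: (second_form_normal oW sX gX a b l (phiW Vq)).
have nY m : dot (local_second_form Y i j q) (partial m Y q) = 0.
  exact: (second_form_normal oV sY gY i j m Vq).
have e0 : e *m metric_mx X (phi q) *m (J q)^T = 0.
  apply/rowP => m; rewrite [RHS]mxE.
  transitivity (dot (\sum_(c < 2) defect q i j c *: partial c X (phi q)) (partial m Y q)).
    rewrite YdE.
    have dE : \sum_(c < 2) defect q i j c *: partial c X (phi q) =
              \sum_(c < 2) e 0 c *: partial c X (phi q).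
      by apply: eq_bigr => a _; rewrite [e 0 a]mxE.
    rewrite dE; apply/esym.
    exact: gram_congruence (metric_mxE X (phi q)).
  rewrite (congr1 (fun u => dot u _) (esym (second_form_defect i j Vq))).
  have := nY m; rewrite (YdE m) => nYm.
  exact: dot_combination0 nYm nX.
have ug := gX (phiW Vq); have uJT : (J q)^T \in unitmx by rewrite unitmx_tr uJ.
suff : e = 0 by move=> /rowP/(_ c); rewrite !mxE.
have eg0 : e *m metric_mx X (phi q) = 0.
  by rewrite -[LHS](mulmxK uJT) e0 mul0mx.
by rewrite -[e](mulmxK ug) eg0 mul0mx.
Qed.

Lemma hessian_reparam (f g : 'rV[R]_2 -> R) q i j : smooth_on W f ->
  {in V, g =1 f \o phi} -> V q ->
  local_hessian Y g i j q =
  \sum_(a < 2) \sum_(b < 2) (J q i a * J q j b) *: (local_hessian X f a b (phi q) : R^o).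
Proof.
move=> sf gE Vq; apply/eqP; rewrite -subr_eq0; apply/eqP.
apply: etrans (hessian_defect i j sf gE Vq) _.
by apply: big1 => c _; rewrite defect0// mul0r.
Qed.

Lemma second_form_reparam q i j : V q ->
  local_second_form Y i j q =
  \sum_(a < 2) \sum_(b < 2) (J q i a * J q j b) *: local_second_form X a b (phi q).
Proof.
move=> Vq; apply/eqP; rewrite -subr_eq0 second_form_defect//; apply/eqP.
by apply: big1 => c _; rewrite defect0// scale0r.
Qed.

Lemma contract_hessian_reparam (f g : 'rV[R]_2 -> R) q : smooth_on W f ->
  {in V, g =1 f \o phi} -> V q ->
  \sum_(i < 2) \sum_(j < 2) metric_inv Y q i j * local_hessian Y g i j q =
  \sum_(a < 2) \sum_(b < 2) metric_inv X (phi q) a b * local_hessian X f a b (phi q).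
Proof.
move=> sf fg Vq.
exact: (@contract_congruence R R^o _ _ _ (fun a b => local_hessian X f a b (phi q))
  (fun i j => local_hessian Y g i j q) (uJ Vq) (gX (phiW Vq)) (metric_reparam Vq)
  (fun i j => hessian_reparam i j sf fg Vq)).
Qed.

Lemma mean_curvature_vector_reparam q : V q ->
  local_mean_curvature_vector Y q = local_mean_curvature_vector X (phi q).
Proof.
move=> Vq; apply: (congr1 ( *:%R 2^-1)).
exact: (contract_congruence (uJ Vq) (gX (phiW Vq)) (metric_reparam Vq)
  (fun i j => second_form_reparam i j Vq)).
Qed.

End Reparametrization.

(** * Codazzi equation for the squared mean curvature *)

(** The letters are values at one point: [b] is beta, [u2], [dg], [dW], [dk] are derivatives,
    [dT l i j] is the [l]-th derivative of the prescribed right side for [b i j], and [s i j l]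
    stands for <d_i d_j X, d_l H>. The two Codazzi equations, [j = 0] and [j = 1], are contracted
    with [(w 1, - w 0)], which [w] annihilates; the result has the factor [W]. *)
Lemma codazzi_trace_alg (R : realFieldType) (g u2 b : 'I_2 -> 'I_2 -> R)
    (c dg : 'I_2 -> 'I_2 -> 'I_2 -> R) (w dW dk : 'I_2 -> R) (u W k : R)
    (D := g 0 0 * g 1 1 - g 0 1 * g 0 1)
    (h := fun i j => u2 i j - \sum_(m < 2) c i j m * w m)
    (dT := fun l i j => w l * g i j + u * dg l i j
       + (dk l * (2 * w i * w j - W * g i j)
          + k * (2 * (u2 l i * w j + w i * u2 l j) - (dW l * g i j + W * dg l i j))))
    (s := fun i j l => b i j * w l / (2 * u) - \sum_(m < 2) c i j m * b l m) :
  g 1 0 = g 0 1 -> u2 1 0 = u2 0 1 -> (forall m, c 1 0 m = c 0 1 m) ->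
  D != 0 -> u != 0 ->
  (forall l i j, dg l i j =
     \sum_(m < 2) c l i m * g m j + \sum_(m < 2) c l j m * g m i) ->
  W * D = g 1 1 * (w 0 * w 0) - 2 * (g 0 1 * (w 0 * w 1)) + g 0 0 * (w 1 * w 1) ->
  (forall l, dW l * D + W * (dg l 0 0 * g 1 1 + g 0 0 * dg l 1 1 - 2 * (g 0 1 * dg l 0 1))
   = dg l 1 1 * (w 0 * w 0) + g 1 1 * (2 * (w 0 * u2 l 0))
     - 2 * (dg l 0 1 * (w 0 * w 1) + g 0 1 * (u2 l 0 * w 1 + w 0 * u2 l 1))
     + (dg l 0 0 * (w 1 * w 1) + g 0 0 * (2 * (w 1 * u2 l 1)))) ->
  (forall l, dk l * (u * u) + k * (2 * (u * w l)) = 0) ->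
  (forall i j, b i j = u * g i j + k * (2 * w i * w j - W * g i j)) ->
  (forall j, s 1 j 0 - s 0 j 1 = dT 0 1 j - dT 1 0 j) ->
  W * (D * (u + 5 * k * W)
       - 4 * k * u * (g 1 1 * h 0 0 - 2 * g 0 1 * h 0 1 + g 0 0 * h 1 1)) = 0.
Proof.
move=> g10 u10 c10 D0 u0 dgE WE dWE dkE bE cod.
pose N := g 1 1 * (w 0 * w 0) - 2 * (g 0 1 * (w 0 * w 1)) + g 0 0 * (w 1 * w 1).
have WE' : W = N / D by rewrite -[N]WE mulfK.
have dkE' l : dk l = - (2 * k * w l) / u.
  apply: (mulIf (mulf_neq0 u0 u0)); have := dkE l => /eqP; rewrite addr_eq0 => /eqP ->.
  by field.
pose dN l := dg l 1 1 * (w 0 * w 0) + g 1 1 * (2 * (w 0 * u2 l 0))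
     - 2 * (dg l 0 1 * (w 0 * w 1) + g 0 1 * (u2 l 0 * w 1 + w 0 * u2 l 1))
     + (dg l 0 0 * (w 1 * w 1) + g 0 0 * (2 * (w 1 * u2 l 1))).
have dWE' l : dW l = (dN l - W * (dg l 0 0 * g 1 1 + g 0 0 * dg l 1 1
    - 2 * (g 0 1 * dg l 0 1))) / D.
  by rewrite -[dN l]dWE addrK mulfK.
(* The claim is [2 * u] times the contracted equation, an identity of rational functions once all
   derived quantities are substituted. *)
suff -> : W * (D * (u + 5 * k * W) - 4 * k * u
      * (g 1 1 * h 0 0 - 2 * g 0 1 * h 0 1 + g 0 0 * h 1 1))
    = 2 * u * ((s 1 0 0 - s 0 0 1 - (dT 0 1 0 - dT 1 0 0)) * w 1
               - (s 1 1 0 - s 0 1 1 - (dT 0 1 1 - dT 1 0 1)) * w 0).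
  by rewrite !cod !subrr !mul0r subr0 mulr0.
rewrite /s /dT /h !dWE' /dN !dkE' !dgE !sum2E !bE WE' /N !c10 u10 g10.
rewrite /D in D0 *.
field.
by rewrite D0 u0.
Qed.

(** * Tangent frames completed by a normal vector *)

Lemma dot_mulmx (R : realType) n (u v : 'rV[R]_n) : dot u v = (u *m v^T) 0 0.
Proof. by rewrite mxE; apply: eq_bigr => k _; rewrite mxE. Qed.

Lemma dot_suml (R : realType) n (I : Type) (r : seq I) (F : I -> 'rV[R]_n) v :
  dot (\sum_(i <- r) F i) v = \sum_(i <- r) dot (F i) v.
Proof.
elim: r => [|a r IHr]; first by rewrite !big_nil dot0l.
by rewrite !big_cons dotDl IHr.
Qed.

Section Frame.
Context {R : realType}.
Variables (e : 'I_2 -> 'rV[R]_3) (g : 'M[R]_2) (H : 'rV[R]_3).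
Hypotheses (gE : forall a b, g a b = dot (e a) (e b)) (ug : g \in unitmx).
Hypotheses (He : forall a, dot H (e a) = 0) (H0 : dot H H != 0).

(** The Gram matrix of [e 0], [e 1], [H] is block diagonal with blocks [g] and <H,H>, both
    invertible, so the three vectors form a basis. *)
Lemma frame_orthogonal0 Q : (forall a, dot Q (e a) = 0) -> dot Q H = 0 -> Q = 0.
Proof.
move=> Qe QH; pose E : 'M[R]_(2, 3) := \matrix_(i, j) e i 0 j.
have EE (P : 'rV[R]_3) : P *m E^T = \row_a dot P (e a).
  by apply/rowP => a; rewrite !mxE; apply: eq_bigr => k _; rewrite !mxE.
pose B : 'M[R]_3 := col_mx E H.
have uB : B \in unitmx.
  suff : B *m B^T \in unitmx by rewrite unitmx_mul => /andP[].
  have -> : B *m B^T =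
      block_mx (E *m E^T) (E *m H^T) (H *m E^T) (H *m H^T) :> 'M[R]_(2 + 1).
    by rewrite -mul_col_row -tr_col_mx.
  have -> : E *m E^T = g.
    apply/matrixP => i j; rewrite gE !mxE; apply: eq_bigr => k _.
    by rewrite !mxE.
  have -> : H *m E^T = 0 by rewrite EE; apply/rowP => a; rewrite !mxE He.
  rewrite [X in is_true X](unitmxE (_ : 'M[R]_(2 + 1))) det_ublock unitrM -unitmxE ug/= det_mx11.
  by rewrite -dot_mulmx unitfE.
rewrite -[LHS]mulmx1 -(mulmxV (_ : B^T \in unitmx)); last by rewrite unitmx_tr.
rewrite mulmxA (_ : Q *m B^T = 0) ?mul0mx//.
have -> : Q *m B^T = row_mx (Q *m E^T) (Q *m H^T) :> 'rV[R]_(2 + 1).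
  by rewrite -mul_mx_row -tr_col_mx.
rewrite EE (_ : \row_a _ = 0); last by apply/rowP => a; rewrite !mxE Qe.
rewrite (_ : Q *m H^T = 0) ?row_mx0//.
by apply/rowP => a; rewrite (ord1 a) -dot_mulmx QH mxE.
Qed.

Lemma frame_expansion P :
  P = \sum_(k < 2) ((\row_a dot P (e a)) *m invmx g) 0 k *: e k
      + (dot P H / dot H H) *: H.
Proof.
set T := (\row_a dot P (e a)) *m invmx g.
apply/eqP; rewrite -subr_eq0; apply/eqP; apply: frame_orthogonal0.
  move=> a; rewrite dotBl dotDl dotZl He mulr0 addr0 sum2E dotDl !dotZl -!gE.
  have -> : dot P (e a) = (T *m g) 0 a by rewrite mulmxKV// mxE.
  by rewrite mxE sum2E subrr.
rewrite dotBl dotDl dotZl sum2E dotDl !dotZl (dotC (e 0)) (dotC (e 1)) !He.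
by rewrite !mulr0 !add0r divfK// subrr.
Qed.

Lemma frame_dot P Q : dot P Q =
  ((\row_a dot P (e a)) *m invmx g *m (\row_a dot Q (e a))^T) 0 0
  + dot P H * dot Q H / dot H H.
Proof.
rewrite {1}[P]frame_expansion dotDl dotZl sum2E dotDl !dotZl [RHS]addrC.
rewrite [in RHS]mxE sum2E ![_^T _ _]mxE ![(\row_a _) 0 _]mxE.
rewrite (dotC Q (e 0)) (dotC Q (e 1)) (dotC Q H) addrC mulrAC.
by [].
Qed.

Lemma frame_normal P : (forall a, dot P (e a) = 0) ->
  P = (dot P H / dot H H) *: H.
Proof.
move=> Pe; rewrite {1}[P]frame_expansion (_ : \row_a _ = 0).
  by rewrite mul0mx big1 ?add0r// => k _; rewrite mxE scale0r.
by apply/rowP => a; rewrite !mxE Pe.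
Qed.

End Frame.

Lemma row_sandwich (R : comRingType) n (a b : 'rV[R]_n) (B G : 'M[R]_n) i j :
  a = - row i B -> b = - row j B -> (forall k l, B k l = B l k) ->
  (a *m G *m b^T) 0 0 = (B *m G *m B) i j.
Proof.
move=> -> -> Bsym; rewrite mulNmx linearN/= mulmxN mulNmx opprK -!row_mul.
by rewrite [LHS]mxE [LHS]mxE [RHS]mxE; apply: eq_bigr => k _; rewrite !mxE Bsym.
Qed.

(** * Derivatives of the expressions in the Codazzi equation *)

Section PartialRules.
Context {R : realType}.
Variables (l : 'I_2) (q : 'rV[R]_2).
Implicit Types (f g : 'rV[R]_2 -> R).

(** Existence and value are bundled so that the rules compose along the structure of an expression,
    with no separate derivability conditions. *)
Definition has_partial f d := derivable f q (delta_mx 0 l) /\ partial l f q = d.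

Lemma has_partial_cst c : has_partial (fun _ => c) 0.
Proof. by split; [exact: derivable_cst|exact: partial_cst]. Qed.

Lemma has_partialD f g df dg : has_partial f df -> has_partial g dg ->
  has_partial (fun r => f r + g r) (df + dg).
Proof.
by move=> [f1 <-] [g1 <-]; split; [exact: derivableD|exact: partialD].
Qed.

Lemma has_partialM f g df dg : has_partial f df -> has_partial g dg ->
  has_partial (fun r => f r * g r) (f q * dg + df * g q).
Proof.
by move=> [f1 <-] [g1 <-]; split; [exact: derivableM|exact: partialM].
Qed.

Lemma has_partialN f df : has_partial f df -> has_partial (fun r => - f r) (- df).
Proof.
move=> fdf; have := has_partialM (has_partial_cst (-1)) fdf.
rewrite mul0r addr0 mulN1r; congr has_partial.
by apply/funext => r; rewrite mulN1r.
Qed.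

Lemma has_partial_eq f d d' : has_partial f d -> d = d' -> has_partial f d'.
Proof. by move=> fd <-. Qed.

Lemma has_partial_quadratic (g00 g01 g11 w0 w1 : 'rV[R]_2 -> R) (d00 d01 d11 e0 e1 : R) :
  has_partial g00 d00 -> has_partial g01 d01 -> has_partial g11 d11 ->
  has_partial w0 e0 -> has_partial w1 e1 ->
  has_partial (fun r => g11 r * (w0 r * w0 r) - 2 * (g01 r * (w0 r * w1 r))
     + g00 r * (w1 r * w1 r))
   (d11 * (w0 q * w0 q) + g11 q * (2 * (w0 q * e0))
     - 2 * (d01 * (w0 q * w1 q) + g01 q * (e0 * w1 q + w0 q * e1))
     + (d00 * (w1 q * w1 q) + g00 q * (2 * (w1 q * e1)))).
Proof.
move=> h1 h2 h3 h4 h5; have c := has_partial_cst 2.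
apply: has_partial_eq (has_partialD (has_partialD
  (has_partialM h3 (has_partialM h4 h4))
  (has_partialN (has_partialM c (has_partialM h2 (has_partialM h4 h5)))))
  (has_partialM h1 (has_partialM h5 h5))) _.
by ring.
Qed.

Lemma has_partial_scaled_det (g00 g01 g11 w : 'rV[R]_2 -> R) (d00 d01 d11 e : R) :
  has_partial g00 d00 -> has_partial g01 d01 -> has_partial g11 d11 ->
  has_partial w e ->
  has_partial (fun r => w r * (g00 r * g11 r - g01 r * g01 r))
   (e * (g00 q * g11 q - g01 q * g01 q)
    + w q * (d00 * g11 q + g00 q * d11 - 2 * (g01 q * d01))).
Proof.
move=> h1 h2 h3 h4.
apply: has_partial_eq (has_partialM h4 (has_partialD (has_partialM h1 h3)
  (has_partialN (has_partialM h2 h2)))) _.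
by ring.
Qed.

Lemma has_partial_scaled_square (k u : 'rV[R]_2 -> R) (dk du : R) :
  has_partial k dk -> has_partial u du ->
  has_partial (fun r => k r * (u r * u r)) (dk * (u q * u q) + k q * (2 * (u q * du))).
Proof.
move=> h1 h2; apply: has_partial_eq (has_partialM h1 (has_partialM h2 h2)) _.
by ring.
Qed.

Lemma has_partial_tensor (u g k wi wj W : 'rV[R]_2 -> R) (du dg dk di dj dW : R) :
  has_partial u du -> has_partial g dg -> has_partial k dk ->
  has_partial wi di -> has_partial wj dj -> has_partial W dW ->
  has_partial (fun r => u r * g r + k r * (2 * wi r * wj r - W r * g r))
   (du * g q + u q * dg + (dk * (2 * wi q * wj q - W q * g q)
      + k q * (2 * (di * wj q + wi q * dj) - (dW * g q + W q * dg)))).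
Proof.
move=> h1 h2 h3 h4 h5 h6; have c := has_partial_cst 2.
apply: has_partial_eq (has_partialD (has_partialM h1 h2)
  (has_partialM h3 (has_partialD (has_partialM (has_partialM c h4) h5)
    (has_partialN (has_partialM h6 h2))))) _.
by ring.
Qed.

End PartialRules.

(** * The second fundamental form paired with the mean curvature vector *)

Section MeanCurvatureForms.
Context {R : realType}.
Variable X : 'rV[R]_2 -> 'rV[R]_3.

(** This and the next four are [u], beta, [w], [W] and tr(Hess u) of the overview, in one chart.
    None of them refers to a unit normal. *)
Definition mean_sq q : R :=
  dot (local_mean_curvature_vector X q) (local_mean_curvature_vector X q).

Definition mean_form q : 'M[R]_2 :=
  \matrix_(i, j) dot (local_second_form X i j q) (local_mean_curvature_vector X q).

Definition mean_sq_diff q : 'rV[R]_2 := \row_i partial i mean_sq q.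

Definition mean_sq_grad2 q : R :=
  (mean_sq_diff q *m metric_inv X q *m (mean_sq_diff q)^T) 0 0.

Definition mean_sq_trace_hessian q : R :=
  \sum_(i < 2) \sum_(j < 2) metric_inv X q i j * local_hessian X mean_sq i j q.

End MeanCurvatureForms.

Section LocalFacts.
Context {R : realType}.
Variables (W : set 'rV[R]_2) (X : 'rV[R]_2 -> 'rV[R]_3).
Hypotheses (oW : open W) (sX : smooth_on W X).
Hypothesis gW : forall q, W q -> metric_mx X q \in unitmx.
Hypothesis uW : forall q, W q -> mean_sq X q != 0.

Let H := local_mean_curvature_vector X.
Let u := mean_sq X.
Let sH : smooth_on W H := smooth_mean_curvature_vector oW sX gW.
Let su : smooth_on W u := smooth_dot oW sH sH.
Let sXi i : smooth_on W (partial i X) := smooth_partial i sX.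

Lemma mean_curvature_normal q a : W q -> dot (H q) (partial a X q) = 0.
Proof.
move=> Wq; have n i j := second_form_normal oW sX gW i j a Wq.
rewrite /H /local_mean_curvature_vector dotZl dot_suml big1 ?mulr0// => i _.
by rewrite dot_suml big1// => j _; rewrite dotZl n mulr0.
Qed.

Lemma mean_formE q i j : W q ->
  mean_form X q i j = dot (partial i (partial j X) q) (H q).
Proof.
move=> Wq; rewrite mxE /local_second_form dotBl dot_suml big1 ?subr0// => k _.
by rewrite dotZl dotC (mean_curvature_normal k Wq) mulr0.
Qed.

Lemma mean_form_sym q i j : W q -> mean_form X q i j = mean_form X q j i.
Proof. move=> Wq; rewrite (mean_formE i j Wq) (mean_formE j i Wq).
by rewrite (smooth_partialC_rV i j oW sX Wq). Qed.

Lemma second_form_mean q i j : W q ->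
  local_second_form X i j q = (mean_form X q i j / u q) *: H q.
Proof.
move=> Wq; rewrite [mean_form X q i j]mxE.
exact: (frame_normal (metric_mxE X q) (gW Wq)
  (fun a => mean_curvature_normal a Wq) (uW Wq)
  (fun a => second_form_normal oW sX gW i j a Wq)).
Qed.

Lemma partial_mean_sq q i : W q -> partial i u q = 2 * dot (partial i H q) (H q).
Proof.
move=> Wq; rewrite /u /mean_sq.
rewrite (partial_dot (smooth_derivable sH Wq) (smooth_derivable sH Wq)).
by rewrite (dotC (H q)) mulr2n mulrDl mul1r.
Qed.

(** Obtained by differentiating <H, d_m X> = 0. *)
Lemma partial_mean_tangent q i m : W q ->
  dot (partial i H q) (partial m X q) = - mean_form X q i m.
Proof.
move=> Wq; have E := partial_dot (smooth_derivable (i := i) sH Wq) (smooth_derivable (sXi m) Wq).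
have z : partial i (fun r => dot (H r) (partial m X r)) q = 0.
  rewrite (partial_eq_on (G := fun _ => 0) i oW Wq); first exact: partial_cst.
  by move=> r /set_mem Wr; exact: mean_curvature_normal.
rewrite z in E; rewrite (mean_formE i m Wq) (dotC _ (H q)).
by apply/eqP; rewrite -addr_eq0 -E.
Qed.

(** The Gauss formula splits the second partial of [X] into a multiple of [H] and a tangent vector,
    and the derivative of [H] is known against both. These terms survive in the Codazzi equation
    once the third partials cancel. *)
Lemma dot_second_partial q i j l : W q ->
  dot (partial i (partial j X) q) (partial l H q) =
  mean_form X q i j * partial l u q / (2 * u q)
  - \sum_(m < 2) christoffel X i j m q * mean_form X q l m.
Proof.
move=> Wq; have := second_form_mean i j Wq.
rewrite /local_second_form => /eqP; rewrite subr_eq => /eqP ->.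
rewrite dotDl dotZl dot_suml (dotC (H q)) (partial_mean_sq l Wq) -sumrN.
congr (_ + _); last first.
  apply: eq_bigr => m _.
  by rewrite dotZl dotC (partial_mean_tangent _ _ Wq) mulrN.
have := uW Wq; rewrite -/(u q); move: (u q) (mean_form X q i j) (dot _ _) => a b c a0.
by field.
Qed.

Lemma mean_sq_trace q : W q ->
  \sum_(i < 2) \sum_(j < 2) metric_inv X q i j * mean_form X q i j = 2 * u q.
Proof.
move=> Wq; rewrite /u /mean_sq -[X in _ * dot X _]/(2^-1 *: _) dotZl mulrA divff ?mul1r//.
rewrite dot_suml; apply: eq_bigr => i _; rewrite dot_suml; apply: eq_bigr => j _.
by rewrite dotZl mxE.
Qed.

Lemma dot_partial_mean q i j : W q ->
  dot (partial i H q) (partial j H q) =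
  (mean_form X q *m metric_inv X q *m mean_form X q) i j
  + partial i u q * partial j u q / (4 * u q).
Proof.
move=> Wq.
have Hn a : dot (H q) (partial a X q) = 0 by exact: mean_curvature_normal.
rewrite (frame_dot (metric_mxE X q) (gW Wq) Hn (uW Wq) (partial i H q)).
congr (_ + _); last first.
  rewrite (partial_mean_sq i Wq) (partial_mean_sq j Wq).
  have alg (a b c : R) : c != 0 -> a * b / c = 2 * a * (2 * b) / (4 * c).
    by move=> c0; field.
  exact: alg (uW Wq).
have rE k : \row_a dot (partial k H q) (partial a X q) = - row k (mean_form X q).
  by apply/rowP => a; rewrite [LHS]mxE (partial_mean_tangent k a Wq) !mxE.
exact: (@row_sandwich R 2 _ _ (mean_form X q) (metric_inv X q) i j (rE i) (rE j)
  (fun a b => mean_form_sym a b Wq)).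
Qed.

(** Compatibility of the connection with the metric, read off from the tangential parts of the
    second partials of [X]. *)
Lemma partial_metric q l i j : W q ->
  partial l (fun r => metric_mx X r i j) q =
  \sum_(m < 2) christoffel X l i m q * metric_mx X q m j
  + \sum_(m < 2) christoffel X l j m q * metric_mx X q m i.
Proof.
move=> Wq.
have tang a b c : dot (partial a (partial b X) q) (partial c X q) =
    \sum_(m < 2) christoffel X a b m q * metric_mx X q m c.
  have := second_form_normal oW sX gW a b c Wq.
  rewrite /local_second_form dotBl => /eqP; rewrite subr_eq0 => /eqP ->.
  by rewrite dot_suml; apply: eq_bigr => m _; rewrite dotZl metric_mxE.
transitivity (partial l (fun r => dot (partial i X r) (partial j X r)) q).
  by apply: (partial_eq_on _ oW Wq) => r _; rewrite metric_mxE.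
apply: (etrans (partial_dot (smooth_derivable (sXi i) Wq) (smooth_derivable (sXi j) Wq))).
exact: (congr2 +%R (tang l i j) (etrans (dotC _ _) (tang l j i))).
Qed.

Lemma smooth_mean_sq_grad2 : smooth_on W (mean_sq_grad2 X).
Proof.
have s : smooth_on W (fun q => \sum_(j < 2) (\sum_(i < 2) partial i u q * metric_inv X q i j) * partial j u q).
  apply: smooth_sum => // j; apply: smoothM => //; last exact: smooth_partial.
  apply: smooth_sum => // i; apply: smoothM => //; first exact: smooth_partial.
  exact: smooth_metric_inv.
apply: smooth_eq s => // q _; rewrite /mean_sq_grad2 mxE; apply: eq_bigr => j _.
rewrite mxE [_^T _ _]mxE [mean_sq_diff _ _ _ _]mxE; congr (_ * _).
by apply: eq_bigr => i _; rewrite [mean_sq_diff _ _ _ _]mxE.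
Qed.

Lemma smooth_mean_sq_trace_hessian : smooth_on W (mean_sq_trace_hessian X).
Proof.
apply: smooth_sum => // i; apply: smooth_sum => // j; apply: smoothM => //.
  exact: smooth_metric_inv.
exact: smooth_hessian.
Qed.

Let g q i j := metric_mx X q i j.

Lemma det_metric q : \det (metric_mx X q) = g q 0 0 * g q 1 1 - g q 0 1 * g q 0 1.
Proof. by rewrite det2E /g [metric_mx X q 1 0]metric_mxE dotC -metric_mxE. Qed.

Let det_neq0 q : W q -> g q 0 0 * g q 1 1 - g q 0 1 * g q 0 1 != 0.
Proof. by move=> /gW; rewrite unitmxE unitfE det_metric. Qed.

(** The factor det g removes the inverse metric, so that only polynomial expressions have to be
    differentiated. *)
Lemma mean_sq_grad2E q : W q ->
  mean_sq_grad2 X q * (g q 0 0 * g q 1 1 - g q 0 1 * g q 0 1) =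
  g q 1 1 * (partial 0 u q * partial 0 u q)
  - 2 * (g q 0 1 * (partial 0 u q * partial 1 u q))
  + g q 0 0 * (partial 1 u q * partial 1 u q).
Proof.
move=> Wq; have [e00 e01 e10 e11] := metric_invE gW Wq.
have := det_neq0 Wq; rewrite -det_metric.
rewrite /mean_sq_grad2 mxE sum2E ![(_ *m _) 0 _]mxE !sum2E ![_^T _ _]mxE.
rewrite ![mean_sq_diff _ _ _ _]mxE e00 e01 e10 e11 -/(g q 0 0) -/(g q 0 1) -/(g q 1 1).
move: (\det _) (partial 0 _ _) (partial 1 _ _) (g q 0 0) (g q 0 1) (g q 1 1).
by move=> D a b x y z D0; field.
Qed.

Lemma christoffel_sym q i j m : W q -> christoffel X i j m q = christoffel X j i m q.
Proof.
move=> Wq; rewrite (christoffelE oW sX i j m Wq) (christoffelE oW sX j i m Wq).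
by apply: eq_bigr => l _; rewrite (smooth_partialC_rV i j oW sX Wq).
Qed.

Let h q i j := partial i (partial j u) q - \sum_(m < 2) christoffel X i j m q * partial m u q.

Lemma mean_sq_trace_hessianE q : W q ->
  mean_sq_trace_hessian X q * (g q 0 0 * g q 1 1 - g q 0 1 * g q 0 1) =
  g q 1 1 * h q 0 0 - 2 * g q 0 1 * h q 0 1 + g q 0 0 * h q 1 1.
Proof.
move=> Wq; have [e00 e01 e10 e11] := metric_invE gW Wq.
have hsym : h q 1 0 = h q 0 1.
  rewrite /h (smooth_partialC 1 0 oW su Wq); congr (_ - _).
  by apply: eq_bigr => m _; rewrite (christoffel_sym 1 0 m Wq).
have -> : mean_sq_trace_hessian X q =
    \sum_(i < 2) \sum_(j < 2) metric_inv X q i j * h q i j by [].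
have := det_neq0 Wq; rewrite -det_metric !sum2E e00 e01 e10 e11 hsym.
rewrite -/(g q 0 0) -/(g q 0 1) -/(g q 1 1).
move: (\det _) (h q 0 0) (h q 0 1) (h q 1 1) (g q 0 0) (g q 0 1) (g q 1 1).
by move=> D a b c x y z D0; field.
Qed.

Section Umbilicity.
Variables (U : set 'rV[R]_2) (eps : R).
Hypotheses (oU : open U) (UW : U `<=` W).
Let k r := eps / 16 * (u r * u r)^-1.
Hypothesis formU : forall r, U r -> forall i j, mean_form X r i j =
  u r * g r i j + k r * (2 * partial i u r * partial j u r - mean_sq_grad2 X r * g r i j).

Let sk : smooth_on W k.
Proof.
apply: smoothM => //; first exact: (smooth_cst W (eps / 16 : R)).
apply: smoothV => //; last exact: smoothM.
by move=> r Wr; rewrite mulf_neq0//; exact: uW.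
Qed.

(** Where the sign is a constant [eps], the formula for beta can be differentiated; comparing with
    [dot_second_partial] expresses the Codazzi equation through [u] and the metric alone. *)
Lemma codazzi_mean_sq q : U q ->
  mean_sq_grad2 X q * (u q + 5 * k q * mean_sq_grad2 X q
    - 4 * k q * u q * mean_sq_trace_hessian X q) = 0.
Proof.
move=> Uq; have Wq := UW Uq.
have hp (f : 'rV[R]_2 -> R) l : smooth_on W f -> has_partial l q f (partial l f q).
  by move=> sf; split => //; exact: smooth_derivable sf Wq.
have hu l := hp u l su; have hw i l := hp (partial i u) l (smooth_partial i su).
have hk l := hp k l sk; have hW l := hp (mean_sq_grad2 X) l smooth_mean_sq_grad2.
have hg i j l := hp (fun r => g r i j) l (smooth_metric oW sX i j).
have D0 := det_neq0 Wq.
have dWE l : partial l (mean_sq_grad2 X) q * (g q 0 0 * g q 1 1 - g q 0 1 * g q 0 1)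
   + mean_sq_grad2 X q * (partial l (fun r => g r 0 0) q * g q 1 1
      + g q 0 0 * partial l (fun r => g r 1 1) q - 2 * (g q 0 1 * partial l (fun r => g r 0 1) q))
   = partial l (fun r => g r 1 1) q * (partial 0 u q * partial 0 u q)
     + g q 1 1 * (2 * (partial 0 u q * partial l (partial 0 u) q))
     - 2 * (partial l (fun r => g r 0 1) q * (partial 0 u q * partial 1 u q)
        + g q 0 1 * (partial l (partial 0 u) q * partial 1 u q
                     + partial 0 u q * partial l (partial 1 u) q))
     + (partial l (fun r => g r 0 0) q * (partial 1 u q * partial 1 u q)
        + g q 0 0 * (2 * (partial 1 u q * partial l (partial 1 u) q))).
  have [_ <-] := has_partial_scaled_det (hg 0 0 l) (hg 0 1 l) (hg 1 1 l) (hW l).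
  have [_ <-] := has_partial_quadratic (hg 0 0 l) (hg 0 1 l) (hg 1 1 l) (hw 0 l) (hw 1 l).
  by apply: (partial_eq_on _ oW Wq) => r /set_mem Wr; exact: mean_sq_grad2E.
(* The product of [k] and [u ^+ 2] is the constant [eps / 16]. *)
have dkE l : partial l k q * (u q * u q) + k q * (2 * (u q * partial l u q)) = 0.
  have [_ <-] := has_partial_scaled_square (hk l) (hu l).
  rewrite (partial_eq_on (G := fun _ => eps / 16) l oW Wq); first exact: partial_cst.
  by move=> r /set_mem Wr; rewrite /k mulfVK// mulf_neq0//; exact: uW.
pose T i j r := u r * g r i j + k r * (2 * partial i u r * partial j u r - mean_sq_grad2 X r * g r i j).
have dT l i j : partial l (T i j) q =
    dot (partial l (partial i (partial j X)) q) (H q)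
    + (mean_form X q i j * partial l u q / (2 * u q)
       - \sum_(m < 2) christoffel X i j m q * mean_form X q l m).
  rewrite -(dot_second_partial i j l Wq).
  rewrite -(partial_dot (smooth_derivable (smooth_partial i (sXi j)) Wq) (smooth_derivable sH Wq)).
  apply: (partial_eq_on _ oU Uq) => r /set_mem Ur.
  by rewrite /T -(formU Ur i j); exact: mean_formE (UW Ur).
(* Third partials of [X] commute, so they drop out when the derivative of beta is
   antisymmetrized. *)
have cod j : mean_form X q 1 j * partial 0 u q / (2 * u q)
      - \sum_(m < 2) christoffel X 1 j m q * mean_form X q 0 m
    - (mean_form X q 0 j * partial 1 u q / (2 * u q)
      - \sum_(m < 2) christoffel X 0 j m q * mean_form X q 1 m)
    = partial 0 (T 1 j) q - partial 1 (T 0 j) q.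
  have E := smooth_partialC_rV 0 1 oW (sXi j) Wq.
  rewrite (dT 0 1 j) (dT 1 0 j) E.
  have alg (a b c : R) : b - c = a + b - (a + c) by ring.
  exact: alg.
have dTE l i j : partial l (T i j) q = _ :=
  (has_partial_tensor (hu l) (hg i j l) (hk l) (hw i l) (hw j l) (hW l)).2.
have key := @codazzi_trace_alg R (g q) (fun i j => partial i (partial j u) q)
  (mean_form X q) (fun i j m => christoffel X i j m q)
  (fun l i j => partial l (fun r => g r i j) q) (fun i => partial i u q)
  (fun l => partial l (mean_sq_grad2 X) q) (fun l => partial l k q)
  (u q) (mean_sq_grad2 X q) (k q).
have g10 : g q 1 0 = g q 0 1 by rewrite /g !metric_mxE dotC.
have := key g10 (smooth_partialC 1 0 oW su Wq) (fun m => christoffel_sym 1 0 m Wq)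
  D0 (uW Wq) (fun l i j => partial_metric l i j Wq) (mean_sq_grad2E Wq) dWE dkE (formU Uq).
move=> key2.
have {}key2 := key2 (fun j => etrans (cod j) (congr2 (fun a b => a - b) (dTE 0 1 j) (dTE 1 0 j))).
have alg (a b c d x D : R) : D != 0 -> d * D = x -> a * (D * b - c * x) = 0 ->
    a * (b - c * d) = 0.
  by move=> D1 <- E; apply: (mulfI D1); rewrite mulr0 -[RHS]E; ring.
exact: alg D0 (mean_sq_trace_hessianE Wq) key2.
Qed.

End Umbilicity.

End LocalFacts.

(** * Pointwise algebra of the second fundamental form *)

Section PointwiseAlgebra.
Context {R : realFieldType}.
Implicit Types (B b g : 'M[R]_2) (v w : 'rV[R]_2) (u r : R).

(** Since the trace is [2 * u], the off-diagonal entries of [B *m B], and the difference of its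
    diagonal ones, are [2 * u] times those of [B]. This eliminates [r] and determines [B] entry by
    entry. *)
Lemma conformal_shape B w v u r : u != 0 -> \tr B = 2 * u ->
  B *m B + (4 * u)^-1 *: (w^T *m v) = r%:M ->
  (exists kappa, v *m B = kappa *: v) /\
  \det B = u ^+ 2 - (v *m w^T) 0 0 ^+ 2 / (256 * u ^+ 4).
Proof.
move=> u0; rewrite /mxtrace sum2E => trB /matrixP E.
have := E 0 0; have := E 0 1; have := E 1 0; have := E 1 1.
rewrite !mxE !sum2E !big_ord1 !mxE /= mulr0n mulr1n (_ : ord0 = 0 :> 'I_1) //.
move=> E11 E10 E01 E00.
have B1 : B 1 1 = 2 * u - B 0 0 by rewrite -trB addrAC subrr add0r.
have B00 : B 0 0 = u - (w 0 0 * v 0 0 - w 0 1 * v 0 1) / (16 * u ^+ 2).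
  have : 2 * u * (B 0 0 * 2 - 2 * u) + (4 * u)^-1 * (w 0 0 * v 0 0 - w 0 1 * v 0 1) = 0.
    rewrite -[RHS](subrr r) -{1}E00 -E11 B1; ring.
  move=> H; apply: (mulfI (_ : 4 * u != 0)); first by rewrite mulf_neq0// pnatr_eq0.
  apply/eqP; rewrite -subr_eq0 -H; apply/eqP; field; exact: u0.
have B01 : B 0 1 = - (w 0 0 * v 0 1) / (8 * u ^+ 2).
  apply: (mulfI (_ : 2 * u != 0)); first by rewrite mulf_neq0// pnatr_eq0.
  apply/eqP; rewrite -subr_eq0 -[X in _ == X]E01 B1; apply/eqP; field; exact: u0.
have B10 : B 1 0 = - (w 0 1 * v 0 0) / (8 * u ^+ 2).
  apply: (mulfI (_ : 2 * u != 0)); first by rewrite mulf_neq0// pnatr_eq0.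
  apply/eqP; rewrite -subr_eq0 -[X in _ == X]E10 B1; apply/eqP; field; exact: u0.
split.
  (* The trace-free part is a multiple of [2 w^T v - W], which maps the row [v] to [W v]. *)
  exists (u - (w 0 0 * v 0 0 + w 0 1 * v 0 1) / (16 * u ^+ 2)).
  apply: row2P; rewrite !mxE sum2E ?B1 ?B01 ?B10 B00; field; exact: u0.
rewrite det2E B1 B01 B10 B00; field; exact: u0.
Qed.

(** [w^T v / W] projects onto the eigenline of [kappa], and the trace makes the other eigenvalue
    [2 * u - kappa]. Hence [B = u + lam (2 w^T v / W - 1)] with [lam = kappa - u], and the
    determinant [u^2 - lam^2] leaves only the sign of [lam] open. *)
Lemma eigen_tensor B w v u kappa (W := (v *m w^T) 0 0) : W != 0 -> u != 0 ->
  \tr B = 2 * u -> \det B = u ^+ 2 - W ^+ 2 / (256 * u ^+ 4) ->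
  v *m B = kappa *: v -> B *m w^T = kappa *: w^T ->
  exists2 eps, eps ^+ 2 = 1 &
    B = u%:M + (eps / 16 * (u * u)^-1) *: (2 *: (w^T *m v) - W%:M).
Proof.
move=> W0 u0; rewrite /mxtrace sum2E det2E => trB detB /rowP vB /colP Bw.
have := vB 0; have := vB 1; have := Bw 0; have := Bw 1; rewrite !mxE !sum2E !mxE.
move=> Bw1 Bw0 vB1 vB0.
have WE : W = v 0 0 * w 0 0 + v 0 1 * w 0 1 by rewrite /W mxE sum2E !mxE.
have B1 : B 1 1 = 2 * u - B 0 0 by rewrite -trB addrAC subrr add0r.
pose lam := kappa - u.
have C00 : W * (B 0 0 - kappa) = - 2 * lam * (w 0 1 * v 0 1).
  have e1 : v 0 1 * w 0 1 * (B 1 1 - kappa) = v 0 0 * w 0 0 * (B 0 0 - kappa).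
    have a : v 0 1 * (B 1 1 - kappa) = - (v 0 0 * B 0 1).
      by rewrite mulrBr [_ * kappa]mulrC -vB1; ring.
    have b : w 0 0 * (B 0 0 - kappa) = - (w 0 1 * B 0 1).
      by rewrite mulrBr [_ * kappa]mulrC -Bw0; ring.
    by rewrite mulrAC a -[RHS]mulrA b; ring.
  by rewrite WE mulrDl -e1 B1 /lam; ring.
have C01 : W * B 0 1 = 2 * lam * (w 0 0 * v 0 1).
  have a : v 0 0 * B 0 1 = kappa * v 0 1 - v 0 1 * B 1 1 by rewrite -vB1; ring.
  have b : w 0 1 * B 0 1 = kappa * w 0 0 - w 0 0 * B 0 0 by rewrite -Bw0; ring.
  have -> : W * B 0 1 = w 0 0 * (v 0 0 * B 0 1) + v 0 1 * (w 0 1 * B 0 1).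
    by rewrite WE; ring.
  by rewrite a b B1 /lam; ring.
have C10 : W * B 1 0 = 2 * lam * (w 0 1 * v 0 0).
  have a : v 0 1 * B 1 0 = kappa * v 0 0 - v 0 0 * B 0 0 by rewrite -vB0; ring.
  have b : w 0 0 * B 1 0 = kappa * w 0 1 - w 0 1 * B 1 1 by rewrite -Bw1; ring.
  have -> : W * B 1 0 = w 0 1 * (v 0 1 * B 1 0) + v 0 0 * (w 0 0 * B 1 0).
    by rewrite WE; ring.
  by rewrite a b B1 /lam; ring.
have B00E : B 0 0 = u + lam * (2 * (w 0 0 * v 0 0) - W) / W.
  apply: (mulfI W0); have -> : W * B 0 0 = W * (B 0 0 - kappa) + W * kappa by ring.
  rewrite C00 /lam {1 2}WE; rewrite WE in W0; rewrite WE; field; exact: W0.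
have B01E : B 0 1 = 2 * lam * (w 0 0 * v 0 1) / W by rewrite -C01 mulrC mulKf.
have B10E : B 1 0 = 2 * lam * (w 0 1 * v 0 0) / W by rewrite -C10 mulrC mulKf.
have lam2 : lam ^+ 2 = W ^+ 2 / (256 * u ^+ 4).
  have -> : lam ^+ 2 = u ^+ 2 - (B 0 0 * B 1 1 - B 0 1 * B 1 0).
    rewrite B1 B00E B01E B10E WE; rewrite WE in W0; field; exact: W0.
  by rewrite detB opprB addrC subrK.
(* By [lam2], [lam] is [W / (16 u^2)] up to sign; this quotient is that sign. *)
exists (16 * u ^+ 2 * lam / W).
  rewrite !exprMn exprVn lam2; field; rewrite W0 u0//.
set c := _ / (u * u).
have E i j : (u%:M + c *: (2 *: (w^T *m v) - W%:M)) i j =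
    u *+ (i == j) + c * (2 * (w 0 i * v 0 j) - W *+ (i == j)).
  rewrite [LHS]mxE [u%:M i j]mxE; congr (_ + _).
  rewrite [LHS]mxE; congr (_ * _); rewrite [LHS]mxE [(- W%:M) i j]mxE [W%:M i j]mxE.
  congr (_ - _); rewrite [LHS]mxE; congr (_ * _).
  by rewrite [LHS]mxE big_ord1 [w^T _ _]mxE (_ : ord0 = 0).
apply: matrix2P; rewrite E ?mulr1n ?mulr0n /c.
- by rewrite B00E; field; rewrite W0 u0.
- by rewrite B01E; field; rewrite W0 u0.
- by rewrite B10E; field; rewrite W0 u0.
- by rewrite B1 B00E WE; rewrite WE in W0; field; rewrite W0 u0.
Qed.

(** Relative to the positive definite [g], the symmetric form [b - u g], with entries [x], [y], [z],
    has trace and determinant zero; both eigenvalues vanish. *)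
Lemma umbilic_form g b u : g^T = g -> b^T = b -> 0 < g 0 0 -> 0 < \det g ->
  \tr (b *m invmx g) = 2 * u -> \det (b *m invmx g) = u ^+ 2 -> b = u *: g.
Proof.
move=> gT bT g00 dg trE detE.
have ug : g \in unitmx by rewrite unitmxE unitfE gt_eqF.
have g10 : g 1 0 = g 0 1 by rewrite -{1}gT mxE.
have b10 : b 1 0 = b 0 1 by rewrite -{1}bT mxE.
have dgE := det2E g; rewrite g10 in dgE.
pose x := b 0 0 - u * g 0 0; pose y := b 0 1 - u * g 0 1; pose z := b 1 1 - u * g 1 1.
have [e00 e01 e10 e11] := invmx2E ug.
have lin : g 1 1 * x - 2 * g 0 1 * y + g 0 0 * z = 0.
  move: trE; rewrite /mxtrace sum2E !mxE !sum2E e00 e01 e10 e11 b10 g10 => trE.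
  have : \det g * ((\det g)^-1 * (b 0 0 * g 1 1 - 2 * b 0 1 * g 0 1 + b 1 1 * g 0 0)) = \det g * (2 * u).
    by rewrite -trE; congr (_ * _); ring.
  rewrite mulVKf ?gt_eqF// dgE /x /y /z => E.
  by apply/eqP; rewrite -(subrr (2 * u * (g 0 0 * g 1 1 - g 0 1 * g 0 1))) -subr_eq0; apply/eqP;
    transitivity (b 0 0 * g 1 1 - 2 * b 0 1 * g 0 1 + b 1 1 * g 0 0 - (g 0 0 * g 1 1 - g 0 1 * g 0 1) * (2 * u)); [ring|rewrite E subrr].
have quad : x * z = y ^+ 2.
  move: detE; rewrite det_mulmx det_inv => /(congr1 ( *%R^~ (\det g))).
  rewrite divfK ?gt_eqF// det2E b10 dgE => E.
  have lin' : b 0 0 * g 1 1 - 2 * b 0 1 * g 0 1 + b 1 1 * g 0 0 = 2 * u * (g 0 0 * g 1 1 - g 0 1 * g 0 1).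
    apply/eqP; rewrite -subr_eq0 -lin /x /y /z; apply/eqP; ring.
  apply/eqP; rewrite -subr_eq0; apply/eqP.
  transitivity ((b 0 0 * b 1 1 - b 0 1 * b 0 1) - u * (b 0 0 * g 1 1 - 2 * b 0 1 * g 0 1 + b 1 1 * g 0 0) + u ^+ 2 * (g 0 0 * g 1 1 - g 0 1 * g 0 1)).
    by rewrite /x /y /z; ring.
  by rewrite E lin'; ring.
(* By [lin] and [quad], the square of [g 1 1 * x - g 0 0 * z] equals [-4 (det g) y^2]. *)
have y0 : y = 0.
  apply/eqP; rewrite -sqrf_eq0 -[_ == 0]orbF -(gt_eqF dg) -mulf_eq0 eq_le.
  rewrite (mulr_ge0 (sqr_ge0 _) (ltW dg)) andbT dgE.
  have : 0 <= (g 1 1 * x - g 0 0 * z) ^+ 2 by exact: sqr_ge0.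
  have -> : (g 1 1 * x - g 0 0 * z) ^+ 2 =
      (g 1 1 * x + g 0 0 * z) ^+ 2 - 4 * g 0 0 * g 1 1 * (x * z) by ring.
  have -> : g 1 1 * x + g 0 0 * z = 2 * g 0 1 * y.
    by apply/eqP; rewrite -subr_eq0 -lin; apply/eqP; ring.
  by rewrite quad; nra.
rewrite y0 expr0n /= in quad.
have {}lin : g 1 1 * x + g 0 0 * z = 0 by rewrite -lin y0; ring.
have g11 : 0 < g 1 1.
  rewrite -(pmulr_rgt0 _ g00); apply: lt_le_trans dg _.
  by rewrite dgE gerBl -expr2 sqr_ge0.
have [x0 z0] : x = 0 /\ z = 0.
  move/eqP: quad; rewrite mulf_eq0 => /orP[]/eqP e; move: lin; rewrite e mulr0 ?add0r ?addr0 => /eqP;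
  by rewrite mulf_eq0 gt_eqF//= => /eqP.
apply: matrix2P; rewrite !mxE; apply/eqP; rewrite -subr_eq0 ?b10 ?g10; apply/eqP => //.
Qed.

End PointwiseAlgebra.

(** * Cross product and Euclidean length *)

Section Normal.
Context {R : realType}.
Implicit Types a b : 'rV[R]_3.

Lemma sum3E (V : nmodType) (f : 'I_3 -> V) : \sum_(i < 3) f i = f 0 + f 1 + f 2.
Proof.
rewrite !big_ord_recl big_ord0 addr0 addrA.
by congr (_ + f _ + f _); exact/val_inj.
Qed.

Lemma crossE a b :
  [/\ cross a b 0 0 = a 0 1 * b 0 2 - a 0 2 * b 0 1,
      cross a b 0 1 = a 0 2 * b 0 0 - a 0 0 * b 0 2 &
      cross a b 0 2 = a 0 0 * b 0 1 - a 0 1 * b 0 0].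
Proof.
have e01 : 0 + 1 = 1 :> 'I_3 by exact/val_inj.
have e02 : 0 + 2 = 2 :> 'I_3 by exact/val_inj.
have e11 : 1 + 1 = 2 :> 'I_3 by exact/val_inj.
have e12 : 1 + 2 = 0 :> 'I_3 by exact/val_inj.
have e21 : 2 + 1 = 0 :> 'I_3 by exact/val_inj.
have e22 : 2 + 2 = 1 :> 'I_3 by exact/val_inj.
by split; rewrite mxE ?e01 ?e02 ?e11 ?e12 ?e21 ?e22.
Qed.

Transparent dot.

Lemma dot_crossl a b : dot (cross a b) a = 0.
Proof.
rewrite /dot sum3E; have [-> -> ->] := crossE a b.
by move: (a 0 0) (a 0 1) (a 0 2) (b 0 0) (b 0 1) (b 0 2) => *; ring.
Qed.

Lemma dot_crossr a b : dot (cross a b) b = 0.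
Proof.
rewrite /dot sum3E; have [-> -> ->] := crossE a b.
by move: (a 0 0) (a 0 1) (a 0 2) (b 0 0) (b 0 1) (b 0 2) => *; ring.
Qed.

Lemma dot_cross_cross a b : dot (cross a b) (cross a b) = dot a a * dot b b - dot a b ^+ 2.
Proof.
rewrite /dot !sum3E; have [-> -> ->] := crossE a b.
by move: (a 0 0) (a 0 1) (a 0 2) (b 0 0) (b 0 1) (b 0 2) => *; ring.
Qed.

Opaque dot.

Lemma enorm_sq n (v : 'rV[R]_n) : enorm v ^+ 2 = dot v v.
Proof. by rewrite sqr_sqrtr// dot_ge0. Qed.

End Normal.

(** * Translation between the shape operator and beta *)

Section LocalShape.
Context {R : realType}.
Variables (W : set 'rV[R]_2) (X : 'rV[R]_2 -> 'rV[R]_3).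
Hypotheses (oW : open W) (sX : smooth_on W X).
Hypothesis gW : forall q, W q -> metric_mx X q \in unitmx.
Hypothesis uW : forall q, W q -> mean_sq X q != 0.

Lemma det_metric_cross q : \det (metric_mx X q) =
  dot (cross (partial 0 X q) (partial 1 X q)) (cross (partial 0 X q) (partial 1 X q)).
Proof.
have alg (A : 'M[R]_2) (a b c : R) : A 0 0 = a -> A 0 1 = c -> A 1 1 = b ->
    A 0 0 * A 1 1 - A 0 1 * A 0 1 = a * b - c ^+ 2 by move=> -> -> ->; rewrite expr2.
apply: (etrans (det_metric X q)); apply: (etrans _ (esym (dot_cross_cross _ _))).
exact: alg (metric_mxE X q 0 0) (metric_mxE X q 0 1) (metric_mxE X q 1 1).
Qed.

Lemma det_metric_gt0 q : W q -> 0 < \det (metric_mx X q).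
Proof. by move=> /gW; rewrite unitmxE unitfE lt0r det_metric_cross dot_ge0 andbT. Qed.

Lemma metric00_gt0 q : W q -> 0 < metric_mx X q 0 0.
Proof.
move=> Wq; have := det_metric_gt0 Wq; rewrite det_metric.
have : 0 <= metric_mx X q 0 0 by rewrite metric_mxE dot_ge0.
move: (metric_mx X q 0 0) (metric_mx X q 1 1) (metric_mx X q 0 1) => x y z x0 D.
rewrite lt0r x0 andbT; apply/eqP => z0; move: D.
by rewrite z0 mul0r sub0r -expr2 oppr_gt0 ltNge sqr_ge0.
Qed.

Lemma unit_normal_normal q a : dot (local_unit_normal X q) (partial a X q) = 0.
Proof.
rewrite /local_unit_normal dotZl; move: a; apply: forall2E.
  by rewrite dot_crossl mulr0.
by rewrite dot_crossr mulr0.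
Qed.

Lemma unit_normal_unit q : W q -> dot (local_unit_normal X q) (local_unit_normal X q) = 1.
Proof.
move=> Wq; rewrite /local_unit_normal; set c := cross _ _.
have c0 : 0 < dot c c by rewrite -det_metric_cross det_metric_gt0.
by rewrite dotZl dotZr mulrA -expr2 exprVn enorm_sq mulVf// gt_eqF.
Qed.

(** The unit normal is [sigma] times [H]. The sign of [sigma] depends on the chart; its square, by
    [sigma_sq], does not. *)
Let sigma q := dot (local_mean_curvature_vector X q) (local_unit_normal X q) / mean_sq X q.

Lemma sigma_sq q : W q -> sigma q ^+ 2 * mean_sq X q = 1.
Proof.
move=> Wq; have Hn a := mean_curvature_normal oW sX gW a Wq.
have := frame_normal (metric_mxE X q) (gW Wq) Hn (uW Wq) (unit_normal_normal q).
move=> /(congr1 (fun z => dot z (local_unit_normal X q))).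
rewrite unit_normal_unit// dotZl (dotC (local_unit_normal X q)) => ->.
by rewrite /sigma /mean_sq; field; exact: uW.
Qed.

Lemma shape_mean_form q : W q ->
  local_shape_mx X q = sigma q *: (mean_form X q *m metric_inv X q).
Proof.
move=> Wq; rewrite /local_shape_mx scalemxAl; congr (_ *m _).
apply/matrixP => i j; rewrite [LHS]mxE (second_form_mean oW sX gW uW i j Wq) dotZl.
by rewrite [RHS]mxE /sigma mulrAC [X in X / _]mulrC [RHS]mulrAC.
Qed.

Let w q := mean_sq_diff X q.
Let v q := w q *m metric_inv X q.
Let B q := mean_form X q *m metric_inv X q.

Lemma mean_form_trmx q : W q -> (mean_form X q)^T = mean_form X q.
Proof.
by move=> Wq; apply/matrixP => i j; rewrite [LHS]mxE (mean_form_sym oW sX gW i j Wq).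
Qed.

Lemma mean_form_trace q : W q -> \tr (B q) = 2 * mean_sq X q.
Proof.
move=> Wq; rewrite -(mean_sq_trace X Wq) /mxtrace; apply: eq_bigr => i _.
rewrite /B mxE; apply: eq_bigr => j _; rewrite mulrC; congr (_ * _).
by rewrite -[in LHS]metric_inv_sym mxE.
Qed.

(** In dimension two the factor [sigma] enters the determinant squared, as [1 / u], so the
    orientation disappears. *)
Lemma det_shape q : W q -> \det (local_shape_mx X q) = \det (B q) / mean_sq X q.
Proof.
move=> Wq; rewrite (shape_mean_form Wq) detZ -/(B q) mulrC; congr (_ * _).
by apply: (mulIf (uW Wq)); rewrite sigma_sq// mulVf// uW.
Qed.

Lemma sigma_neq0 q : W q -> sigma q != 0.
Proof.
move=> Wq; have := sigma_sq Wq; apply: contra_eq_neq => ->.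
by rewrite expr0n mul0r eq_sym oner_eq0.
Qed.

Lemma eigen_shape q (z : 'rV[R]_2) : W q ->
  (exists kappa, z *m local_shape_mx X q = kappa *: z) <->
  (exists kappa, z *m B q = kappa *: z).
Proof.
move=> Wq; rewrite (shape_mean_form Wq) -/(B q) -scalemxAr; split=> -[k E].
  exists ((sigma q)^-1 * k); rewrite -scalerA -E scalerA mulVf ?scale1r//.
  exact: sigma_neq0.
by exists (sigma q * k); rewrite E scalerA.
Qed.

Lemma conformal_pointwise q c : W q ->
  (forall i j, dot (partial i (local_mean_curvature_vector X) q)
                   (partial j (local_mean_curvature_vector X) q) = c * metric_mx X q i j) ->
  (exists kappa, v q *m local_shape_mx X q = kappa *: v q) /\
  \det (local_shape_mx X q) =
    mean_sq X q - mean_sq_grad2 X q ^+ 2 / (256 * mean_sq X q ^+ 5).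
Proof.
move=> Wq conf; have u0 := uW Wq.
have E : mean_form X q *m metric_inv X q *m mean_form X q
    + (4 * mean_sq X q)^-1 *: ((w q)^T *m w q) = c *: metric_mx X q.
  apply/matrixP => i j; rewrite [RHS]mxE -conf (dot_partial_mean oW sX gW uW i j Wq).
  rewrite [LHS]mxE; congr (_ + _); rewrite [LHS]mxE mulrC; congr (_ * _).
  by rewrite mxE big_ord1 [_^T _ _]mxE ![w q _ _]mxE.
(* Multiplication by the inverse metric turns the identity of bilinear forms into one of
   endomorphisms. *)
have E' : B q *m B q + (4 * mean_sq X q)^-1 *: ((w q)^T *m v q) = c%:M.
  have -> : c%:M = (c *: metric_mx X q) *m metric_inv X q.
    by rewrite -scalemxAl mulmxV ?scalemx1//; exact: gW.
  by rewrite -E mulmxDl -scalemxAl /B /v !mulmxA.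
have [k1 k2] := conformal_shape u0 (mean_form_trace Wq) E'.
split; first exact/eigen_shape.
rewrite (det_shape Wq) k2 /mean_sq_grad2 -/(w q) -/(v q).
by move: (mean_sq X q) u0 (_ 0 0) => a a0 b; field.
Qed.

Lemma mean_sq_grad2_eq0 q : W q -> mean_sq_grad2 X q = 0 -> w q = 0.
Proof.
move=> Wq g0; have := mean_sq_grad2E gW Wq; rewrite g0 mul0r => /esym.
have := det_metric_gt0 Wq; rewrite det_metric; have := metric00_gt0 Wq.
have w0 : partial 0 (mean_sq X) q = w q 0 0 by rewrite mxE.
have w1 : partial 1 (mean_sq X) q = w q 0 1 by rewrite mxE.
rewrite w0 w1; move: (metric_mx X q 0 0) (metric_mx X q 0 1) (metric_mx X q 1 1).
move=> x y z x0 D0 E.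
(* The quadratic form, multiplied by [x], with its square completed. *)
have E2 : (x * w q 0 1 - y * w q 0 0) ^+ 2 + (x * z - y * y) * w q 0 0 ^+ 2 = 0.
  by rewrite -[RHS](mulr0 x) -E; ring.
have /eqP : (x * z - y * y) * w q 0 0 ^+ 2 = 0.
  apply/eqP; rewrite eq_le; apply/andP; split; first by rewrite -E2 lerDr sqr_ge0.
  by apply: mulr_ge0; [exact: ltW|exact: sqr_ge0].
rewrite mulf_eq0 gt_eqF//= sqrf_eq0 => /eqP z0.
move: E2; rewrite z0 expr0n /= !mulr0 subr0 addr0 => /eqP.
rewrite sqrf_eq0 mulf_eq0 gt_eqF//= => /eqP z1.
by apply: row2P; rewrite ?z0 ?z1 [RHS]mxE.
Qed.

Lemma tensor_pointwise q : W q ->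
  (v q != 0 -> exists kappa, v q *m local_shape_mx X q = kappa *: v q) ->
  \det (local_shape_mx X q) =
    mean_sq X q - mean_sq_grad2 X q ^+ 2 / (256 * mean_sq X q ^+ 5) ->
  if mean_sq_grad2 X q == 0 then mean_form X q = mean_sq X q *: metric_mx X q else
  exists2 eps, eps ^+ 2 = 1 & mean_form X q = mean_sq X q *: metric_mx X q
    + (eps / 16 * (mean_sq X q * mean_sq X q)^-1) *:
        (2 *: ((w q)^T *m w q) - mean_sq_grad2 X q *: metric_mx X q).
Proof.
move=> Wq vk; have u0 := uW Wq; have ug := gW Wq.
rewrite (det_shape Wq) => /(congr1 ( *%R^~ (mean_sq X q))); rewrite divfK// => detB.
case: ifPn => [/eqP W0|W0].
  apply: umbilic_form => //.
  - exact: metric_mx_sym.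
  - exact: mean_form_trmx.
  - exact: metric00_gt0.
  - exact: det_metric_gt0.
  - exact: mean_form_trace.
  - by rewrite detB W0 expr0n /= mul0r subr0 -expr2.
have v0 : v q != 0.
  by apply: contra_neq W0 => v0; rewrite /mean_sq_grad2 -/(w q) -/(v q) v0 mul0mx mxE.
have [kappa vB] := (eigen_shape _ Wq).1 (vk v0).
have vg : v q *m metric_mx X q = w q by rewrite /v mulmxKV.
(* Self-adjointness: transposing the eigenvector equation of the gradient [v] gives the one for the
   differential [w]. *)
have Bw : B q *m (w q)^T = kappa *: (w q)^T.
  have e : v q *m mean_form X q = kappa *: w q.
    by rewrite -vg scalemxAl -vB /B !mulmxA mulmxKV.
  have := congr1 trmx e; rewrite trmx_mul linearZ/= mean_form_trmx// => <-.
  by rewrite /B -mulmxA /v trmx_mul metric_inv_sym.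
have [|eps e1 BE] := eigen_tensor W0 u0 (mean_form_trace Wq) _ vB Bw.
  rewrite detB -/(mean_sq_grad2 X q); move: (mean_sq X q) (mean_sq_grad2 X q) u0 => a b a0.
  by field.
exists eps => //; rewrite -[LHS](mulmxKV ug) -/(metric_inv X q) -/(B q) BE mulmxDl.
rewrite mul_scalar_mx; congr (_ + _); rewrite -scalemxAl mulmxBl -scalemxAl -mulmxA vg.
by rewrite mul_scalar_mx.
Qed.

Lemma umbilic_conformal q i j : W q -> mean_sq_grad2 X q = 0 ->
  mean_form X q = mean_sq X q *: metric_mx X q ->
  dot (partial i (local_mean_curvature_vector X) q)
      (partial j (local_mean_curvature_vector X) q) =
  mean_sq X q ^+ 2 * metric_mx X q i j.
Proof.
move=> Wq W0 bE; rewrite (dot_partial_mean oW sX gW uW i j Wq).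
have w0 := mean_sq_grad2_eq0 Wq W0.
have -> : partial i (mean_sq X) q = w q 0 i by rewrite mxE.
rewrite (_ : w q 0 i = 0); last by rewrite w0 mxE.
rewrite !mul0r addr0 bE -!scalemxAl mulmxV; last exact: gW.
by rewrite mul1mx !mxE mulrA -expr2.
Qed.

End LocalShape.

(** * Coordinate invariance of beta, [W], tr(Hess u) and the sign *)

Lemma congruence_tensor (R : fieldType) n (J b g b' g' : 'M[R]_n) (w w' : 'rV[R]_n)
    (u u' c c' k : R) :
  J \in unitmx -> b' = J *m b *m J^T -> g' = J *m g *m J^T -> w' = w *m J^T ->
  u' = u -> c' = c ->
  b' = u' *: g' + (k * (u' * u')^-1) *: (2 *: (w'^T *m w') - c' *: g') ->
  b = u *: g + (k * (u * u)^-1) *: (2 *: (w^T *m w) - c *: g).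
Proof.
move=> uJ -> -> -> -> -> E.
have uJT : J^T \in unitmx by rewrite unitmx_tr.
have {}E : J *m b *m J^T =
    J *m (u *: g + (k / (u * u)) *: (2 *: (w^T *m w) - c *: g)) *m J^T.
  rewrite E trmx_mul trmxK.
  rewrite mulmxDr mulmxDl -!scalemxAr -!scalemxAl mulmxBr mulmxBl.
  by rewrite -!scalemxAr -!scalemxAl !mulmxA.
move/(can_inj (mulmxK uJT)): E; exact: (can_inj (mulKmx uJ)).
Qed.

Section TensorReparametrization.
Context {R : realType}.
Variables (V W : set 'rV[R]_2) (X Y : 'rV[R]_2 -> 'rV[R]_3).
Variable phi : 'rV[R]_2 -> 'rV[R]_2.
Hypotheses (oV : open V) (oW : open W) (sX : smooth_on W X).
Hypotheses (sphi : smooth_on V phi) (phiW : forall q, V q -> W (phi q)).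
Hypothesis YE : {in V, Y =1 X \o phi}.
Hypothesis sY : smooth_on V Y.
Hypothesis gX : forall r, W r -> metric_mx X r \in unitmx.
Hypothesis gY : forall q, V q -> metric_mx Y q \in unitmx.

Let J := jac phi.

Lemma mean_sq_reparam q : V q -> mean_sq Y q = mean_sq X (phi q).
Proof.
by move=> Vq; rewrite /mean_sq (mean_curvature_vector_reparam oV oW sX sphi phiW YE sY gX gY Vq).
Qed.

Let smsq : smooth_on W (mean_sq X).
Proof. by apply: smooth_dot => //; exact: smooth_mean_curvature_vector. Qed.

Let mean_sqE : {in V, mean_sq Y =1 mean_sq X \o phi}.
Proof. by move=> r /set_mem Vr; exact: mean_sq_reparam. Qed.

Lemma mean_sq_diff_reparam q : V q ->
  mean_sq_diff Y q = mean_sq_diff X (phi q) *m (J q)^T.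
Proof.
move=> Vq; apply/rowP => i; rewrite [LHS]mxE [RHS]mxE.
apply: (etrans (partial_reparam oV oW sphi phiW i smsq mean_sqE Vq)).
by apply: eq_bigr => a _; rewrite [_^T _ _]mxE [mean_sq_diff _ _ _ _]mxE mulrC.
Qed.

Let gE q (Vq : V q) := metric_reparam oV oW sX sphi phiW YE Vq.

Let uJ q (Vq : V q) := (reparam_unit oV oW sX sphi phiW YE Vq (gY Vq)).1.

Lemma mean_form_reparam q : V q ->
  mean_form Y q = J q *m mean_form X (phi q) *m (J q)^T.
Proof.
move=> Vq; apply/matrixP => i j; rewrite [LHS]mxE.
rewrite (second_form_reparam oV oW sX sphi phiW YE sY gX gY i j Vq).
rewrite (mean_curvature_vector_reparam oV oW sX sphi phiW YE sY gX gY Vq).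
rewrite -mulmxA mxE dot_suml; apply: eq_bigr => a _.
rewrite dot_suml [X in _ = _ * X]mxE mulr_sumr; apply: eq_bigr => b _.
by rewrite dotZl [_^T _ _]mxE [mean_form _ _ _ _]mxE -mulrA [J q j b * _]mulrC.
Qed.

Lemma mean_sq_grad2_reparam q : V q -> mean_sq_grad2 Y q = mean_sq_grad2 X (phi q).
Proof.
move=> Vq; rewrite /mean_sq_grad2 mean_sq_diff_reparam// trmx_mul trmxK.
rewrite /metric_inv (gE Vq) -(invmx_congruence (uJ Vq) (gX (phiW Vq))).
by rewrite !mulmxA.
Qed.

Lemma mean_sq_trace_hessian_reparam q : V q ->
  mean_sq_trace_hessian Y q = mean_sq_trace_hessian X (phi q).
Proof.
move=> Vq.
exact: (contract_hessian_reparam oV oW sX sphi phiW YE sY gX gY smsq mean_sqE Vq).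
Qed.

Lemma tensor_reparam q k : V q ->
  mean_form Y q = mean_sq Y q *: metric_mx Y q
    + (k * (mean_sq Y q * mean_sq Y q)^-1) *:
      (2 *: ((mean_sq_diff Y q)^T *m mean_sq_diff Y q) - mean_sq_grad2 Y q *: metric_mx Y q) ->
  mean_form X (phi q) = mean_sq X (phi q) *: metric_mx X (phi q)
    + (k * (mean_sq X (phi q) * mean_sq X (phi q))^-1) *:
      (2 *: ((mean_sq_diff X (phi q))^T *m mean_sq_diff X (phi q))
       - mean_sq_grad2 X (phi q) *: metric_mx X (phi q)).
Proof.
move=> Vq; exact: (congruence_tensor (uJ Vq) (mean_form_reparam Vq) (gE Vq)
  (mean_sq_diff_reparam Vq) (mean_sq_reparam Vq) (mean_sq_grad2_reparam Vq)).
Qed.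

End TensorReparametrization.

(** * The balance function *)

Lemma sign_close (R : realFieldType) (a b : R) :
  a ^+ 2 = 1 -> b ^+ 2 = 1 -> `|a - b| < 1 -> a = b.
Proof.
move=> /eqP; rewrite sqrf_eq1 => /orP[]/eqP ->; move=> /eqP; rewrite sqrf_eq1;
  by move=> /orP[]/eqP -> //; rewrite real_ltr_norml ?num_real//; lra.
Qed.

(** [(1, 0)] and [(b, - a)] are orthogonal for the metric with entries [a], [b], [c], so the metric
    trace is a positive combination of the values of the form on these two vectors. *)
Lemma trace_le0 (R : realFieldType) (a b c x y z : R) :
  0 < a -> 0 < a * c - b * b ->
  (forall s t : R, s ^+ 2 * x + 2 * s * t * y + t ^+ 2 * z <= 0) ->
  c * x - 2 * b * y + a * z <= 0.
Proof.
move=> a0 D0 Q; rewrite -(pmulr_rle0 _ a0).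
have -> : a * (c * x - 2 * b * y + a * z) =
  (a * c - b * b) * (1 ^+ 2 * x + 2 * 1 * 0 * y + 0 ^+ 2 * z)
  + (b ^+ 2 * x + 2 * b * (- a) * y + (- a) ^+ 2 * z) by ring.
have H1 := mulr_ge0_le0 (ltW D0) (Q 1 0).
by apply: le_trans (lerD H1 (Q b (- a))) _; rewrite addr0.
Qed.

Section Balance.
Context {R : realType}.
Variables (W : set 'rV[R]_2) (X : 'rV[R]_2 -> 'rV[R]_3).
Hypotheses (oW : open W) (sX : smooth_on W X).
Hypothesis gW : forall q, W q -> metric_mx X q \in unitmx.
Hypothesis uW : forall q, W q -> mean_sq X q != 0.

Let u := mean_sq X.
Let w := mean_sq_diff X.
Let su : smooth_on W u.
Proof. by apply: smooth_dot => //; exact: smooth_mean_curvature_vector. Qed.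

(** The function [Phi]: with [k = eps / (16 u^2)] the equation of [codazzi_mean_sq] becomes
    [eps * Phi = 1] where [W] is nonzero. *)
Definition mean_sq_balance q : R :=
  (4 * mean_sq X q * mean_sq_trace_hessian X q - 5 * mean_sq_grad2 X q)
    / (16 * mean_sq X q ^+ 3).

Lemma smooth_mean_sq_balance : smooth_on W mean_sq_balance.
Proof.
have c (a : R) := smooth_cst W a.
apply: smoothM => //.
  apply: smoothB => //; last by apply: smoothM => //; exact: smooth_mean_sq_grad2.
  apply: smoothM => //; last exact: smooth_mean_sq_trace_hessian.
  exact: smoothM.
apply: smoothV => //.
  by move=> q Wq; rewrite mulf_neq0 ?expf_neq0 ?pnatr_eq0//; exact: uW.
by apply: smoothM => //; exact: smoothX.
Qed.

Definition quasi_umbilic eps q :=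
  mean_form X q = mean_sq X q *: metric_mx X q
    + (eps / 16 * (mean_sq X q * mean_sq X q)^-1) *:
        (2 *: ((mean_sq_diff X q)^T *m mean_sq_diff X q)
         - mean_sq_grad2 X q *: metric_mx X q).

Let v q j := \sum_(i < 2) partial i u q * metric_inv X q i j.
Let vbv q := \sum_(j < 2) (\sum_(i < 2) v q i * mean_form X q i j) * v q j.

Let vE q : w q *m metric_inv X q = \row_j v q j.
Proof.
by apply/rowP => j; rewrite !mxE; apply: eq_bigr => i _; rewrite [w q 0 i]mxE.
Qed.

Let vbvE q : vbv q = (w q *m metric_inv X q *m mean_form X q *m (w q *m metric_inv X q)^T) 0 0.
Proof.
rewrite vE mxE; apply: eq_bigr => j _; rewrite [_^T _ _]mxE mxE [(\row_j _) 0 j]mxE.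
by congr (_ * _); apply: eq_bigr => i _; rewrite [(\row__ _) 0 i]mxE.
Qed.

Let svbv : smooth_on W vbv.
Proof.
have sv j : smooth_on W (v ^~ j).
  apply: smooth_sum => // i; apply: smoothM => //; first exact: smooth_partial.
  exact: smooth_metric_inv.
apply: smooth_sum => // j; apply: smoothM => //; apply: smooth_sum => // i.
apply: smoothM => //.
have s : smooth_on W (fun q => dot (local_second_form X i j q) (local_mean_curvature_vector X q)).
  by apply: smooth_dot => //; [exact: smooth_second_form|exact: smooth_mean_curvature_vector].
by apply: smooth_eq s => // q _; rewrite mxE.
Qed.

(** On the gradient of [u], the formula for beta gives [vbv = u W + eps W^2 / (16 u^2)]. Solved for
    [eps], this is continuous where [W] is nonzero. *)
Let sign q := 16 * u q ^+ 2 * (vbv q - u q * mean_sq_grad2 X q) / mean_sq_grad2 X q ^+ 2.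

Let quasi_umbilic_sign q eps : W q -> mean_sq_grad2 X q != 0 ->
  quasi_umbilic eps q -> sign q = eps.
Proof.
move=> Wq W0 T; rewrite /sign vbvE T.
set z := w q *m metric_inv X q.
have zg : z *m metric_mx X q = w q by rewrite /z mulmxKV//; exact: gW.
have wz : (w q *m z^T) 0 0 = mean_sq_grad2 X q.
  by rewrite /mean_sq_grad2 -/(w q) /z trmx_mul metric_inv_sym mulmxA.
have zw : (z *m (w q)^T) 0 0 = mean_sq_grad2 X q by [].
set k := eps / 16 / _.
have -> : (z *m (mean_sq X q *: metric_mx X q + k *: (2 *: ((mean_sq_diff X q)^T *m mean_sq_diff X q) - mean_sq_grad2 X q *: metric_mx X q)) *m z^T) 0 0
   = u q * mean_sq_grad2 X q + k * (2 * (mean_sq_grad2 X q * mean_sq_grad2 X q) - mean_sq_grad2 X q * mean_sq_grad2 X q).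
  rewrite mulmxDr mulmxDl -!scalemxAr -!scalemxAl mulmxBr mulmxBl -!scalemxAr -!scalemxAl zg.
  rewrite -/(w q) mulmxA -[z *m (w q)^T *m w q *m _]mulmxA.
  have entry (a b c : R) (A B C : 'M[R]_1) :
      (a *: A + b *: (2 *: B - c *: C)) 0 0 = a * A 0 0 + b * (2 * B 0 0 - c * C 0 0).
    by rewrite !mxE.
  by rewrite entry wz [(_ *m (_ *m _)) 0 0]mxE big_ord1 (_ : ord0 = 0) // wz zw.
have := uW Wq; rewrite /k -/(u q); move: (u q) (mean_sq_grad2 X q) W0 => a b b0 a0.
by field; rewrite a0 b0.
Qed.

(** The hypothesis gives [eps] point by point, whereas the Codazzi equation needs it constant on an
    open set. [sign] is continuous and equals 1 or -1, so it is locally constant. *)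
Lemma balance_square q : W q -> mean_sq_grad2 X q != 0 ->
  (forall r, W r -> mean_sq_grad2 X r != 0 -> exists2 eps, eps ^+ 2 = 1 & quasi_umbilic eps r) ->
  mean_sq_balance q ^+ 2 = 1.
Proof.
move=> Wq W0 qu.
have sW := smooth_mean_sq_grad2 oW sX gW.
have nW : \forall r \near q, W r /\ mean_sq_grad2 X r != 0.
  near=> r; split; near: r; first exact: open_nbhs_nbhs.
  have cW := smooth_continuous sW Wq.
  exact: (cvgr_neq0 _ cW W0).
have ssign : smooth_on W (fun r => 16 * u r ^+ 2 * (vbv r - u r * mean_sq_grad2 X r)).
  apply: smoothM => //; last by apply: smoothB => //; exact: smoothM.
  by apply: smoothM => //; [exact: (smooth_cst W (16 : R))|exact: smoothX].
have csign : {for q, continuous sign}.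
  apply: (@continuousM _ _ _ (fun r => (mean_sq_grad2 X r ^+ 2)^-1)).
    exact: smooth_continuous ssign Wq.
  apply: (@continuousV _ _ (fun r => mean_sq_grad2 X r ^+ 2)); first by rewrite expf_neq0.
  exact: smooth_continuous (smoothX 2 oW sW) Wq.
have [eps eps2 Tq] := qu q Wq W0.
have signq := quasi_umbilic_sign Wq W0 Tq.
have nS : \forall r \near q, [/\ W r, mean_sq_grad2 X r != 0 & quasi_umbilic eps r].
  have /cvgrPdist_lt/(_ _ ltr01) cs := csign.
  near=> r; have [Wr r0] : W r /\ mean_sq_grad2 X r != 0 by near: r.
  have [e e2 Tr] := qu r Wr r0; split; [exact: Wr|exact: r0|].
  have close : `|sign q - sign r| < 1 by near: r.
  rewrite signq (quasi_umbilic_sign Wr r0 Tr) in close.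
  by rewrite (sign_close eps2 e2 close).
pose U : set 'rV[R]_2 := interior [set r | [/\ W r, mean_sq_grad2 X r != 0 & quasi_umbilic eps r]].
have oU : open U by exact: open_interior.
have UW : U `<=` W by move=> r /interior_subset[].
have Uq : U q by [].
have form r : U r -> forall i j, mean_form X r i j =
    mean_sq X r * metric_mx X r i j + eps / 16 * (mean_sq X r * mean_sq X r)^-1 *
     (2 * partial i (mean_sq X) r * partial j (mean_sq X) r - mean_sq_grad2 X r * metric_mx X r i j).
  move=> /interior_subset[_ _ T] i j; rewrite T.
  have entry (a b c : R) (A B C : 'M[R]_2) :
      (a *: A + b *: (2 *: B - c *: C)) i j = a * A i j + b * (2 * B i j - c * C i j).
    by rewrite !mxE.
  rewrite entry; congr (_ + _ * (_ - _)); rewrite -mulrA; congr (_ * _).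
  by rewrite [LHS]mxE big_ord1 [_^T _ _]mxE ![mean_sq_diff _ _ _ _]mxE.
have := codazzi_mean_sq oW sX gW uW oU UW form Uq.
move=> /eqP; rewrite mulf_eq0 (negbTE W0)/= /mean_sq_balance.
have := uW Wq; move: (mean_sq X q) (mean_sq_grad2 X q) (mean_sq_trace_hessian X q).
move=> a b c a0 /eqP E.
have e0 : eps != 0 by rewrite -sqrf_eq0 eps2 oner_eq0.
suff -> : (4 * a * c - 5 * b) / (16 * a ^+ 3) = eps by [].
apply: (mulIf (_ : 16 * a ^+ 3 != 0)); first by rewrite mulf_neq0 ?expf_neq0 ?pnatr_eq0.
rewrite divfK; last by rewrite mulf_neq0 ?expf_neq0 ?pnatr_eq0.
(* Multiplication by [eps], with [eps ^+ 2 = 1], turns the goal into the contracted Codazzi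
   equation. *)
apply: (mulfI e0); rewrite mulrA -expr2 eps2 mul1r.
apply/eqP; rewrite -subr_eq0 -[X in _ == X](mulr0 (- 16 * a ^+ 2)) -E; apply/eqP.
by field; rewrite a0.
Unshelve. all: by end_near. Qed.

Lemma balance_constant U q : open U -> U `<=` W -> U q ->
  (forall r, U r -> mean_sq_grad2 X r = 0) -> mean_sq_balance q = 0.
Proof.
move=> oU UW Uq g0.
have w0 i r : U r -> partial i u r = 0.
  move=> Ur; have := mean_sq_grad2_eq0 gW (UW _ Ur) (g0 _ Ur).
  by move=> /rowP/(_ i); rewrite !mxE.
have h0 i j : local_hessian X u i j q = 0.
  rewrite /local_hessian (partial_eq_on (G := fun _ => 0) i oU Uq); last first.
    by move=> r /set_mem Ur; exact: w0.
  by rewrite partial_cst big1 ?subr0// => m _; rewrite (w0 m q Uq) scaler0.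
rewrite /mean_sq_balance (g0 _ Uq) /mean_sq_trace_hessian big1 ?mulr0 ?subr0 ?mul0r// => i _.
by rewrite big1// => j _; rewrite h0 mulr0.
Qed.

(** At a critical point the Christoffel terms of the Hessian vanish, so the second derivative test
    applies to the metric trace. *)
Lemma critical_balance q : W q -> (forall i, partial i u q = 0) ->
  mean_sq_grad2 X q = 0 /\
  mean_sq_trace_hessian X q * \det (metric_mx X q) =
    metric_mx X q 1 1 * partial 0 (partial 0 u) q
    - 2 * metric_mx X q 0 1 * partial 0 (partial 1 u) q
    + metric_mx X q 0 0 * partial 1 (partial 1 u) q.
Proof.
move=> Wq u0; have w0 : w q = 0 by apply/rowP => i; rewrite [LHS]mxE u0 mxE.
split; first by rewrite /mean_sq_grad2 -/(w q) w0 !mul0mx mxE.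
rewrite det_metric (mean_sq_trace_hessianE oW sX gW Wq).
have c0 i j : \sum_(m < 2) christoffel X i j m q * partial m u q = 0.
  by rewrite big1// => m _; rewrite u0 mulr0.
have alg (a b c x y z p r s : R) : p = 0 -> r = 0 -> s = 0 ->
    a * (x - p) - b * (y - r) + c * (z - s) = a * x - b * y + c * z.
  by move=> -> -> ->; rewrite !subr0.
exact: alg (c0 0 0) (c0 0 1) (c0 1 1).
Qed.

Lemma max_balance q : W q -> 0 < u q -> (forall r, W r -> u r <= u q) ->
  mean_sq_balance q <= 0.
Proof.
move=> Wq uq0 umax; have dg := det_metric_gt0 gW Wq.
have u0 i : partial i u q = 0 := local_max_partial oW Wq su umax i.
have Q := local_max_hessian oW Wq su umax.
have [W0 LE] := critical_balance Wq u0.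
rewrite /mean_sq_balance W0 mulr0 subr0 -/(u q).
have L0 : mean_sq_trace_hessian X q <= 0.
  rewrite -(pmulr_lle0 _ dg) LE; rewrite det_metric in dg.
  exact: trace_le0 (metric00_gt0 gW Wq) dg Q.
rewrite mulr_le0_ge0//; last by rewrite invr_ge0 mulr_ge0// exprn_ge0// ltW.
by rewrite mulr_ge0_le0// mulr_ge0// ltW.
Qed.

Lemma min_balance q : W q -> 0 < u q -> (forall r, W r -> u q <= u r) ->
  0 <= mean_sq_balance q.
Proof.
move=> Wq uq0 umin; have dg := det_metric_gt0 gW Wq.
have sNu := smoothN oW su.
have Nmax r : W r -> - u r <= - u q by move=> Wr; rewrite lerN2; exact: umin.
have pN (f : 'rV[R]_2 -> R) i r : smooth_on W f -> W r ->
    partial i (fun r => - f r) r = - partial i f r.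
  move=> sf Wr; have hf : has_partial i r f (partial i f r).
    by split => //; exact: smooth_derivable sf Wr.
  exact: (has_partialN hf).2.
have ppN i j : partial i (partial j (fun r => - u r)) q = - partial i (partial j u) q.
  rewrite -(pN (partial j u) i q (smooth_partial j su) Wq).
  by apply: (partial_eq_on _ oW Wq) => r /set_mem Wr; exact: pN.
have u0 i : partial i u q = 0.
  have := local_max_partial oW Wq sNu Nmax i.
  by rewrite (pN u i q su Wq) => /eqP; rewrite oppr_eq0 => /eqP.
have Q := local_max_hessian oW Wq sNu Nmax.
have [W0 LE] := critical_balance Wq u0.
rewrite /mean_sq_balance W0 mulr0 subr0 -/(u q).
have L0 : 0 <= mean_sq_trace_hessian X q.
  rewrite -(pmulr_lge0 _ dg) LE -oppr_le0.
  have alg (a b c x y z x' y' z' : R) : x' = - x -> y' = - y -> z' = - z ->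
      a * x' - b * y' + c * z' <= 0 -> - (a * x - b * y + c * z) <= 0.
    by move=> -> -> ->; apply: le_trans; rewrite le_eqVlt; apply/orP; left; apply/eqP; ring.
  rewrite det_metric in dg.
  exact: alg (ppN 0 0) (ppN 0 1) (ppN 1 1) (trace_le0 (metric00_gt0 gW Wq) dg Q).
rewrite mulr_ge0//; last by rewrite invr_ge0 mulr_ge0// exprn_ge0// ltW.
by rewrite mulr_ge0// mulr_ge0// ltW.
Qed.

End Balance.

(** * The global argument *)

Lemma within_continuous_open (T U : topologicalType) (A : set T) (f : T -> U) (a : T) :
  open A -> A a -> {within A, continuous f} -> {for a, continuous f}.
Proof.
move=> oA Aa; rewrite (continuous_open_subspace f oA) => cf; apply: cf.
by rewrite inE.
Qed.

Lemma dot_derive_metric (R : realType) (X : 'rV[R]_2 -> 'rV[R]_3) q (z z' : 'rV[R]_2) :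
  differentiable X q ->
  dot ('D_z X q) ('D_z' X q) = (z *m metric_mx X q *m z'^T) 0 0.
Proof.
move=> dX; have E y : 'D_y X q = \sum_(a < 2) y 0 a *: partial a X q.
  exact: etrans (derive_row2 y dX) (esym (sum2E (fun a => y 0 a *: partial a X q))).
rewrite (E z) (E z').
exact: (@gram_congruence R 3 1 1 z z' _ (fun a => partial a X q) 0 0 (metric_mxE X q)).
Qed.

Lemma dot_sums (R : realType) (n : nat) (I J : finType) (a : I -> R) (b : J -> R)
    (A : I -> 'rV[R]_n) (B : J -> 'rV[R]_n) :
  dot (\sum_i a i *: A i) (\sum_j b j *: B j) =
  \sum_i \sum_j a i * b j * dot (A i) (B j).
Proof.
rewrite dot_suml; apply: eq_bigr => i _; rewrite dotZl dotC dot_suml mulr_sumr.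
by apply: eq_bigr => j _; rewrite dotZl dotC mulrA.
Qed.

Lemma sum_delta2 (R : realType) (i j : 'I_2) (F : 'I_2 -> 'I_2 -> R) :
  \sum_(a < 2) \sum_(b < 2)
    (delta_mx 0 i : 'rV[R]_2) 0 a * (delta_mx 0 j : 'rV[R]_2) 0 b * F a b = F i j.
Proof.
rewrite (bigD1 i)//= (bigD1 j)//= !mxE !eqxx !mul1r !big1 ?addr0//.
  move=> a ai; apply: big1 => b _; rewrite !mxE (negbTE ai) andbF.
  by rewrite !mul0r.
by move=> b bj; rewrite !mxE (negbTE bj) andbF mulr0 mul0r.
Qed.

Lemma connected_three_values (R : realType) (T : topologicalType) (f : T -> R) :
  connected [set: T] -> continuous f -> (forall t, f t = 0 \/ f t ^+ 2 = 1) ->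
  forall s t, f s = f t.
Proof.
move=> cT cf val s t.
have /connected_intervalP I : connected [set f y | y in [set: T]].
  by apply: connected_continuous_connected => //; exact: continuous_subspaceT.
have no a b : (exists y, f y = a) -> (exists y, f y = b) -> ~ a < b.
  move=> [y ya] [y' yb] ab.
  (* A quarter of the way is never a third admissible value; the midpoint of -1 and 1 would be 0. *)
  have [r _ rE] : [set f y | y in [set: T]] (a + (b - a) / 4).
    apply: (I a b); [by exists y|by exists y'|].
    apply/andP; split; lra.
  have three (v : R) : v = 0 \/ v ^+ 2 = 1 -> [\/ v = 0, v = 1 | v = -1].
    move=> [->|/eqP]; first by constructor 1.
    by rewrite sqrf_eq1 => /orP[] /eqP ->; [constructor 2|constructor 3].
  have := three _ (val r); have := three _ (val y); have := three _ (val y').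
  rewrite rE ya yb.
  by move=> [] h1 [] h2 [] h3; lra.
have := no (f s) (f t) (ex_intro _ _ erefl) (ex_intro _ _ erefl).
have := no (f t) (f s) (ex_intro _ _ erefl) (ex_intro _ _ erefl).
by move=> /negP; rewrite -leNgt => h1 /negP; rewrite -leNgt => h2; apply/le_anti; rewrite h1 h2.
Qed.

(** * Invariants on the surface and their expressions in charts *)

Section Surface.
Context {R : realType} {M : topologicalType} (S : smooth_surface R M).
Variable x : M -> 'rV[R]_3.
Hypothesis imm : immersion S x.

Let c p := chart_at S p.
Let X p := in_coord S p x.
Let D p := chart_cod (c p).

Lemma chart_cod_coord p m : chart_dom (c p) m -> D p (chart_map (c p) m).
Proof. by move=> cm; exists m. Qed.

Lemma open_D p : open (D p).
Proof. exact: chart_cod_open. Qed.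

Lemma smooth_X p : smooth_on (D p) (X p).
Proof. by have [sx _] := imm; apply: sx; exact: chart_at_atlas. Qed.

Lemma D_coord p : D p (Defs.coord S p).
Proof. by apply: chart_cod_coord; exact: chart_at_dom. Qed.

Lemma metric_unit_center p : metric_mx (X p) (Defs.coord S p) \in unitmx.
Proof.
have [_ inj] := imm; rewrite unitmxE unitfE; apply/det0P => -[z z0 zg].
have dX : differentiable (X p) (Defs.coord S p).
  exact: smooth_differentiable_rV (@open_D p) (D_coord p) (smooth_X p).
have dz : dot (differential S x p z) (differential S x p z) = 0.
  by rewrite [LHS](dot_derive_metric z z dX) zg mul0mx mxE.
move/eqP: z0; apply; apply: (inj p); rewrite (dot_eq0 dz).
by rewrite /differential derive0.
Qed.

(** Invariants at [m] are computed in the chart attached to [m]; for limits and derivatives they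
    have to be carried into one fixed chart. [V] is the overlap of the two domains, seen in the
    chart of [m]. *)
Lemma transition m p : chart_dom (c p) m ->
  exists (V : set 'rV[R]_2) (phi : 'rV[R]_2 -> 'rV[R]_2),
    [/\ open V, smooth_on V phi, forall q, V q -> D p (phi q),
        {in V, X m =1 X p \o phi} & V `<=` D m] /\
    (V (Defs.coord S m) /\ phi (Defs.coord S m) = chart_map (c p) m).
Proof.
move=> cm; pose V := chart_map (c m) @` (chart_dom (c m) `&` chart_dom (c p)).
have mm : chart_dom (c m) m by exact: chart_at_dom.
exists V, (chart_map (c p) \o chart_inv (c m)); split; last first.
  split; first by exists m.
  by rewrite /= /Defs.coord (chart_mapK mm).
have VE : V = D m `&` chart_inv (c m) @^-1` chart_dom (c p).
  apply/seteqP; split=> [q [n [n1 n2] <-]|q [[n n1 <-]]].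
    by split; [exact: chart_cod_coord|rewrite /preimage/= (chart_mapK n1)].
  by rewrite /preimage/= (chart_mapK n1) => n2; exists n.
split.
- rewrite openE => q; rewrite VE => -[Dq cq].
  have ci := within_continuous_open (@open_D m) Dq (chart_inv_cont (c:=c m)).
  apply: filterI; first exact: open_nbhs_nbhs (conj (@open_D m) Dq).
  apply: ci; apply: open_nbhs_nbhs; split => //; exact: chart_dom_open.
- exact: (atlas_compatible (chart_at_atlas S m) (chart_at_atlas S p)).
- by move=> q [n [n1 n2] <-]; rewrite /= (chart_mapK n1); exact: chart_cod_coord.
- move=> q /set_mem [n [n1 n2] <-]; rewrite /= /X /in_coord /=.
  by rewrite (chart_mapK n1) (chart_mapK n2).
- by rewrite VE => q [].
Qed.

(** The immersion property is stated at each point in its own preferred chart. The transition from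
    the chart of [m] to that of [p] carries it to the other points of the latter. *)
Lemma metric_unit p r : D p r -> metric_mx (X p) r \in unitmx.
Proof.
move=> [m cm <-]; have [V [phi [[oV sphi phiD XE VD] [Vm phim]]]] := transition cm.
have [_] := reparam_unit oV (@open_D p) (smooth_X p) sphi phiD XE Vm (metric_unit_center m).
by rewrite phim.
Qed.

Section Invariants.
Variables (m p : M) (cm : chart_dom (c p) m).

Let smooth_restrict (V : set 'rV[R]_2) : V `<=` D m -> smooth_on V (X m).
Proof. by move=> VD; exact: smooth_sub VD (smooth_X m). Qed.

Lemma mean_curvature_vector_chart :
  local_mean_curvature_vector (X m) (Defs.coord S m) =
  local_mean_curvature_vector (X p) (chart_map (c p) m).
Proof.
have [V [phi [[oV sphi phiD XE VD] [Vm phim]]]] := transition cm.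
rewrite -phim; apply: (mean_curvature_vector_reparam oV (@open_D p) (smooth_X p) sphi phiD XE
  (smooth_restrict VD) (@metric_unit p) _ Vm).
by move=> q /VD; exact: metric_unit.
Qed.

Lemma mean_sq_chart :
  mean_sq (X m) (Defs.coord S m) = mean_sq (X p) (chart_map (c p) m).
Proof. by rewrite /mean_sq mean_curvature_vector_chart. Qed.

Lemma mean_sq_grad2_chart :
  mean_sq_grad2 (X m) (Defs.coord S m) = mean_sq_grad2 (X p) (chart_map (c p) m).
Proof.
have [V [phi [[oV sphi phiD XE VD] [Vm phim]]]] := transition cm.
rewrite -phim; apply: (mean_sq_grad2_reparam oV (@open_D p) (smooth_X p) sphi phiD XE
  (smooth_restrict VD) (@metric_unit p) _ Vm).
by move=> q /VD; exact: metric_unit.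
Qed.

Lemma mean_sq_balance_chart :
  mean_sq_balance (X m) (Defs.coord S m) = mean_sq_balance (X p) (chart_map (c p) m).
Proof.
have [V [phi [[oV sphi phiD XE VD] [Vm phim]]]] := transition cm.
have gV q : V q -> metric_mx (X m) q \in unitmx by move=> /VD; exact: metric_unit.
rewrite /mean_sq_balance mean_sq_chart mean_sq_grad2_chart.
have := mean_sq_trace_hessian_reparam oV (@open_D p) (smooth_X p) sphi phiD XE
  (smooth_restrict VD) (@metric_unit p) gV Vm.
by rewrite phim => ->.
Qed.

Lemma quasi_umbilic_chart eps : quasi_umbilic (X m) eps (Defs.coord S m) ->
  quasi_umbilic (X p) eps (chart_map (c p) m).
Proof.
have [V [phi [[oV sphi phiD XE VD] [Vm phim]]]] := transition cm.
have gV q : V q -> metric_mx (X m) q \in unitmx by move=> /VD; exact: metric_unit.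
rewrite -phim; exact: (tensor_reparam oV (@open_D p) (smooth_X p) sphi phiD XE
  (smooth_restrict VD) (@metric_unit p) gV Vm).
Qed.

End Invariants.

Hypothesis alpha_neq0 : forall p, mean_curvature S x p != 0.

Let z p := Defs.coord S p.
Let u p := mean_sq (X p) (z p).
Let grad p : 'rV[R]_2 := mean_sq_diff (X p) (z p) *m metric_inv (X p) (z p).

Lemma mean_curvature_sq p : mean_curvature S x p ^+ 2 = u p.
Proof. exact: enorm_sq. Qed.

Lemma mean_sq_pos p r : D p r -> 0 < mean_sq (X p) r.
Proof.
move=> [m cm <-]; rewrite -(mean_sq_chart cm) -/(u m) -mean_curvature_sq.
by rewrite exprn_even_gt0//= alpha_neq0.
Qed.

Lemma mean_sq_neq0 p r : D p r -> mean_sq (X p) r != 0.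
Proof. by move=> /mean_sq_pos; exact: lt0r_neq0. Qed.

Lemma in_coord_sq p :
  {in D p, in_coord S p (fun q => mean_curvature S x q ^+ 2) =1 mean_sq (X p)}.
Proof.
move=> r /set_mem [m cm <-]; rewrite /in_coord /= (chart_mapK cm) mean_curvature_sq.
exact: mean_sq_chart.
Qed.

Lemma in_coord_sqrt p :
  {in D p, in_coord S p (mean_curvature S x) =1 Num.sqrt \o mean_sq (X p)}.
Proof.
move=> r Dr; rewrite /= -(in_coord_sq Dr) /in_coord /= sqrtr_sqr ger0_norm//.
exact: sqrtr_ge0.
Qed.

Lemma gradient_sq p : gradient S x (fun q => mean_curvature S x q ^+ 2) p = grad p.
Proof.
rewrite /gradient /local_gradient /grad; congr (_ *m _); apply/rowP => i.
rewrite [LHS]mxE [RHS]mxE.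
exact: (partial_eq_on i (@open_D p) (D_coord p) (@in_coord_sq p)).
Qed.

Let smooth_mean_sq p : smooth_on (D p) (mean_sq (X p)).
Proof.
have sH := smooth_mean_curvature_vector (@open_D p) (smooth_X p) (@metric_unit p).
exact: (smooth_dot (@open_D p) sH sH).
Qed.

(** Differentiates [alpha * alpha = u]; positivity of [u] makes the square root differentiable. *)
Lemma partial_mean_curvature p i :
  2 * mean_curvature S x p * partial i (in_coord S p (mean_curvature S x)) (z p)
  = partial i (mean_sq (X p)) (z p).
Proof.
have Dz := D_coord p.
have du := smooth_differentiable (@open_D p) Dz (@smooth_mean_sq p).
have ds : differentiable (Num.sqrt \o mean_sq (X p)) (z p).
  apply: differentiable_comp => //; apply/derivable1_diffP.
  by have [] := is_derive1_sqrt (mean_sq_pos Dz).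
have dsi : derivable (Num.sqrt \o mean_sq (X p)) (z p) (delta_mx 0 i).
  exact: diff_derivable.
have aE : in_coord S p (mean_curvature S x) (z p) = mean_curvature S x p.
  by rewrite /in_coord /= /z /Defs.coord chart_mapK//; exact: chart_at_dom.
have E := @in_coord_sqrt p.
rewrite (partial_eq_on i (@open_D p) Dz E) -aE (E _ (mem_set Dz)).
have := partialM dsi dsi.
have -> : partial i (fun r => (Num.sqrt \o mean_sq (X p)) r * (Num.sqrt \o mean_sq (X p)) r) (z p)
   = partial i (mean_sq (X p)) (z p).
  apply: (partial_eq_on i (@open_D p) Dz) => r /set_mem Dr.
  have sq (a : R) : 0 <= a -> Num.sqrt a * Num.sqrt a = a by move=> a0; rewrite -expr2 sqr_sqrtr.
  exact: (sq _ (ltW (mean_sq_pos Dr))).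
move=> ->; move: ((_ \o _) (z p)) (partial i _ _) => a b; ring.
Qed.

Lemma gradient_mean_curvature p :
  gradient S x (mean_curvature S x) p = (2 * mean_curvature S x p)^-1 *: grad p.
Proof.
rewrite /gradient /local_gradient /grad scalemxAl; congr (_ *m _); apply/rowP => i.
rewrite [LHS]mxE [RHS]mxE [mean_sq_diff _ _ _ _]mxE -partial_mean_curvature mulKf//.
by rewrite mulf_neq0// pnatr_eq0.
Qed.

Lemma metric_grad p : metric S x p (grad p) (grad p) = mean_sq_grad2 (X p) (z p).
Proof.
have Dz := D_coord p.
have dX := smooth_differentiable_rV (@open_D p) Dz (smooth_X p).
apply: etrans (dot_derive_metric (grad p) (grad p) dX) _.
rewrite /grad mulmxKV; last exact: metric_unit.
by rewrite trmx_mul metric_inv_sym mulmxA.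
Qed.

(** The gradient of [alpha] is that of [u] divided by [2 alpha], so its norm to the fourth is
    [W^2 / (16 u^2)], and [16 alpha^6 = 16 u^3] supplies the other factor of [256 u^5]. *)
Lemma norm_gradient p :
  (16 * mean_curvature S x p ^+ 6)^-1
    * metric_norm S x p (gradient S x (mean_curvature S x) p) ^+ 4
  = mean_sq_grad2 (X p) (z p) ^+ 2 / (256 * u p ^+ 5).
Proof.
have Dz := D_coord p.
have n0 v : 0 <= metric S x p v v by exact: dot_ge0.
have e4 (a : R) : a ^+ 4 = (a ^+ 2) ^+ 2 by rewrite -exprM.
rewrite /metric_norm e4 sqr_sqrtr; last exact: n0.
have dX := smooth_differentiable_rV (@open_D p) Dz (smooth_X p).
have mZ k v : metric S x p (k *: v) (k *: v) = k ^+ 2 * metric S x p v v.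
  apply: etrans (dot_derive_metric (k *: v) (k *: v) dX) _.
  have -> : metric S x p v v = (v *m metric_mx (X p) (z p) *m v^T) 0 0.
    exact: dot_derive_metric dX.
  by rewrite linearZ/= -!scalemxAl -scalemxAr scalerA mxE expr2.
rewrite gradient_mean_curvature mZ metric_grad -mean_curvature_sq.
by move: (mean_curvature S x p) (alpha_neq0 p) (mean_sq_grad2 _ _) => a a0 b; field.
Qed.

Lemma gauss_equation p :
  gauss_curvature S x p = mean_curvature S x p ^+ 2
       - (16 * mean_curvature S x p ^+ 6)^-1
         * metric_norm S x p (gradient S x (mean_curvature S x) p) ^+ 4
  <-> \det (local_shape_mx (X p) (z p)) =
      u p - mean_sq_grad2 (X p) (z p) ^+ 2 / (256 * u p ^+ 5).
Proof. by rewrite norm_gradient mean_curvature_sq. Qed.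

(** [local_hessian] of the immersion itself is [local_second_form], so its Laplacian is minus the
    trace of the second fundamental form. *)
Lemma in_coord_laplace p : {in D p, in_coord S p (laplace_map S x)
  =1 fun r => (-2 : R) *: local_mean_curvature_vector (X p) r}.
Proof.
move=> r /set_mem [m cm <-]; rewrite -(mean_curvature_vector_chart cm).
rewrite /in_coord /= (chart_mapK cm) /laplace_map /laplacian /local_laplacian.
rewrite /local_mean_curvature_vector scalerA mulNr divff ?pnatr_eq0// scaleN1r.
by [].
Qed.

Let H p := local_mean_curvature_vector (X p).

Lemma differential_laplace p v v' :
  dot (differential S (laplace_map S x) p v) (differential S (laplace_map S x) p v')
  = 4 * \sum_(i < 2) \sum_(j < 2) v 0 i * v' 0 j * dot (partial i (H p) (z p)) (partial j (H p) (z p)).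
Proof.
have Dz := D_coord p.
have sH : smooth_on (D p) (H p).
  exact: smooth_mean_curvature_vector (@open_D p) (smooth_X p) (@metric_unit p).
have dH := smooth_differentiable_rV (@open_D p) Dz sH.
have E y : differential S (laplace_map S x) p y =
    (-2 : R) *: \sum_(i < 2) y 0 i *: partial i (H p) (z p).
  rewrite /differential.
  rewrite (near_eq_derive _ (open_near_eq (@open_D p) Dz (@in_coord_laplace p))).
  have -> : 'D_y (fun r => (-2 : R) *: H p r) (z p) = (-2 : R) *: 'D_y (H p) (z p).
    exact: (@deriveZ _ _ _ (H p) (-2) (z p) y (diff_derivable dH)).
  congr (_ *: _).
  exact: etrans (derive_row2 y dH) (esym (sum2E (fun a => y 0 a *: partial a (H p) (z p)))).
rewrite (E v) (E v') dotZl dotZr mulrA mulrNN -natrM; congr (_ * _).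
exact: dot_sums.
Qed.

Lemma metric_sum p v v' : metric S x p v v' =
  \sum_(i < 2) \sum_(j < 2) v 0 i * v' 0 j * metric_mx (X p) (z p) i j.
Proof.
have dX := smooth_differentiable_rV (@open_D p) (D_coord p) (smooth_X p).
apply: etrans (dot_derive_metric v v' dX) _.
rewrite -mulmxA mxE; apply: eq_bigr => i _; rewrite mxE mulr_sumr.
by apply: eq_bigr => j _; rewrite [_^T _ _]mxE mulrA mulrAC.
Qed.

Let local_conditions p :=
  (grad p != 0 -> exists kappa, grad p *m local_shape_mx (X p) (z p) = kappa *: grad p) /\
  \det (local_shape_mx (X p) (z p)) =
    mean_sq (X p) (z p) - mean_sq_grad2 (X p) (z p) ^+ 2 / (256 * mean_sq (X p) (z p) ^+ 5).

Lemma conformal_local_conditions :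
  conformal_laplace_transformation S x -> forall p, local_conditions p.
Proof.
move=> [rho [rho0 conf]] p.
(* The divisor 4 comes from the factor [-2] between the Laplace map and [H]. *)
have eqH i j : dot (partial i (H p) (z p)) (partial j (H p) (z p)) =
    (rho p ^+ 2 / 4) * metric_mx (X p) (z p) i j.
  have := conf p (delta_mx 0 i) (delta_mx 0 j).
  rewrite differential_laplace metric_sum !sum_delta2.
  have alg (a b k : R) : 4 * a = k * b -> a = k / 4 * b by move=> h; lra.
  exact: alg.
have [] := conformal_pointwise (@open_D p) (smooth_X p) (@metric_unit p)
  (@mean_sq_neq0 p) (D_coord p) eqH.
by move=> h1 h2; split => // _; exact: h1.
Qed.

Let balance p := mean_sq_balance (X p) (z p).

(** Each value [f m] is defined through the chart of [m]; continuity at [p] is tested in the chart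
    of [p] alone. *)
Lemma continuous_in_charts (f : M -> R) (F : M -> 'rV[R]_2 -> R) :
  (forall p, smooth_on (D p) (F p)) ->
  (forall p m, chart_dom (c p) m -> f m = F p (chart_map (c p) m)) -> continuous f.
Proof.
move=> sF fE p; have pp : chart_dom (c p) p by exact: chart_at_dom.
apply: (@near_eq_continuous _ _ (F p \o chart_map (c p))).
  apply: filterS (open_nbhs_nbhs (conj (@chart_dom_open _ _ (c p)) pp)) => m cm.
  exact/esym/fE.
apply: continuous_comp.
  exact: (within_continuous_open (@chart_dom_open _ _ (c p)) pp (@chart_map_cont _ _ (c p))).
exact: smooth_continuous (sF p) (D_coord p).
Qed.

Lemma continuous_mean_sq : continuous u.
Proof. exact: (continuous_in_charts smooth_mean_sq (fun p m cm => mean_sq_chart cm)). Qed.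

Lemma continuous_balance : continuous balance.
Proof.
apply: (continuous_in_charts (F := fun p => mean_sq_balance (X p))).
  by move=> p; exact: smooth_mean_sq_balance (@open_D p) (smooth_X p) (@metric_unit p) (@mean_sq_neq0 p).
by move=> p m cm; exact: mean_sq_balance_chart cm.
Qed.

(** * The converse: from the pointwise conditions to umbilicity *)

Hypothesis loc : forall p, local_conditions p.

Lemma grad2_neq0_quasi_umbilic p r : D p r -> mean_sq_grad2 (X p) r != 0 ->
  exists2 eps, eps ^+ 2 = 1 & quasi_umbilic (X p) eps r.
Proof.
move=> [m cm <-]; rewrite -(mean_sq_grad2_chart cm) => W0.
have [l1 l2] := loc m.
have := tensor_pointwise (@open_D m) (smooth_X m) (@metric_unit m) (@mean_sq_neq0 m)
  (D_coord m) l1 l2.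
rewrite (negbTE W0) => -[eps e2 T]; exists eps; first exact: e2.
exact: (quasi_umbilic_chart cm T).
Qed.

Lemma balance_sq p : mean_sq_grad2 (X p) (z p) != 0 -> balance p ^+ 2 = 1.
Proof.
move=> W0; exact: (balance_square (@open_D p) (smooth_X p) (@metric_unit p) (@mean_sq_neq0 p)
  (D_coord p) W0 (@grad2_neq0_quasi_umbilic p)).
Qed.

(** Either [W] vanishes near [p], or [p] is a limit of points where [W] is nonzero, and there the
    square of [balance] is 1. *)
Lemma balance_values p : balance p = 0 \/ balance p ^+ 2 = 1.
Proof.
have [[A nA]|noA] := pselect (exists2 A, nbhs p A &
    forall m, A m -> mean_sq_grad2 (X m) (z m) = 0).
  move=> A0; left.
  pose U := interior (D p `&` chart_inv (c p) @^-1` A).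
  have inA m : D p m -> A (chart_inv (c p) m) -> mean_sq_grad2 (X p) m = 0.
    move=> [n cn <-]; rewrite chart_mapK// => An.
    by rewrite -(mean_sq_grad2_chart cn); exact: A0.
  apply: (balance_constant (@metric_unit p) (U := U)).
  - exact: open_interior.
  - by move=> m /interior_subset[].
  - have ci := within_continuous_open (@open_D p) (D_coord p) (chart_inv_cont (c:=c p)).
    apply: filterI; first exact: open_nbhs_nbhs (conj (@open_D p) (D_coord p)).
    by apply: ci; rewrite chart_mapK//; exact: chart_at_dom.
  - by move=> m /interior_subset[]; exact: inA.
right; apply: contrapT => b1; apply: noA.
(* If the square differed from 1 at [p], it would do so on this neighbourhood, where [balance_sq]
   then forces [W] to vanish. *)
exists [set m | balance m ^+ 2 != 1]; last first.
  move=> m bm; have {}bm : balance m ^+ 2 != 1 := bm.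
  by apply/eqP; apply: contraNT bm => W0; apply/eqP; exact: balance_sq.
have cb : {for p, continuous (fun m => balance m * balance m - 1)}.
  apply: continuousB; last exact: cst_continuous.
  by apply: continuousM; exact: continuous_balance.
have b1' : balance p * balance p - 1 != 0 by rewrite subr_eq0 -expr2; apply/eqP.
by apply: filterS (cvgr_neq0 _ cb b1') => m; rewrite subr_eq0 -expr2.
Qed.

Hypothesis M_compact : compact [set: M].
Hypothesis M_connected : connected [set: M].

Lemma balance0 p : balance p = 0.
Proof.
have bc := connected_three_values M_connected continuous_balance balance_values.
have ne : [set: M] !=set0 by exists p.
have cu : {within [set: M], continuous u} by apply: continuous_subspaceT; exact: continuous_mean_sq.
have [a _ amax] := compact_EVT_max ne M_compact cu.
have [b _ bmin] := compact_EVT_min ne M_compact cu.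
apply/le_anti/andP; split.
  rewrite (bc p a).
  apply: (max_balance (@open_D a) (smooth_X a) (@metric_unit a) (D_coord a)).
    exact: mean_sq_pos (D_coord a).
  move=> r [m cm <-]; rewrite -(mean_sq_chart cm); apply: amax; exact: in_setT.
rewrite (bc p b).
apply: (min_balance (@open_D b) (smooth_X b) (@metric_unit b) (D_coord b)).
  exact: mean_sq_pos (D_coord b).
move=> r [m cm <-]; rewrite -(mean_sq_chart cm); apply: bmin; exact: in_setT.
Qed.

Lemma mean_sq_grad2_vanishes p : mean_sq_grad2 (X p) (z p) = 0.
Proof.
apply/eqP; apply: contraT => /balance_sq /eqP.
by rewrite balance0 expr0n/= eq_sym oner_eq0.
Qed.

Lemma local_conditions_conformal : conformal_laplace_transformation S x.
Proof.
(* At an umbilic point with [W = 0] the derivative of [H] stretches lengths by [u], and the Laplace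
   map is [-2 H]. *)
exists (fun p => 2 * u p); split=> [p|p v w].
  by rewrite mulr_gt0// (mean_sq_pos (D_coord p)).
rewrite differential_laplace metric_sum.
have W0 := mean_sq_grad2_vanishes p; have [l1 l2] := loc p.
have := tensor_pointwise (@open_D p) (smooth_X p) (@metric_unit p) (@mean_sq_neq0 p)
  (D_coord p) l1 l2.
rewrite {1}W0 eqxx => B.
have E i j := umbilic_conformal (@open_D p) (smooth_X p) (@metric_unit p) (@mean_sq_neq0 p)
  i j (D_coord p) W0 B.
have alg (F G : 'I_2 -> 'I_2 -> R) (k : R) : (forall i j, F i j = k ^+ 2 * G i j) ->
    4 * (\sum_(i < 2) \sum_(j < 2) v 0 i * w 0 j * F i j) =
    (2 * k) ^+ 2 * \sum_(i < 2) \sum_(j < 2) v 0 i * w 0 j * G i j.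
  move=> FG; rewrite !sum2E !FG; ring.
exact: alg.
Qed.

End Surface.

Theorem theorem3p2 (R : realType) (M : topologicalType)
    (S : smooth_surface R M) (x : M -> 'rV[R]_3)
    (M_compact : compact [set: M]) (M_connected : connected [set: M])
    (x_immersion : immersion S x)
    (alpha_neq0 : forall p : M, mean_curvature S x p != 0) :
  conformal_laplace_transformation S x <->
  (forall p : M,
     gradient S x (fun q => mean_curvature S x q ^+ 2) p != 0 ->
     principal_direction S x p
       (gradient S x (fun q => mean_curvature S x q ^+ 2) p)) /\
  (forall p : M,
     gauss_curvature S x p =
       mean_curvature S x p ^+ 2
       - (16 * mean_curvature S x p ^+ 6)^-1
         * metric_norm S x p (gradient S x (mean_curvature S x) p) ^+ 4).
Proof.
split=> [conf|[principal gauss]].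
  have loc := conformal_local_conditions x_immersion alpha_neq0 conf.
  split=> p; last first.
    by apply/(gauss_equation x_immersion alpha_neq0); have [] := loc p.
  rewrite (gradient_sq x_immersion) => g0; split; first exact: g0.
  by have [l1 _] := loc p; exact: l1.
apply: (local_conditions_conformal x_immersion alpha_neq0 _ M_compact M_connected) => p; split.
  have := principal p; rewrite (gradient_sq x_immersion) => pr g0.
  by have [_] := pr g0.
exact/(gauss_equation x_immersion alpha_neq0).
Qed.
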